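(* Let $G$ be a cohomologically quasi-Boolean pro-$2$ group. Then for every $i>0$ there is a natural homomorphism $$\pi_i\colon H^i(G,\mathbb Z/2\mathbb Z)\to C(\mathcal X^*(G),\mathbb Z/2\mathbb Z)$$ which is an isomorphism for $i>1$ and surjective for $i=1$.
   Context: $H^\bullet(G,\mathbb Z/2\mathbb Z)$ is continuous cohomology. $\mathcal Y^*(G)$ denotes the set of elements of order exactly $2$ of $G$ with the subspace topology, and $\mathcal X^*(G)$ the set of conjugacy classes of such elements, with the quotient topology from $\mathcal Y^*(G)$. $C(\mathcal X^*(G),\mathbb Z/2\mathbb Z)$ is the ring of continuous functions $\mathcal X^*(G)\to\mathbb Z/2\mathbb Z$, the target being discrete. The natural homomorphism $\pi_i$ is the restriction map to subgroups of order two: for $c\in H^i(G,\mathbb Z/2\mathbb Z)$ the value of $\pi_i(c)$ at the conjugacy class of an involution $y\in G$ is the restriction of $c$ to $H^i(\langle y\rangle,\mathbb Z/2\mathbb Z)=\mathbb Z/2\mathbb Z$. A Boolean ring is a (commutative, unital) ring with $x^2=x$ for all $x$ (this includes the zero ring). A graded Boolean algebra is a graded $\mathbb F_2$-algebra $B^\bullet=\bigoplus_{i\ge0}B^i$ with $B^0=\mathbb F_2$ for which there is a Boolean ring $B$ such that $B^i=B$ for every $i\ge1$ and for all $i,j\ge 1$ the multiplication $B^i\times B^j\to B^{i+j}$ is the multiplication of $B$. A dual algebra is a graded $\mathbb F_2$-algebra $D^\bullet$ with $D^0=\mathbb F_2$ and $D^i=0$ for $i\ge2$. The connected sum $D^\bullet\sqcap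 B^\bullet$ has degree $0$ part $\mathbb F_2$, degree $i$ part $D^i\oplus B^i$ for $i\ge1$, with products $D^1B^i$ and $B^iD^1$ zero for all $i\ge1$. A pro-$2$ group $G$ is cohomologically quasi-Boolean if $H^\bullet(G,\mathbb F_2)$ is (isomorphic as a graded algebra to) the connected sum of a dual algebra and a graded Boolean algebra. *)

(* Defs.v *)
From HB Require Import structures.
From mathcomp Require Import all_boot all_order all_algebra.
From mathcomp Require Import all_classical topology.
Set Implicit Arguments.
Unset Strict Implicit.
Unset Printing Implicit Defensive.
Import GRing.Theory.
Local Open Scope classical_set_scope.
Local Open Scope ring_scope.

HB.mixin Record isTopologicalGroup G of Group G & Topological G := {
  mulg_continuous : continuous (fun p : G * G => (p.1 * p.2)%g);
  invg_continuous : continuous (fun x : G => x^-1%g)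
}.

#[short(type="topGroupType")]
HB.structure Definition TopologicalGroup :=
  {G of isTopologicalGroup G & Group G & Topological G}.

Section Subgroups.
Variable G : topGroupType.

Record subgroup := Subgroup {
  subgroup_set :> set G;
  subgroup_closed : group_closed (mem subgroup_set)
}.

Definition normal_subgroup (U : subgroup) : Prop :=
  forall x u : G, u \in (U : set G) -> (u ^ x)%g \in (U : set G).

Definition left_cosets (U : subgroup) : set (set G) :=
  [set [set (x * u)%g | u in (U : set G)] | x in [set: G]].

(* Profinite, with every open normal subgroup of 2-power index. *)
Definition is_pro2 : Prop :=
  [/\ compact [set: G], hausdorff_space G, totally_disconnected [set: G]
    & forall U : subgroup, open (U : set G) -> normal_subgroup U ->
        exists n : nat, (left_cosets U #= `I_(2 ^ n))%card].

Definition subgroup_type (U : subgroup) : Type := set_type U.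

Section SubgroupType.
Variable U : subgroup.
HB.instance Definition _ := SubChoice.on (subgroup_type U).
HB.instance Definition _ := Topological.on (subgroup_type U).

HB.instance Definition _ :=
  SubChoice_isSubGroup.Build G _ (subgroup_type U) (subgroup_closed U).

Lemma val_subgroup_continuous : continuous (val : subgroup_type U -> G).
Proof. exact: initial_continuous. Qed.

Lemma subgroup_mulg_continuous :
  continuous (fun p : subgroup_type U * subgroup_type U => (p.1 * p.2)%g).
Proof.
apply: (@continuous_comp_initial _ _ _ (set_val : subgroup_type U -> G)).
have -> : (set_val : subgroup_type U -> G) \o
    (fun p : subgroup_type U * subgroup_type U => (p.1 * p.2)%g) =
    (fun p : G * G => (p.1 * p.2)%g) \o (fun p => (val p.1, val p.2)) by [].
move=> p; apply: continuous_comp; last exact: mulg_continuous.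
apply: cvg_pair.
  apply: (@continuous_comp _ _ _ fst (val : subgroup_type U -> G)).
    exact: cvg_fst.
  exact: val_subgroup_continuous.
apply: (@continuous_comp _ _ _ snd (val : subgroup_type U -> G)).
  exact: cvg_snd.
exact: val_subgroup_continuous.
Qed.

Lemma subgroup_invg_continuous :
  continuous (fun x : subgroup_type U => x^-1%g).
Proof.
apply: (@continuous_comp_initial _ _ _ (set_val : subgroup_type U -> G)).
have -> : (set_val : subgroup_type U -> G) \o
    (fun x : subgroup_type U => x^-1%g) = (fun x : G => x^-1%g) \o val by [].
move=> x; apply: continuous_comp; first exact: val_subgroup_continuous.
exact: invg_continuous.
Qed.

HB.instance Definition _ := isTopologicalGroup.Build (subgroup_type U)
  subgroup_mulg_continuous subgroup_invg_continuous.
End SubgroupType.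

Lemma generated_subgroup_closed (A : set G) :
  group_closed (mem (smallest (fun H : set G => group_closed (mem H)) A)).
Proof.
split=> [|x y]; first by apply: mem_set => H [[H1 _] _]; exact: set_mem H1.
move=> /set_mem Hx /set_mem Hy; apply: mem_set => H HA.
have [[_ HV] _] := HA; apply: set_mem; apply: HV; apply: mem_set.
  exact: Hx HA.
exact: Hy HA.
Qed.

Definition generated (A : set G) : subgroup :=
  Subgroup (generated_subgroup_closed A).
End Subgroups.

Section ContF2.
Variable T : topologicalType.

Definition continuousF2 (f : T -> 'F_2) : Prop :=
  continuous (f : T -> discrete_topology 'F_2).

Lemma continuousF2P (f : T -> 'F_2) :
  continuousF2 f <-> forall x, \forall y \near x, f y = f x.
Proof.
split=> [fc x|fl x A /=].
  by apply: (fc x [set f x]); exact: discrete_set1.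
rewrite nbhs_principalE => /principal_filterP Afx.
by apply: filterS (fl x) => y /= ->.
Qed.

Record contF2 := ContF2 {
  contF2_fun :> T -> 'F_2;
  contF2P : `[< continuousF2 contF2_fun >]
}.
HB.instance Definition _ := [isSub for contF2_fun].
HB.instance Definition _ := [Choice of contF2 by <:].

Lemma contF2_subring_closed :
  subring_closed [pred f : T -> 'F_2 | `[< continuousF2 f >]].
Proof.
split=> [|f g /asboolP/continuousF2P fc /asboolP/continuousF2P gc
         |f g /asboolP/continuousF2P fc /asboolP/continuousF2P gc];
  apply/asboolP/continuousF2P => x; first exact: nearW.
- by apply: filterS2 (fc x) (gc x) => y /= fy gy; rewrite !fctE fy gy.
- by apply: filterS2 (fc x) (gc x) => y /= fy gy; rewrite !fctE fy gy.
Qed.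

HB.instance Definition _ :=
  GRing.SubChoice_isSubComPzRing.Build (T -> 'F_2) _ contF2 contF2_subring_closed.
End ContF2.
Section ContF2Comp.
Variables (X Y : topologicalType) (h : X -> Y) (hc : continuous h).

Lemma contF2_comp_subproof (f : contF2 Y) : `[< continuousF2 (f \o h) >].
Proof.
apply/asboolP => x; apply: continuous_comp; first exact: hc.
by have /asboolP := contF2P f; apply.
Qed.

Definition contF2_comp (f : contF2 Y) : contF2 X :=
  ContF2 (contF2_comp_subproof f).

Lemma contF2_comp_is_zmod_morphism : zmod_morphism contF2_comp.
Proof. by move=> f g; apply: val_inj. Qed.
HB.instance Definition _ :=
  GRing.isZmodMorphism.Build _ _ contF2_comp contF2_comp_is_zmod_morphism.
End ContF2Comp.

Lemma contF2_sumE (T : topologicalType) (I : Type) (r : seq I) (P : pred I)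
    (F : I -> contF2 T) (x : T) :
  (\sum_(i <- r | P i) F i) x = \sum_(i <- r | P i) F i x.
Proof. exact: (big_morph (fun f : contF2 T => f x)). Qed.

Lemma contF2_addE (T : topologicalType) (f g : contF2 T) x :
  (f + g) x = f x + g x.
Proof. by []. Qed.

Lemma contF2_oppE (T : topologicalType) (f : contF2 T) x : (- f) x = - f x.
Proof. by []. Qed.

Lemma contF2_mulE (T : topologicalType) (f g : contF2 T) x :
  (f * g) x = f x * g x.
Proof. by []. Qed.

Lemma contF2_0E (T : topologicalType) (x : T) : (0 : contF2 T) x = 0.
Proof. by []. Qed.

Lemma contF2_eq (T : topologicalType) (f g : contF2 T) :
  (forall x, f x = g x) -> f = g.
Proof. by move=> fg; apply: val_inj; apply: funext. Qed.

Lemma contF2_char2 (T : topologicalType) (f : contF2 T) : f + f = 0.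
Proof.
by apply: contF2_eq => x; rewrite contF2_addE (addrr_pchar2 (pchar_Fp (isT : prime 2))).
Qed.

Lemma ptws_continuous (X : topologicalType) (I : Type) (T : topologicalType)
    (h : X -> {ptws I -> T}) :
  (forall i, continuous (h^~ i)) -> continuous h.
Proof.
move=> hc x; apply/cvg_sup => i.
exact: (@continuous_comp_initial _ _ _ (fun f : I -> T => f i) h (hc i) x).
Qed.

Lemma ptws_proj_continuous (I : Type) (T : topologicalType) (i : I) :
  continuous (fun f : {ptws I -> T} => f i).
Proof. exact: (@proj_continuous {classic I} (fun=> T) i). Qed.

Section Cohomology.
Variable G : topGroupType.

Definition cochain (n : nat) : Type := contF2 {ptws 'I_n -> G}.
HB.instance Definition _ n := GRing.ComPzRing.on (cochain n).

(* The k-th face (x_0, ..., x_n) |-> (..., x_(k-1) * x_k, ...) for 0 < k <= n;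
   the faces k = 0 and k = n + 1 delete x_0 and x_n respectively. *)
Definition face n (k : 'I_n.+2) (x : {ptws 'I_n.+1 -> G}) : {ptws 'I_n -> G} :=
  fun j => let xj := x (widen_ord (leqnSn n) j) in let xj1 := x (lift ord0 j) in
    if (j.+1 < k)%N then xj else if j.+1 == k then (xj * xj1)%g else xj1.

Lemma face_continuous n (k : 'I_n.+2) : continuous (@face n k).
Proof.
apply: ptws_continuous => j; rewrite /face.
case: (j.+1 < k)%N; first exact: ptws_proj_continuous.
case: (j.+1 == k); last exact: ptws_proj_continuous.
move=> x; pose h (x : {ptws 'I_n.+1 -> G}) :=
  (x (widen_ord (leqnSn n) j), x (lift ord0 j)).
apply: (@continuous_comp _ _ _ h (fun p : G * G => (p.1 * p.2)%g)).
  exact: (cvg_pair (@ptws_proj_continuous _ G (widen_ord (leqnSn n) j) x)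
                   (@ptws_proj_continuous _ G (lift ord0 j) x)).
exact: mulg_continuous.
Qed.

(* Inhomogeneous continuous cochains; the signs disappear over F_2. *)
Definition coboundary_map n (f : cochain n) : cochain n.+1 :=
  \sum_(k < n.+2) contF2_comp (@face_continuous n k) f.

Lemma coboundary_map_is_zmod_morphism n : zmod_morphism (@coboundary_map n).
Proof.
by move=> f g; rewrite -sumrB; apply: eq_bigr => k _; rewrite raddfB.
Qed.
HB.instance Definition _ n := GRing.isZmodMorphism.Build _ _
  (@coboundary_map n) (@coboundary_map_is_zmod_morphism n).

Lemma coboundary_mapE n (f : cochain n) x :
  coboundary_map f x = \sum_(k < n.+2) f (face k x).
Proof. by rewrite contF2_sumE. Qed.

Definition cocycle_pred n : {pred cochain n} :=
  [pred f | coboundary_map f == 0].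
Lemma cocycle_zmod_closed n : zmod_closed (@cocycle_pred n).
Proof.
split=> [|f g /eqP Zf /eqP Zg]; apply/eqP; first exact: raddf0.
by rewrite raddfB /= Zf Zg subrr.
Qed.

Record cocycle n := Cocycle {
  cocycle_val :> cochain n;
  cocycleP : cocycle_val \in @cocycle_pred n
}.
HB.instance Definition _ n := [isSub for @cocycle_val n].
HB.instance Definition _ n := [Choice of cocycle n by <:].
HB.instance Definition _ n := GRing.SubChoice_isSubZmodule.Build
  (cochain n) _ (cocycle n) (@cocycle_zmod_closed n).

Definition is_coboundary n : cochain n -> Prop :=
  if n is m.+1 then fun f => exists g : cochain m, f = coboundary_map g
  else fun f => f = 0.

Definition coboundary_pred n : {pred cocycle n} :=
  fun z => `[< is_coboundary (val z) >].

Lemma coboundary_zmod_closed n : zmod_closed (@coboundary_pred n).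
Proof.
split; first by apply/asboolP; case: n => //= n; exists 0; rewrite raddf0.
move=> f g /asboolP Bf /asboolP Bg; apply/asboolP => /=.
case: n f g Bf Bg => /= [f g -> ->|n f g [f' ->] [g' ->]].
  by rewrite subrr.
by exists (f' - g'); rewrite raddfB.
Qed.
HB.instance Definition _ n := GRing.isZmodClosed.Build
  (cocycle n) (@coboundary_pred n) (@coboundary_zmod_closed n).

Definition cohomology n : Type := Quotient.quot (@coboundary_pred n).
HB.instance Definition _ n := GRing.Zmodule.on (cohomology n).
HB.instance Definition _ n := ZmodQuotient.on (cohomology n).

Lemma pi_cohomology_eqP n (z w : cocycle n) :
  reflect (is_coboundary (val (z - w)))
    (\pi_(cohomology n)%qT z == \pi_(cohomology n)%qT w).
Proof.
rewrite /cohomology -Quotient.idealrBE.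
exact: asboolP.
Qed.

Definition left_part p q (x : {ptws 'I_(p + q) -> G}) : {ptws 'I_p -> G} :=
  fun i => x (lshift q i).
Definition right_part p q (x : {ptws 'I_(p + q) -> G}) : {ptws 'I_q -> G} :=
  fun j => x (rshift p j).

Lemma left_part_continuous p q : continuous (@left_part p q).
Proof. by apply: ptws_continuous => i; exact: ptws_proj_continuous. Qed.
Lemma right_part_continuous p q : continuous (@right_part p q).
Proof. by apply: ptws_continuous => i; exact: ptws_proj_continuous. Qed.

Definition cup_cochain p q (f : cochain p) (g : cochain q) : cochain (p + q) :=
  contF2_comp (@left_part_continuous p q) f *
  contF2_comp (@right_part_continuous p q) g.

Lemma leibniz p q (f : cochain p) (g : cochain q)
    (x : {ptws 'I_(p + q).+1 -> G}) :
  coboundary_map (cup_cochain f g) x =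
    coboundary_map f (fun j => x (inord j)) *
      g (fun j => x (inord (p + j).+1)) +
    f (fun j => x (inord j)) *
      coboundary_map g (fun j => x (inord (p + j))).
Proof.
rewrite !coboundary_mapE.
have E : ((p + q).+2 = p.+1 + q.+1)%N by rewrite addSn addnS.
transitivity (\sum_(k < p.+1 + q.+1)
   cup_cochain f g (face (cast_ord (esym E) k) x)).
  rewrite (reindex (cast_ord (esym E))) //.
  by exists (cast_ord E) => k _; rewrite ?cast_ordK ?cast_ordKV.
rewrite big_split_ord /=.
pose fL := f (fun j => x (inord j)).
pose gR := g (fun j => x (inord (p + j).+1)).
have -> : \sum_(k < p.+1)
    cup_cochain f g (face (cast_ord (esym E) (lshift q.+1 k)) x) =
    (\sum_(k < p.+1)
      f (face (widen_ord (leqnSn p.+1) k) (fun j => x (inord j)))) * gR.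
  rewrite mulr_suml; apply: eq_bigr => k _.
  rewrite /cup_cochain contF2_mulE /=; congr (f _ * g _); apply: funext => j.
    rewrite /left_part /face /=.
    rewrite (_ : inord _ = widen_ord (leqnSn (p + q)) (lshift q j)); last first.
      by apply: val_inj => /=; rewrite inordK //= ltnW // ltnS ltn_addr.
    rewrite (_ : inord _ = lift ord0 (lshift q j)) //.
    by apply: val_inj => /=; rewrite inordK //= ltnS ltn_addr.
  rewrite /right_part /face /=.
  have lt : (k < (p + j).+1)%N by rewrite ltnS (leq_trans (leq_ord k)) ?leq_addr.
  rewrite ltnNge (ltnW lt) /= gtn_eqF //; congr x.
  by apply: val_inj => /=; rewrite inordK //= ltnS ltn_add2l.
have -> : \sum_(k < q.+1)
    cup_cochain f g (face (cast_ord (esym E) (rshift p.+1 k)) x) =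
    fL * (\sum_(k < q.+1)
      g (face (lift ord0 k) (fun j => x (inord (p + j))))).
  rewrite mulr_sumr; apply: eq_bigr => k _.
  rewrite /cup_cochain contF2_mulE /=; congr (f _ * g _); apply: funext => j.
    rewrite /left_part /face /=.
    have lt : (j.+1 < p.+1 + k)%N by rewrite addSn ltnS ltn_addr.
    rewrite lt; congr x.
    by apply: val_inj => /=; rewrite inordK //= ltnW // ltnS ltn_addr.
  rewrite /right_part /face /=.
  have -> : ((p + j).+1 < p.+1 + k)%N = (j.+1 < bump 0 k)%N.
    by rewrite /bump add1n addSn !ltnS ltn_add2l.
  have -> : ((p + j).+1 == p.+1 + k)%N = (j.+1 == bump 0 k)%N.
    by rewrite /bump add1n addSn !eqSS eqn_add2l.
  rewrite (_ : inord _ = widen_ord (leqnSn (p + q)) (rshift p j)); last first.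
    by apply: val_inj => /=; rewrite inordK //= ltnW // ltnS ltn_add2l.
  rewrite (_ : inord _ = lift ord0 (rshift p j)) //.
  by apply: val_inj => /=; rewrite /bump /= !add1n addnS inordK // ltnS ltn_add2l.
rewrite [in RHS]big_ord_recr [X in _ = _ + _ * X]big_ord_recl /=.
have -> : f (face ord_max (fun j => x (inord j))) = fL.
  congr (f _); apply: funext => j; rewrite /face /=.
  by rewrite ltnS ltn_ord.
have -> : g (face ord0 (fun j => x (inord (p + j)))) = gR.
  congr (g _); apply: funext => j; rewrite /face /=.
  by rewrite /bump add1n addnS.
rewrite mulrDl mulrDr -/gR -addrA; congr (_ + _); rewrite addrA.
by rewrite (addrr_pchar2 (pchar_Fp (isT : prime 2))) add0r.
Qed.

Lemma coboundary_map_cocycle n (z : cocycle n) : coboundary_map z = 0.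
Proof. exact/eqP/cocycleP. Qed.

Lemma cup_cocycle_subproof p q (z : cocycle p) (w : cocycle q) :
  cup_cochain z w \in @cocycle_pred (p + q).
Proof.
apply/eqP; apply: contF2_eq => x.
by rewrite leibniz !coboundary_map_cocycle !contF2_0E mul0r mulr0 addr0.
Qed.

Definition cup_cocycle p q (z : cocycle p) (w : cocycle q) : cocycle (p + q) :=
  Cocycle (cup_cocycle_subproof z w).

Lemma cup_cocycleE p q (z : cocycle p) (w : cocycle q) x :
  (cup_cocycle z w : cochain (p + q)) x =
  (z : cochain p) (left_part x) * (w : cochain q) (right_part x).
Proof. by []. Qed.

(* Does not depend on the representatives: see cup_pi below. *)
Definition cup p q (c : cohomology p) (d : cohomology q) : cohomology (p + q) :=
  \pi_(cohomology (p + q))%qT (cup_cocycle (repr c) (repr d)).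

Lemma is_coboundaryI n m (e : n = m.+1) (f : cochain n) (g : cochain m) :
  (forall x : {ptws 'I_m.+1 -> G},
     f (fun i => x (cast_ord e i)) = coboundary_map g x) ->
  is_coboundary f.
Proof.
move: e f => /[dup] -> e f H; exists g; apply: contF2_eq => x; rewrite -H.
by congr (f _); apply: funext => i; rewrite cast_ord_id.
Qed.

Lemma cup_coboundaryl p q (b : cocycle p) (w : cocycle q) :
  is_coboundary (val b) -> is_coboundary (cup_cochain b w).
Proof.
case: b => b Zb /=; case: p b Zb => [|p] b Zb /=.
  move=> ->; have -> : @cup_cochain 0 q 0 w = 0.
    by apply: contF2_eq => x; rewrite contF2_mulE contF2_0E mul0r.
  by case: q w => [|q] w //=; exists 0; rewrite raddf0.
move=> [g ->]; exists (cup_cochain g w); apply: contF2_eq => x.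
rewrite leibniz coboundary_map_cocycle contF2_0E mulr0 addr0.
rewrite contF2_mulE /=; congr (_ * _).
  congr (coboundary_map g _); apply: funext => j; congr x.
  by apply: val_inj => /=; rewrite inordK //; exact: (ltn_addr q (ltn_ord j)).
congr (val w _); apply: funext => j; congr x.
by apply: val_inj => /=; rewrite inordK // ltnS ltn_add2l.
Qed.

Lemma cup_coboundaryr p q (z : cocycle p) (b : cocycle q) :
  is_coboundary (val b) -> is_coboundary (cup_cochain z b).
Proof.
case: b => b Zb /=; case: q b Zb => [|q] b Zb /=.
  move=> ->; have -> : @cup_cochain p 0 z 0 = 0.
    by apply: contF2_eq => x; rewrite contF2_mulE contF2_0E mulr0.
  by case: (p + 0)%N => [|n] //=; exists 0; rewrite raddf0.
move=> [g ->]; apply: (@is_coboundaryI _ _ (addnS p q) _ (cup_cochain z g)) => x.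
rewrite leibniz coboundary_map_cocycle contF2_0E mul0r add0r.
rewrite contF2_mulE /=; congr (_ * _).
  congr (val z _); apply: funext => j; congr x.
  by apply: val_inj => /=; rewrite inordK // ltnS ltnW // ltn_addr.
congr (coboundary_map g _); apply: funext => j; congr x.
by apply: val_inj => /=; rewrite inordK // ltnS leq_add2l -ltnS.
Qed.

Lemma cup_cocycleDl p q (z z' : cocycle p) (w : cocycle q) :
  cup_cocycle (z + z') w = cup_cocycle z w + cup_cocycle z' w.
Proof. by apply: val_inj => /=; rewrite /cup_cochain raddfD mulrDl. Qed.
Lemma cup_cocycleDr p q (z : cocycle p) (w w' : cocycle q) :
  cup_cocycle z (w + w') = cup_cocycle z w + cup_cocycle z w'.
Proof. by apply: val_inj => /=; rewrite /cup_cochain raddfD mulrDr. Qed.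

Lemma cup_pi p q (z : cocycle p) (w : cocycle q) :
  cup (\pi z)%qT (\pi w)%qT = \pi_(cohomology (p + q))%qT (cup_cocycle z w).
Proof.
set z' := repr (\pi_(cohomology p)%qT z).
set w' := repr (\pi_(cohomology q)%qT w).
have Bz : is_coboundary (val (z' - z)).
  by apply/pi_cohomology_eqP; rewrite reprK.
have Bw : is_coboundary (val (w' - w)).
  by apply/pi_cohomology_eqP; rewrite reprK.
apply/eqP/pi_cohomology_eqP; rewrite -/z' -/w'.
have -> : cup_cocycle z' w' - cup_cocycle z w =
    cup_cocycle (z' - z) w + cup_cocycle z' (w' - w).
  have E1 := cup_cocycleDl z (z' - z) w.
  have E2 := cup_cocycleDr z' w (w' - w).
  rewrite [X in cup_cocycle X w = _]addrC subrK in E1.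
  rewrite [X in cup_cocycle z' X = _]addrC subrK in E2.
  by rewrite E2 E1 [LHS]addrC -[X in - _ + X]addrA addKr.
apply/asboolP; apply: (@rpredD _ (@coboundary_pred (p + q))); apply/asboolP.
  exact: cup_coboundaryl.
exact: cup_coboundaryr.
Qed.

Lemma cochain_char2 n (f : cochain n) : f + f = 0.
Proof. exact: contF2_char2. Qed.

Lemma cohomology_char2 n (c : cohomology n) : c + c = 0.
Proof.
elim/quotW: c => z; rewrite -raddfD /=.
have -> : z + z = 0 by apply: val_inj; exact: cochain_char2.
exact: raddf0.
Qed.

Lemma cocycle_one_subproof : (1 : cochain 0) \in @cocycle_pred 0.
Proof.
apply/eqP; apply: contF2_eq => x.
by rewrite coboundary_mapE !big_ord_recl big_ord0 addr0 addrr_pchar2.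
Qed.

Definition cohomology_one : cohomology 0 :=
  \pi_(cohomology 0)%qT (Cocycle cocycle_one_subproof).

Lemma cohomology_tagged m n (e : m = n) (z : cocycle m) (w : cocycle n) :
  (forall x : {ptws 'I_n -> G}, (z : cochain m) (fun i => x (cast_ord e i)) = (w : cochain n) x) ->
  Tagged cohomology (\pi_(cohomology m)%qT z) =
  Tagged cohomology (\pi_(cohomology n)%qT w).
Proof.
case: n / e w => w zw; suff -> : z = w by [].
apply: val_inj; apply: contF2_eq => x; rewrite -zw.
by congr (val z _); apply: funext => i; rewrite cast_ord_id.
Qed.

Lemma cupA p q r (a : cohomology p) (b : cohomology q) (c : cohomology r) :
  Tagged cohomology (cup a (cup b c)) = Tagged cohomology (cup (cup a b) c).
Proof.
elim/quotW: a => a; elim/quotW: b => b; elim/quotW: c => c.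
rewrite (cup_pi b c) (cup_pi a b) (cup_pi a (cup_cocycle b c)).
rewrite (cup_pi (cup_cocycle a b) c).
apply: (cohomology_tagged (e := addnA p q r)) => x.
rewrite !cup_cocycleE mulrA.
rewrite /left_part /right_part /=; congr (_ * _ * _).
- by congr (val a _); apply: funext => i; congr x; apply: val_inj.
- by congr (val b _); apply: funext => i; congr x; apply: val_inj.
- by congr (val c _); apply: funext => i; congr x; apply: val_inj; rewrite /= addnA.
Qed.

Lemma cup1l p (a : cohomology p) :
  Tagged cohomology (cup cohomology_one a) = Tagged cohomology a.
Proof.
elim/quotW: a => a; rewrite /cohomology_one cup_pi.
apply: (cohomology_tagged (e := add0n p)) => x.
rewrite cup_cocycleE mul1r.
by congr (val a _); apply: funext => i; congr x; apply: val_inj.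
Qed.

Lemma cup1r p (a : cohomology p) :
  Tagged cohomology (cup a cohomology_one) = Tagged cohomology a.
Proof.
elim/quotW: a => a; rewrite /cohomology_one cup_pi.
apply: (cohomology_tagged (e := addn0 p)) => x.
rewrite cup_cocycleE mulr1.
by congr (val a _); apply: funext => i; congr x; apply: val_inj.
Qed.

Lemma cupDl p q (a a' : cohomology p) (b : cohomology q) :
  cup (a + a') b = cup a b + cup a' b.
Proof.
elim/quotW: a => a; elim/quotW: a' => a'; elim/quotW: b => b.
by rewrite -raddfD /= !cup_pi cup_cocycleDl raddfD.
Qed.

Lemma cupDr p q (a : cohomology p) (b b' : cohomology q) :
  cup a (b + b') = cup a b + cup a b'.
Proof.
elim/quotW: a => a; elim/quotW: b' => b'; elim/quotW: b => b.
by rewrite -raddfD /= !cup_pi cup_cocycleDr raddfD.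
Qed.

End Cohomology.

Section F2Scale.
Variables (V : zmodType) (V2 : forall x : V, x + x = 0).
(* The only F_2-module structure on an abelian group killed by 2. *)
Definition F2_scale (a : 'F_2) (x : V) : V := x *+ a.

Lemma F2_scaleE n x : F2_scale (n%:R) x = x *+ n.
Proof.
have V2n m : x *+ (2 * m) = 0 by rewrite mulrnA mulr2n V2 mul0rn.
by rewrite /F2_scale val_Fp_nat // {2}(divn_eq n 2) mulrnDr mulnC V2n add0r.
Qed.

Lemma F2_scaleA a b x : F2_scale a (F2_scale b x) = F2_scale (a * b) x.
Proof.
by rewrite -[a]natr_Zp -[b]natr_Zp -natrM !F2_scaleE mulnC mulrnA.
Qed.
Lemma F2_scale1 : left_id 1 F2_scale.
Proof. by []. Qed.
Lemma F2_scaleDr : right_distributive F2_scale +%R.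
Proof. by move=> a x y; rewrite /F2_scale mulrnDl. Qed.
Lemma F2_scaleDl x : {morph F2_scale^~ x : a b / a + b}.
Proof.
move=> a b; rewrite -[a]natr_Zp -[b]natr_Zp -natrD !F2_scaleE.
by rewrite mulrnDr.
Qed.
End F2Scale.

HB.instance Definition _ (G : topGroupType) n :=
  GRing.Zmodule_isLmodule.Build 'F_2 (cohomology G n)
    (F2_scaleA (@cohomology_char2 G n)) (@F2_scale1 _)
    (@F2_scaleDr _) (F2_scaleDl (@cohomology_char2 G n)).

(* Graded F_2-algebras. The associativity and unit laws relate elements of
   provably equal degrees, hence are stated in the total space. *)
Record gradedAlg := GradedAlg {
  gpart :> nat -> lmodType 'F_2;
  gone : gpart 0;
  gmul : forall i j, gpart i -> gpart j -> gpart (i + j);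
  gmulPl : forall i j (a : 'F_2) (x x' : gpart i) (y : gpart j),
    gmul (a *: x + x') y = a *: gmul x y + gmul x' y;
  gmulPr : forall i j (a : 'F_2) (x : gpart i) (y y' : gpart j),
    gmul x (a *: y + y') = a *: gmul x y + gmul x y';
  gmulA : forall i j k (x : gpart i) (y : gpart j) (z : gpart k),
    Tagged (fun n => gpart n : Type) (gmul x (gmul y z)) =
    Tagged (fun n => gpart n : Type) (gmul (gmul x y) z);
  gmul1l : forall i (x : gpart i),
    Tagged (fun n => gpart n : Type) (gmul gone x) =
    Tagged (fun n => gpart n : Type) x;
  gmul1r : forall i (x : gpart i),
    Tagged (fun n => gpart n : Type) (gmul x gone) =
    Tagged (fun n => gpart n : Type) x
}.
Arguments gone {_}.

Definition graded_iso (A B : gradedAlg) : Prop :=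
  exists phi : forall i, {linear A i -> B i},
    [/\ forall i, bijective (phi i),
        phi 0 gone = gone
      & forall i j (x : A i) (y : A j),
          phi (i + j)%N (gmul x y) = gmul (phi i x) (phi j y)].

Section CohomologyAlgebra.
Variable G : topGroupType.
Lemma cupPl p q (k : 'F_2) (a a' : cohomology G p) (b : cohomology G q) :
  cup (k *: a + a') b = k *: cup a b + cup a' b.
Proof.
rewrite cupDl; congr (_ + _); rewrite /GRing.scale /= /F2_scale.
elim: (k : nat) => [|n IH]; last by rewrite !mulrS cupDl IH.
by rewrite !mulr0n; apply: (addIr (cup 0 b)); rewrite -cupDl !add0r.
Qed.
Lemma cupPr p q (k : 'F_2) (a : cohomology G p) (b b' : cohomology G q) :
  cup a (k *: b + b') = k *: cup a b + cup a b'.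
Proof.
rewrite cupDr; congr (_ + _); rewrite /GRing.scale /= /F2_scale.
elim: (k : nat) => [|n IH]; last by rewrite !mulrS cupDr IH.
by rewrite !mulr0n; apply: (addIr (cup a 0)); rewrite -cupDr !add0r.
Qed.

Definition cohomology_alg : gradedAlg :=
  @GradedAlg (cohomology G) (cohomology_one G) (@cup G)
    cupPl cupPr (@cupA G) (@cup1l G) (@cup1r G).
End CohomologyAlgebra.

(* A dual algebra is determined by the F_2-space V in degree 1. *)
Section DualAlgebra.
Variable V : lmodType 'F_2.

Definition dual_part (n : nat) : lmodType 'F_2 :=
  match n with 0 => ('F_2)^o | 1 => V | _ => 'rV['F_2]_0 end.

Definition dual_mul (i j : nat) :
    dual_part i -> dual_part j -> dual_part (i + j) :=
  match i return dual_part i -> dual_part j -> dual_part (i + j) with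
  | 0 => fun a y => (a : 'F_2) *: y
  | 1 => match j return V -> dual_part j -> dual_part (1 + j) with
         | 0 => fun x b => (b : 'F_2) *: x
         | _ => fun _ _ => 0
         end
  | _ => fun _ _ => 0
  end.

Local Notation tag := (Tagged (fun n => dual_part n : Type)).

Lemma dual_tag2 m n (x : dual_part m) (y : dual_part n) :
  m = n -> (1 < m)%N -> tag x = tag y.
Proof.
move=> e; case: n / e y; case: m x => [|[|m]] //= x y _.
by rewrite (thinmx0 x) (thinmx0 y).
Qed.

Lemma dual_mulPl i j (a : 'F_2) (x x' : dual_part i) (y : dual_part j) :
  dual_mul (a *: x + x') y = a *: dual_mul x y + dual_mul x' y.
Proof.
case: i x x' => [|[|i]] x x' /=; last by rewrite scaler0 addr0.
  by rewrite scalerDl scalerA.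
case: j y => [|j] y /=; last by rewrite scaler0 addr0.
by rewrite scalerDr !scalerA mulrC.
Qed.

Lemma dual_mulPr i j (a : 'F_2) (x : dual_part i) (y y' : dual_part j) :
  dual_mul x (a *: y + y') = a *: dual_mul x y + dual_mul x y'.
Proof.
case: i x => [|[|i]] x /=; last by rewrite scaler0 addr0.
  by rewrite scalerDr !scalerA mulrC.
case: j y y' => [|j] y y' /=; last by rewrite scaler0 addr0.
by rewrite scalerDl scalerA.
Qed.

Lemma dual_mul1l i (x : dual_part i) :
  tag (dual_mul (1 : dual_part 0) x) = tag x.
Proof. by rewrite /= scale1r. Qed.

Lemma dual_mul1r i (x : dual_part i) :
  tag (dual_mul x (1 : dual_part 0)) = tag x.
Proof.
case: i x => [|[|i]] x /=; [by rewrite /GRing.scale /= mulr1| by rewrite scale1r|].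
by apply: dual_tag2; rewrite // addn0.
Qed.

Lemma dual_mulA i j k (x : dual_part i) (y : dual_part j) (z : dual_part k) :
  tag (dual_mul x (dual_mul y z)) = tag (dual_mul (dual_mul x y) z).
Proof.
have [lt|] := ltnP 1 (i + (j + k)); first exact: (dual_tag2 _ _ (addnA i j k) lt).
case: i x => [|[|i]] x; case: j y => [|[|j]] y; case: k z => [|[|k]] z //= _;
  rewrite ?scalerA //.
  by congr (tag (_ *: _)); rewrite mulrC.
by congr (tag (_ *: _)); rewrite mulrC.
Qed.

Definition dual_alg : gradedAlg :=
  @GradedAlg dual_part (1 : 'F_2) dual_mul dual_mulPl dual_mulPr
    dual_mulA dual_mul1l dual_mul1r.
End DualAlgebra.

(* The zero ring is allowed. *)
Record booleanRing := BooleanRing {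
  boolean_ring :> comPzRingType;
  boolean_idem : forall x : boolean_ring, x * x = x
}.

Lemma boolean_char2 (B : booleanRing) (x : B) : x + x = 0.
Proof.
have := boolean_idem (x + x); rewrite mulrDl !mulrDr boolean_idem => E.
by apply: (addrI (x + x)); rewrite addr0.
Qed.

Definition boolean_module (B : booleanRing) : Type := B.
HB.instance Definition _ (B : booleanRing) :=
  GRing.ComPzRing.on (boolean_module B).
HB.instance Definition _ (B : booleanRing) :=
  GRing.Zmodule_isLmodule.Build 'F_2 (boolean_module B)
    (F2_scaleA (@boolean_char2 B)) (@F2_scale1 _)
    (@F2_scaleDr _) (F2_scaleDl (@boolean_char2 B)).

Section BooleanAlgebra.
Variable B : booleanRing.

Definition boolean_part (n : nat) : lmodType 'F_2 :=
  if n is _.+1 then boolean_module B else ('F_2)^o.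

Definition boolean_mul (i j : nat) :
    boolean_part i -> boolean_part j -> boolean_part (i + j) :=
  match i return boolean_part i -> boolean_part j -> boolean_part (i + j) with
  | 0 => fun a y => (a : 'F_2) *: y
  | _.+1 =>
    match j return boolean_module B -> boolean_part j -> boolean_module B with
    | 0 => fun x b => (b : 'F_2) *: x
    | _.+1 => fun x y => x * y
    end
  end.

Local Notation tag := (Tagged (fun n => boolean_part n : Type)).

Lemma boolean_tag m n (x : boolean_module B) : m = n ->
  @Tagged _ m.+1 (fun n => boolean_part n : Type) x =
  @Tagged _ n.+1 (fun n => boolean_part n : Type) x.
Proof. by move->. Qed.

Lemma boolean_scaleAl (a : 'F_2) (x y : boolean_module B) :
  a *: (x * y) = (a *: x) * y.
Proof. by rewrite /GRing.scale /= /F2_scale mulrnAl. Qed.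
Lemma boolean_scaleAr (a : 'F_2) (x y : boolean_module B) :
  a *: (x * y) = x * (a *: y).
Proof. by rewrite /GRing.scale /= /F2_scale mulrnAr. Qed.

Lemma boolean_mulPl i j (a : 'F_2) (x x' : boolean_part i) (y : boolean_part j) :
  boolean_mul (a *: x + x') y = a *: boolean_mul x y + boolean_mul x' y.
Proof.
case: i x x' => [|i] x x' /=; first by rewrite scalerDl scalerA.
case: j y => [|j] y /=; last by rewrite mulrDl boolean_scaleAl.
by rewrite scalerDr !scalerA mulrC.
Qed.

Lemma boolean_mulPr i j (a : 'F_2) (x : boolean_part i) (y y' : boolean_part j) :
  boolean_mul x (a *: y + y') = a *: boolean_mul x y + boolean_mul x y'.
Proof.
case: i x => [|i] x /=; first by rewrite scalerDr !scalerA mulrC.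
case: j y y' => [|j] y y' /=; last by rewrite mulrDr boolean_scaleAr.
by rewrite scalerDl scalerA.
Qed.

Lemma boolean_mul1l i (x : boolean_part i) :
  tag (boolean_mul (1 : boolean_part 0) x) = tag x.
Proof. by rewrite /= scale1r. Qed.

Lemma boolean_mul1r i (x : boolean_part i) :
  tag (boolean_mul x (1 : boolean_part 0)) = tag x.
Proof.
case: i x => [|i] x /=; first by rewrite /GRing.scale /= mulr1.
by rewrite scale1r; exact: (@boolean_tag (i + 0) i _ (addn0 i)).
Qed.

Lemma boolean_mulA i j k (x : boolean_part i) (y : boolean_part j)
    (z : boolean_part k) :
  tag (boolean_mul x (boolean_mul y z)) = tag (boolean_mul (boolean_mul x y) z).
Proof.
case: i x => [|i] x; case: j y => [|j] y; case: k z => [|k] z /=.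
- by rewrite scalerA.
- by rewrite scalerA.
- by rewrite !scalerA mulrC.
- by rewrite boolean_scaleAl.
- rewrite scalerA (_ : y *: z = z * y); last exact: mulrC.
  exact: (@boolean_tag (i + (0 + 0)) _ _ (addnA i 0 0)).
- rewrite -boolean_scaleAr -boolean_scaleAl.
  exact: (@boolean_tag (i + (0 + k.+1)) _ _ (addnA i 0 k.+1)).
- rewrite -boolean_scaleAr.
  exact: (@boolean_tag (i + (j.+1 + 0)) _ _ (addnA i j.+1 0)).
- rewrite mulrA.
  exact: (@boolean_tag (i + (j.+1 + k.+1)) _ _ (addnA i j.+1 k.+1)).
Qed.

Definition boolean_alg : gradedAlg :=
  @GradedAlg boolean_part (1 : 'F_2) boolean_mul boolean_mulPl boolean_mulPr
    boolean_mulA boolean_mul1l boolean_mul1r.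
End BooleanAlgebra.

Section ConnectedSum.
Variables D E : gradedAlg.

Definition csum_part (n : nat) : lmodType 'F_2 :=
  if n is m.+1 then (D m.+1 * E m.+1)%type else ('F_2)^o.

Definition csum_proj1 n : csum_part n -> D n :=
  if n is m.+1 then fun x : D m.+1 * E m.+1 => x.1
  else fun a : 'F_2 => a *: gone.
Definition csum_proj2 n : csum_part n -> E n :=
  if n is m.+1 then fun x : D m.+1 * E m.+1 => x.2
  else fun a : 'F_2 => a *: gone.

(* In positive total degree the product is componentwise, scalars c of degree 0
   acting as (c *: 1, c *: 1); so the products of D and E in positive degrees
   vanish. *)
Definition csum_mul (i j : nat) :
    csum_part i -> csum_part j -> csum_part (i + j) :=
  match i return csum_part i -> csum_part j -> csum_part (i + j) with
  | 0 =>
    match j return csum_part 0 -> csum_part j -> csum_part j with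
    | 0 => fun a b => (a : 'F_2) * (b : 'F_2)
    | m.+1 => fun a y => (gmul (csum_proj1 a) y.1, gmul (csum_proj2 a) y.2)
    end
  | m.+1 => fun x y =>
    (gmul (csum_proj1 x) (csum_proj1 y), gmul (csum_proj2 x) (csum_proj2 y))
  end.

Local Notation tag A := (Tagged (fun n => gpart A n : Type)).
Local Notation ctag := (Tagged (fun n => csum_part n : Type)).

Lemma gmulZl (A : gradedAlg) i j (a : 'F_2) (x : A i) (y : A j) :
  gmul (a *: x) y = a *: gmul x y.
Proof.
have g0 : gmul (0 : A i) y = 0.
  by have := gmulPl (- 1) (0 : A i) 0 y; rewrite scaler0 addr0 scaleN1r addNr.
by have := gmulPl a x 0 y; rewrite g0 !addr0.
Qed.

Lemma gmulZr (A : gradedAlg) i j (a : 'F_2) (x : A i) (y : A j) :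
  gmul x (a *: y) = a *: gmul x y.
Proof.
have g0 : gmul x (0 : A j) = 0.
  by have := gmulPr (- 1) x (0 : A j) 0; rewrite scaler0 addr0 scaleN1r addNr.
by have := gmulPr a x y 0; rewrite g0 !addr0.
Qed.

Lemma gmul11 (A : gradedAlg) : gmul (gone : A 0) gone = gone.
Proof. exact: (eq_from_Tagged (gmul1l (gone : A 0))). Qed.

Lemma csum_proj1M i j (x : csum_part i) (y : csum_part j) :
  csum_proj1 (csum_mul x y) = gmul (csum_proj1 x) (csum_proj1 y).
Proof.
case: i x => [|i] x //; case: j y => [|j] y //.
by rewrite /= gmulZl gmulZr gmul11 scalerA.
Qed.

Lemma csum_proj2M i j (x : csum_part i) (y : csum_part j) :
  csum_proj2 (csum_mul x y) = gmul (csum_proj2 x) (csum_proj2 y).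
Proof.
case: i x => [|i] x //; case: j y => [|j] y //.
by rewrite /= gmulZl gmulZr gmul11 scalerA.
Qed.

Lemma csum_proj1P n (a : 'F_2) (x y : csum_part n) :
  csum_proj1 (a *: x + y) = a *: csum_proj1 x + csum_proj1 y.
Proof. by case: n x y => //= x y; rewrite scalerDl scalerA. Qed.

Lemma csum_proj2P n (a : 'F_2) (x y : csum_part n) :
  csum_proj2 (a *: x + y) = a *: csum_proj2 x + csum_proj2 y.
Proof. by case: n x y => //= x y; rewrite scalerDl scalerA. Qed.

Lemma csum_tagP m n (x : csum_part m) (y : csum_part n) :
  m = n -> (0 < m)%N ->
  tag D (csum_proj1 x) = tag D (csum_proj1 y) ->
  tag E (csum_proj2 x) = tag E (csum_proj2 y) -> ctag x = ctag y.
Proof.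
move=> e; case: n / e y; case: m x => //= m [x1 x2] [y1 y2] _ /=.
by move=> H1 H2; rewrite (eq_from_Tagged H1) (eq_from_Tagged H2).
Qed.

Lemma csum_eqP m (x y : csum_part m) : (0 < m)%N ->
  csum_proj1 x = csum_proj1 y -> csum_proj2 x = csum_proj2 y -> x = y.
Proof. by case: m x y => //= m [x1 x2] [y1 y2] _ /= -> ->. Qed.

Lemma csum_mulPl i j (a : 'F_2) (x x' : csum_part i) (y : csum_part j) :
  csum_mul (a *: x + x') y = a *: csum_mul x y + csum_mul x' y.
Proof.
have [lt|] := ltnP 0 (i + j).
  apply: csum_eqP => //.
    by rewrite csum_proj1P !csum_proj1M csum_proj1P gmulPl.
  by rewrite csum_proj2P !csum_proj2M csum_proj2P gmulPl.
case: i x x' => // x x'; case: j y => //= y _.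
rewrite mulrDl; congr (_ + _); exact: (esym (mulrA _ _ _)).
Qed.

Lemma csum_mulPr i j (a : 'F_2) (x : csum_part i) (y y' : csum_part j) :
  csum_mul x (a *: y + y') = a *: csum_mul x y + csum_mul x y'.
Proof.
have [lt|] := ltnP 0 (i + j).
  apply: csum_eqP => //.
    by rewrite csum_proj1P !csum_proj1M csum_proj1P gmulPr.
  by rewrite csum_proj2P !csum_proj2M csum_proj2P gmulPr.
case: i x => // x; case: j y y' => //= y y' _.
rewrite mulrDr; congr (_ + _); exact: mulrCA.
Qed.

Lemma csum_mulA i j k (x : csum_part i) (y : csum_part j) (z : csum_part k) :
  ctag (csum_mul x (csum_mul y z)) = ctag (csum_mul (csum_mul x y) z).
Proof.
have [lt|] := ltnP 0 (i + (j + k)).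
  apply: csum_tagP; rewrite ?addnA -?addnA //.
    by rewrite !csum_proj1M gmulA.
  by rewrite !csum_proj2M gmulA.
case: i x => // x; case: j y => //= y; case: k z => //= z _.
by rewrite mulrA.
Qed.

Lemma csum_mul1l i (x : csum_part i) :
  ctag (csum_mul (1 : csum_part 0) x) = ctag x.
Proof.
case: i x => [|i] x; first by rewrite /= mul1r.
apply: csum_tagP => //.
  by rewrite csum_proj1M /= scale1r gmul1l.
by rewrite csum_proj2M /= scale1r gmul1l.
Qed.

Lemma csum_mul1r i (x : csum_part i) :
  ctag (csum_mul x (1 : csum_part 0)) = ctag x.
Proof.
case: i x => [|i] x; first by rewrite /= mulr1.
apply: csum_tagP => //; first by rewrite addn0.
  by rewrite csum_proj1M /= scale1r gmul1r.
by rewrite csum_proj2M /= scale1r gmul1r.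
Qed.

Definition connected_sum : gradedAlg :=
  @GradedAlg csum_part (1 : 'F_2) csum_mul csum_mulPl csum_mulPr
    csum_mulA csum_mul1l csum_mul1r.
End ConnectedSum.

Definition cohomologically_quasi_boolean (G : topGroupType) : Prop :=
  exists (V : lmodType 'F_2) (B : booleanRing),
    graded_iso (cohomology_alg G) (connected_sum (dual_alg V) (boolean_alg B)).

Section Restriction.
Variables (G : topGroupType) (U : subgroup G).
Local Notation H := (subgroup_type U).

Definition subgroup_tuple n (x : {ptws 'I_n -> H}) : {ptws 'I_n -> G} :=
  fun i => val (x i).

Lemma subgroup_tuple_continuous n : continuous (@subgroup_tuple n).
Proof.
apply: ptws_continuous => i x.
apply: (@continuous_comp _ _ _ (fun x : {ptws 'I_n -> H} => x i)
  (val : H -> G)); first exact: ptws_proj_continuous.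
exact: val_subgroup_continuous.
Qed.

Definition res_cochain n : cochain G n -> cochain H n :=
  contF2_comp (@subgroup_tuple_continuous n).

Lemma res_coboundary_map n (f : cochain G n) :
  coboundary_map (res_cochain f) = res_cochain (coboundary_map f).
Proof.
apply: contF2_eq => x; rewrite coboundary_mapE /= coboundary_mapE.
apply: eq_bigr => k _ /=; congr (contF2_fun f _); apply: funext => i.
by rewrite /face /subgroup_tuple; case: ifP => // _; case: ifP.
Qed.

Lemma res_cocycle_subproof n (z : cocycle G n) :
  res_cochain z \in @cocycle_pred H n.
Proof.
by apply/eqP; rewrite res_coboundary_map coboundary_map_cocycle; apply: val_inj.
Qed.

Definition res_cocycle n (z : cocycle G n) : cocycle H n :=
  Cocycle (res_cocycle_subproof z).

(* Does not depend on the representative: see res_pi below. *)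
Definition res n (c : cohomology G n) : cohomology H n :=
  \pi_(cohomology H n)%qT (res_cocycle (repr c)).

Lemma res_pi n (z : cocycle G n) :
  res (\pi_(cohomology G n)%qT z) = \pi_(cohomology H n)%qT (res_cocycle z).
Proof.
apply/eqP/pi_cohomology_eqP.
set z' := repr _.
have : is_coboundary (val (z' - z)).
  by apply/pi_cohomology_eqP; rewrite reprK.
have -> : val (res_cocycle z' - res_cocycle z) = res_cochain (val (z' - z)).
  by apply: contF2_eq.
move: (val _) => f; case: n f {z z'} => [|n] f /= => [->|[g ->]].
  exact: val_inj.
by exists (res_cochain g); rewrite res_coboundary_map.
Qed.

Lemma res_is_zmod_morphism n : zmod_morphism (@res n).
Proof.
elim/quotW=> z; elim/quotW=> w.
rewrite -raddfB !res_pi -raddfB.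
suff -> : res_cocycle (z - w) = res_cocycle z - res_cocycle w by [].
by apply: val_inj; apply: contF2_eq.
Qed.
HB.instance Definition _ n :=
  GRing.isZmodMorphism.Build _ _ (@res n) (@res_is_zmod_morphism n).
End Restriction.

Section Involutions.
Variable G : topGroupType.

Definition involution : Type := [set y : G | y != 1%g /\ (y ^+ 2)%g = 1%g].
HB.instance Definition _ := Topological.on involution.

Definition inv_val (y : involution) : G := val y.

Definition conjugate : rel involution :=
  fun y z => `[< exists g : G, inv_val z = (inv_val y ^ g)%g >].

Lemma conjugate_equiv : equiv_class_of conjugate.
Proof.
split=> [y|y z|z y w].
- by apply/asboolP; exists 1%g; rewrite conjg1.
- apply: asbool_equiv_eq; split=> -[g e]; exists (g^-1)%g; rewrite e conjgK //.
- move=> /asboolP [g e1] /asboolP [h e2]; apply/asboolP.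
  by exists (g * h)%g; rewrite conjgM -e1.
Qed.
Canonical conjugate_equiv_rel := EquivRelPack conjugate_equiv.

Definition conj_classes : Type := quotient_topology {eq_quot conjugate}%qT.
HB.instance Definition _ := Topological.on conj_classes.

Definition conj_class (y : involution) : conj_classes :=
  \pi_({eq_quot conjugate})%qT y.

(* The identification of H^n(<y>, F_2) with F_2 is some additive bijection e;
   there is at most one, since both groups then have two elements. *)
Definition is_restriction_to_involutions n
    (phi : cohomology G n -> contF2 conj_classes) : Prop :=
  forall y : involution,
    let Cy := generated [set inv_val y] in
    exists e : {additive cohomology (subgroup_type Cy) n -> 'F_2},
      bijective e /\ forall c, phi c (conj_class y) = e (res Cy c).
End Involutions.

(* Main.v *)
(* Let x in H^1(G) be the unit of the Boolean ring. Multiplication by x is onto from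
   degree 1 on and injective from degree 2 on, and a a = x a for all a in H^1(G).
   The cohomology of open subgroups is that of right G-sets built as iterated double
   covers. The cochains of a double cover form the mapping cone of multiplication by
   its class, which gives the Gysin sequence at once; by diagram chasing, the
   periodicity under x is inherited by all these G-sets. Restriction to an involution
   y is evaluation at the fixed points of y.

   If x b <> 0, some involution y has b(y) = 1. Indeed, along a chain of open normal
   subgroups K starting at ker x one can choose y with y^2 in K and x(y) = 1 such that
   x b does not vanish on P = K u yK. For the next subgroup M of index 2 in K, P/M is
   not cyclic, since otherwise x x = 0 on P. So P has two subgroups of index 2 that
   meet K in M, the kernels of some z and of z + x. If x b vanished on both, it would
   be divisible by z and by z + x, contradicting z z (z + x) (z + x) = 0, a relation
   of the type found by Serre, which follows from the Bockstein of z z = x w.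
   Compactness yields the involution, hence injectivity in degrees i > 1.

   If y and y' are involutions not separated by H^1(G), consider the G-set G/<y'>N.
   After inverting the classes of G that do not vanish at y, the cohomology of a tower
   of double covers is the ring of functions on the fixed points of y; as x does not
   vanish on <y'>N, y has a fixed point, that is, y is conjugate to y' modulo N. By
   compactness, y and y' are conjugate. The functions y |-> b(y) thus form a Boolean
   algebra separating conjugacy classes, and a further compactness argument shows that
   every continuous function is of this form. *)

Require Import Defs.
From HB Require Import structures.
From mathcomp Require Import all_boot all_order all_algebra.
From mathcomp Require fingroup perm pgroup sylow.
From mathcomp Require Import all_classical topology.
From mathcomp Require Import ring.
Set Implicit Arguments.
Unset Strict Implicit.
Unset Printing Implicit Defensive.
Import GRing.Theory.
Local Open Scope classical_set_scope.
Local Open Scope ring_scope.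

(** * Arithmetic in F_2 *)

Lemma F2P (a : 'F_2) : a = 0 \/ a = 1.
Proof.
case: a => [[|[|//]] i]; [left|right]; exact: val_inj.
Qed.

Lemma F2_addxx (a : 'F_2) : a + a = 0.
Proof. exact: (addrr_pchar2 (pchar_Fp (isT : prime 2))). Qed.

Lemma F2_addr_eq0 (a b : 'F_2) : a + b = 0 -> a = b.
Proof. by move=> e; apply: (addIr b); rewrite e F2_addxx. Qed.

(** * Cohomology of right G-sets *)

Section GSets.
Variable G : topGroupType.

(** [gact_near] is continuity of the action for the discrete topology on the carrier; in other
    words, stabilisers are open. *)
Record gset := GSet {
  gcarrier :> Type;
  gact : gcarrier -> G -> gcarrier;
  gact1 : forall t, gact t 1%g = t;
  gactM : forall t g h, gact t (g * h)%g = gact (gact t g) h;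
  gact_near : forall t g, \forall h \near g, gact t h = gact t g
}.

(* A point t of T is placed at the left end: (t; x_0, ..., x_(n-1)) stands for the
   path t, t x_0, t x_0 x_1, ... *)
Definition gcochain (T : gset) (n : nat) : Type := T -> cochain G n.
HB.instance Definition _ T n := GRing.Zmodule.on (gcochain T n).

Definition tailx n (x : {ptws 'I_n.+1 -> G}) : {ptws 'I_n -> G} :=
  fun j => x (lift ord0 j).
Definition headx n (x : {ptws 'I_n.+1 -> G}) : {ptws 'I_1 -> G} :=
  fun=> x ord0.

Lemma tailx_continuous n : continuous (@tailx n).
Proof. by apply: ptws_continuous => j; exact: ptws_proj_continuous. Qed.

Lemma headx_continuous n : continuous (@headx n).
Proof. by apply: ptws_continuous => j; exact: ptws_proj_continuous. Qed.

Variable T : gset.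

Lemma shift_subproof n (f : gcochain T n) (t : T) :
  `[< continuousF2 (fun x : {ptws 'I_n.+1 -> G} =>
        f (gact t (x ord0)) (tailx x)) >].
Proof.
apply/asboolP/continuousF2P => x.
have N1 : \forall y \near x, gact t (y ord0) = gact t (x ord0).
  exact: (@ptws_proj_continuous _ G (ord0 : 'I_n.+1) x _ (gact_near t (x ord0))).
have := contF2P (contF2_comp (@tailx_continuous n) (f (gact t (x ord0)))).
move=> /asboolP/continuousF2P/(_ x) N2.
by apply: filterS2 N1 N2 => y /= -> ->.
Qed.

(** The face that deletes x_0: dropping the first step moves the base point from t to t x_0. *)
Definition gshift n (f : gcochain T n) (t : T) : cochain G n.+1 :=
  ContF2 (shift_subproof f t).

Definition gdelta n (f : gcochain T n) : gcochain T n.+1 := fun t =>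
  gshift f t + \sum_(k < n.+1) contF2_comp (@face_continuous G n (lift ord0 k)) (f t).

Lemma gdeltaE n (f : gcochain T n) t x :
  gdelta f t x = f (gact t (x ord0)) (tailx x) +
    \sum_(k < n.+1) f t (face (lift ord0 k) x).
Proof. by rewrite /gdelta contF2_addE contF2_sumE. Qed.

Lemma gaddE n (f g : gcochain T n) t x : (f + g) t x = f t x + g t x.
Proof. by []. Qed.

Lemma goppE n (f : gcochain T n) t x : (- f) t x = - f t x.
Proof. by []. Qed.

Lemma gdelta_is_zmod_morphism n : zmod_morphism (@gdelta n).
Proof.
move=> f g; apply: funext => t; apply: contF2_eq => x.
rewrite gaddE goppE !gdeltaE opprD addrACA -sumrB.
by congr (_ + _).
Qed.
HB.instance Definition _ n := GRing.isZmodMorphism.Build _ _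
  (@gdelta n) (@gdelta_is_zmod_morphism n).

(** Cup product with a 1-cochain on the left; [f] is read from the point reached after the first
    step. *)
Definition gmul1 n (z : gcochain T 1) (f : gcochain T n) : gcochain T n.+1 :=
  fun t => contF2_comp (@headx_continuous n) (z t) * gshift f t.

Lemma gmul1E n z (f : gcochain T n) t x :
  gmul1 z f t x = z t (fun=> x ord0) * f (gact t (x ord0)) (tailx x).
Proof. by []. Qed.

Lemma gcochain_eq n (f g : gcochain T n) :
  (forall t x, f t x = g t x) -> f = g.
Proof. by move=> fg; apply: funext => t; apply: contF2_eq. Qed.

Lemma gcochain_char2 n (f : gcochain T n) : f + f = 0.
Proof. by apply: gcochain_eq => t x; exact: F2_addxx. Qed.

Lemma gmul1Dl n (z w : gcochain T 1) (f : gcochain T n) :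
  gmul1 (z + w) f = gmul1 z f + gmul1 w f.
Proof. by apply: gcochain_eq => t x; rewrite gaddE !gmul1E gaddE mulrDl. Qed.

Lemma gmul1Dr n (z : gcochain T 1) (f g : gcochain T n) :
  gmul1 z (f + g) = gmul1 z f + gmul1 z g.
Proof. by apply: gcochain_eq => t x; rewrite gaddE !gmul1E gaddE mulrDr. Qed.

Definition pair_tuple (g h : G) : {ptws 'I_2 -> G} :=
  fun i => if i == ord0 then g else h.

Lemma gdelta1E (u : gcochain T 1) t g h :
  gdelta u t (pair_tuple g h) =
    u (gact t g) (fun=> h) + (u t (fun=> (g * h)%g) + u t (fun=> g)).
Proof.
rewrite gdeltaE !big_ord_recl big_ord0 addr0; congr (_ + (_ + _)).
all: by congr (contF2_fun (u _) _); apply: funext => i; rewrite (ord1 i).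
Qed.

(** The Leibniz rule; the second summand is the product of [gdelta u] with [c]. It allows any
    1-cochain [u], so that [u] can serve as a homotopy in [gmul1_assoc]. *)
Lemma gdelta_mul1 n (u : gcochain T 1) (c : gcochain T n) t x :
  gdelta (gmul1 u c) t x = gmul1 u (gdelta c) t x +
    gdelta u t (pair_tuple (x ord0) (x (lift ord0 ord0))) *
    c (gact (gact t (x ord0)) (x (lift ord0 ord0))) (tailx (tailx x)).
Proof.
rewrite gdelta1E gdeltaE !gmul1E gdeltaE big_ord_recl gmul1E.
set A := c _ (tailx (tailx x)).
have -> : c (gact t (face (lift ord0 ord0) x ord0))
   (tailx (face (lift ord0 ord0) x)) = A.
  rewrite /A; congr (contF2_fun (c _) _).
    rewrite -gactM; congr (gact t _); rewrite /face /=; congr (_ * _)%g.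
    by congr x; apply: val_inj.
have -> : u t (fun=> face (lift ord0 ord0) x ord0) =
          u t (fun=> (x ord0 * x (lift ord0 ord0))%g).
  congr (contF2_fun (u t) _); apply: funext => _; rewrite /face /=.
  by congr (_ * _)%g; congr x; apply: val_inj.
under eq_bigr => k _.
  rewrite gmul1E.
  have -> : face (lift ord0 (lift ord0 k)) x ord0 = x ord0.
    by rewrite /face /=; congr x; apply: val_inj.
  have -> : tailx (face (lift ord0 (lift ord0 k)) x) =
            face (lift ord0 k) (tailx x).
    apply: funext => j; rewrite /tailx /face /= /bump !add1n !ltnS !eqSS.
    have -> : widen_ord (leqnSn n.+1) (lift ord0 j) =
              lift ord0 (widen_ord (leqnSn n) j) by apply: val_inj.
    by [].
  over.
rewrite -mulr_sumr mulrDr.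
have E (a b c' d s : 'F_2) :
    d * a + (c' * a + s) = b * a + s + (d + (c' + b)) * a.
  have -> : b * a + s + (d + (c' + b)) * a =
            d * a + (c' * a + s) + (b * a + b * a) by ring.
  by rewrite F2_addxx addr0.
exact: E.
Qed.
End GSets.

(** * Cohomology groups of a G-set and products with classes of degree 1 *)

Section GCohomology.
Variables (G : topGroupType) (T : gset G).

Definition gcocycle_pred n : {pred gcochain T n} := [pred f | gdelta f == 0].
Lemma gcocycle_zmod_closed n : zmod_closed (@gcocycle_pred n).
Proof.
split=> [|f g /eqP Zf /eqP Zg]; apply/eqP; first exact: raddf0.
by rewrite raddfB /= Zf Zg subrr.
Qed.

Record gcocycle n := GCocycle {
  gcocycle_val :> gcochain T n;
  gcocycleP : gcocycle_val \in @gcocycle_pred n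
}.
HB.instance Definition _ n := [isSub for @gcocycle_val n].
HB.instance Definition _ n := [Choice of gcocycle n by <:].
HB.instance Definition _ n := GRing.SubChoice_isSubZmodule.Build
  (gcochain T n) _ (gcocycle n) (@gcocycle_zmod_closed n).

Definition is_gcoboundary n : gcochain T n -> Prop :=
  if n is m.+1 then fun f => exists g : gcochain T m, f = gdelta g
  else fun f => f = 0.

Definition gcoboundary_pred n : {pred gcocycle n} :=
  fun z => `[< is_gcoboundary (val z) >].

Lemma gcoboundary_zmod_closed n : zmod_closed (@gcoboundary_pred n).
Proof.
split; first by apply/asboolP; case: n => //= n; exists 0; rewrite raddf0.
move=> f g /asboolP Bf /asboolP Bg; apply/asboolP => /=.
case: n f g Bf Bg => /= [f g -> ->|n f g [f' ->] [g' ->]].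
  by rewrite subrr.
by exists (f' - g'); rewrite raddfB.
Qed.
HB.instance Definition _ n := GRing.isZmodClosed.Build
  (gcocycle n) (@gcoboundary_pred n) (@gcoboundary_zmod_closed n).

Definition gH n : Type := Quotient.quot (@gcoboundary_pred n).
HB.instance Definition _ n := GRing.Zmodule.on (gH n).
HB.instance Definition _ n := ZmodQuotient.on (gH n).

Definition cls n (z : gcocycle n) : gH n := \pi_(gH n)%qT z.

Lemma cls_is_zmod_morphism n : zmod_morphism (@cls n).
Proof. by move=> z w; rewrite /cls raddfB. Qed.
HB.instance Definition _ n := GRing.isZmodMorphism.Build _ _
  (@cls n) (@cls_is_zmod_morphism n).

Lemma cls_surj n (c : gH n) : exists z, c = cls z.
Proof. by exists (repr c); rewrite /cls reprK. Qed.

Lemma cls_eqP n (z w : gcocycle n) :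
  cls z = cls w <-> is_gcoboundary (val z - val w).
Proof.
rewrite /cls; split => [/eqP|B]; last apply/eqP.
  by rewrite /gH -Quotient.idealrBE => /asboolP.
by rewrite /gH -Quotient.idealrBE; apply/asboolP.
Qed.

Lemma gcochain_subE n (f g : gcochain T n) : f - g = f + g.
Proof. by apply: (addIr g); rewrite subrK -addrA gcochain_char2 addr0. Qed.

Lemma cls_eqSP n (z w : gcocycle n.+1) :
  cls z = cls w <-> exists g, (val z : gcochain T _) + val w = gdelta g.
Proof. by rewrite cls_eqP gcochain_subE. Qed.

Lemma cls_eq0 n (z : gcocycle n.+1) :
  cls z = 0 <-> exists g, (val z : gcochain T _) = gdelta g.
Proof. by rewrite -(raddf0 (@cls n.+1)) cls_eqSP /= addr0. Qed.

Lemma gH_char2 n (c : gH n) : c + c = 0.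
Proof.
have [z ->] := cls_surj c; rewrite -raddfD /=.
have -> : z + z = 0 by apply: val_inj; exact: gcochain_char2.
exact: raddf0.
Qed.

Lemma gH_addr_eq0 n (c d : gH n) : c + d = 0 -> c = d.
Proof. by move=> e; apply: (addIr d); rewrite e gH_char2. Qed.

Lemma gdelta_cocycle n (z : gcocycle n) : gdelta z = 0.
Proof. exact/eqP/gcocycleP. Qed.

Lemma gmul1_cocycle_subproof n (z : gcocycle 1) (c : gcocycle n) :
  gmul1 z c \in @gcocycle_pred n.+1.
Proof.
apply/eqP/gcochain_eq => t x.
by rewrite gdelta_mul1 !gdelta_cocycle gmul1E !contF2_0E mulr0 mul0r addr0.
Qed.
Definition gmul1_cocycle n z c : gcocycle n.+1 :=
  GCocycle (@gmul1_cocycle_subproof n z c).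

Lemma gmul1_delta n (z : gcocycle 1) (e : gcochain T n) :
  gmul1 z (gdelta e) = gdelta (gmul1 z e).
Proof.
apply: gcochain_eq => t x.
by rewrite gdelta_mul1 gdelta_cocycle contF2_0E mul0r addr0.
Qed.

Definition gmul0 n (f : gcochain T 0) (c : gcochain T n) : gcochain T n :=
  fun t => contF2_comp
    (@cst_continuous {ptws 'I_n -> G} {ptws 'I_0 -> G} (fun=> 1%g)) (f t) * c t.

Lemma gmul0E n f (c : gcochain T n) t x y : gmul0 f c t x = f t y * c t x.
Proof.
rewrite /gmul0 contF2_mulE /=; congr (f t _ * _).
by apply: funext => -[].
Qed.

(** For a cocycle [c] this writes [gmul1 (gdelta f) c] as a coboundary, so [cup1] does not depend on
    the representative of its first factor. *)
Lemma gdelta_mul0 n f (c : gcochain T n) :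
  gdelta (gmul0 f c) = gmul0 f (gdelta c) + gmul1 (gdelta f) c.
Proof.
apply: gcochain_eq => t x; pose o : {ptws 'I_0 -> G} := fun=> 1%g.
have E0 (y : {ptws 'I_0 -> G}) s : f s y = f s o.
  by congr (contF2_fun _ _); apply: funext => -[].
rewrite gdeltaE gaddE !(gmul0E _ _ _ _ o) gdeltaE gmul1E gdeltaE.
under eq_bigr do rewrite (gmul0E _ _ _ _ o).
rewrite -mulr_sumr big_ord1 !(E0 (tailx _)) !(E0 (face _ _)).
set S := \sum_(i < _) _; set c' := c _ _.
have -> : f t o * (c' + S) + (f (gact t (x ord0)) o + f t o) * c' =
  f (gact t (x ord0)) o * c' + f t o * S + (f t o * c' + f t o * c') by ring.
by rewrite F2_addxx addr0.
Qed.

Definition cup1 n (a : gH 1) (c : gH n) : gH n.+1 :=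
  cls (gmul1_cocycle (repr a) (repr c)).

Lemma cup1_cls n (z : gcocycle 1) (c : gcocycle n) :
  cup1 (cls z) (cls c) = cls (gmul1_cocycle z c).
Proof.
rewrite /cup1; set z' := repr _; set c' := repr _.
have /cls_eqSP[f Ef] : cls z' = cls z by rewrite /z' /cls reprK.
have Ec : cls c' = cls c by rewrite /c' /cls reprK.
transitivity (cls (gmul1_cocycle z c')).
  apply/cls_eqSP; exists (gmul0 f c') => /=.
  rewrite -gmul1Dl Ef gdelta_mul0 gdelta_cocycle.
  suff -> : gmul0 f (0 : gcochain T n.+1) = 0 by rewrite add0r.
  by apply: gcochain_eq => t x; rewrite (gmul0E _ _ _ _ (fun=> 1%g)) contF2_0E mulr0.
case: n c c' Ec => [|n] c c' Ec.
  have /cls_eqP /= /eqP := Ec; rewrite subr_eq0 => /eqP e.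
  by congr cls; apply: val_inj => /=; rewrite e.
have /cls_eqSP[e Ee] := Ec.
by apply/cls_eqSP; exists (gmul1 z e) => /=; rewrite -gmul1Dr Ee gmul1_delta.
Qed.

Lemma cup1Dl n (a b : gH 1) (c : gH n) : cup1 (a + b) c = cup1 a c + cup1 b c.
Proof.
have [z ->] := cls_surj a; have [w ->] := cls_surj b; have [d ->] := cls_surj c.
rewrite -raddfD /= !cup1_cls -raddfD /=; congr cls.
by apply: val_inj; rewrite /= gmul1Dl.
Qed.

Lemma cup1Dr n (a : gH 1) (c d : gH n) : cup1 a (c + d) = cup1 a c + cup1 a d.
Proof.
have [z ->] := cls_surj a; have [w ->] := cls_surj c; have [v ->] := cls_surj d.
rewrite -raddfD /= !cup1_cls -raddfD /=; congr cls.
by apply: val_inj; rewrite /= gmul1Dr.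
Qed.

Lemma cup1_0r n (a : gH 1) : cup1 a (0 : gH n) = 0.
Proof. by apply: (addIr (cup1 a 0)); rewrite -cup1Dr !add0r. Qed.
Lemma cup1_0l n (c : gH n) : cup1 0 c = 0.
Proof. by apply: (addIr (cup1 0 c)); rewrite -cup1Dl !add0r. Qed.

(** By the Leibniz rule, a relation a b + c d = delta u between 2-cochains survives multiplication
    by the cocycle [e] on the right. Both [cup1_comm] and [cup1_assoc] follow from this. *)
Lemma gmul1_assoc n (a b c d u : gcochain T 1) (e : gcocycle n) :
  (forall t g h, a t (fun=> g) * b (gact t g) (fun=> h) +
                 c t (fun=> g) * d (gact t g) (fun=> h) =
                 gdelta u t (pair_tuple g h)) ->
  gmul1 a (gmul1 b e) + gmul1 c (gmul1 d e) = gdelta (gmul1 u e).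
Proof.
move=> H; apply: gcochain_eq => t x.
rewrite gdelta_mul1 gdelta_cocycle -H gmul1E contF2_0E mulr0 add0r gaddE !gmul1E.
by rewrite !mulrA -mulrDl.
Qed.

(** A 1-cocycle is a homomorphism from the action groupoid of T to F_2. *)
Lemma gcocycle1M (z : gcocycle 1) t g h :
  (z : gcochain T 1) t (fun=> (g * h)%g) =
  (z : gcochain T 1) t (fun=> g) + (z : gcochain T 1) (gact t g) (fun=> h).
Proof.
have := gdelta1E z t g h; rewrite gdelta_cocycle contF2_0E.
by move=> e; apply: F2_addr_eq0; rewrite addrA addrC.
Qed.

Lemma gcocycle1_1 (z : gcocycle 1) t : (z : gcochain T 1) t (fun=> 1%g) = 0.
Proof.
have := gcocycle1M z t 1%g 1%g; rewrite mulg1 gact1 F2_addxx //.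
Qed.

Lemma cup1_comm n (a b : gH 1) (c : gH n) : cup1 a (cup1 b c) = cup1 b (cup1 a c).
Proof.
have [z ->] := cls_surj a; have [w ->] := cls_surj b; have [e ->] := cls_surj c.
rewrite !cup1_cls; apply/cls_eqSP => /=.
(* The pointwise product of two 1-cocycles z and w has coboundary z w + w z. *)
exists (gmul1 (fun t => (z : gcochain T 1) t * (w : gcochain T 1) t) e).
apply: gmul1_assoc => t g h; rewrite gdelta1E !contF2_mulE !gcocycle1M.
have E (p q r s : 'F_2) : p * s + q * r = r * s + ((p + r) * (q + s) + p * q).
  have -> : r * s + ((p + r) * (q + s) + p * q) =
    p * s + q * r + (r * s + r * s) + (p * q + p * q) by ring.
  by rewrite !F2_addxx !addr0.
exact: E.
Qed.

Lemma pair_tupleE (x : {ptws 'I_2 -> G}) :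
  x = pair_tuple (x ord0) (x (lift ord0 ord0)).
Proof.
apply: funext => -[[|[|//]] i]; rewrite /pair_tuple /=.
all: by congr x; apply: val_inj.
Qed.

Lemma cup1_assoc n (a b c d : gH 1) (e : gH n) :
  cup1 a b = cup1 c d -> cup1 a (cup1 b e) = cup1 c (cup1 d e).
Proof.
have [z1 ->] := cls_surj a; have [z2 ->] := cls_surj b.
have [z3 ->] := cls_surj c; have [z4 ->] := cls_surj d.
have [f ->] := cls_surj e.
rewrite !cup1_cls => /cls_eqSP[u Eu]; apply/cls_eqSP; exists (gmul1 u f).
apply: gmul1_assoc => t g h; rewrite -Eu gaddE !gmul1E /=.
by congr (_ * contF2_fun _ _ + _ * contF2_fun _ _); apply: funext => i.
Qed.
End GCohomology.

(** * Double covers and the Gysin sequence *)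

Section Pullback.
Variables (G : topGroupType) (S T : gset G) (f : S -> T).
Hypothesis fE : forall s g, f (gact s g) = gact (f s) g.

Definition gpull n (c : gcochain T n) : gcochain S n := fun s => c (f s).

Lemma gpull_delta n (c : gcochain T n) : gdelta (gpull c) = gpull (gdelta c).
Proof. by apply: gcochain_eq => s x; rewrite /gpull !gdeltaE fE. Qed.

Lemma gpull_mul1 n (z : gcochain T 1) (c : gcochain T n) :
  gpull (gmul1 z c) = gmul1 (gpull z) (gpull c).
Proof. by apply: gcochain_eq => s x; rewrite /gpull !gmul1E fE. Qed.

Lemma gpull_cocycle_subproof n (z : gcocycle T n) :
  gpull z \in @gcocycle_pred _ S n.
Proof. by apply/eqP; rewrite gpull_delta gdelta_cocycle. Qed.
Definition gpull_cocycle n z : gcocycle S n :=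
  GCocycle (@gpull_cocycle_subproof n z).

Definition pullH n (c : gH T n) : gH S n := cls (gpull_cocycle (repr c)).

Lemma pull_cls n (z : gcocycle T n) : pullH (cls z) = cls (gpull_cocycle z).
Proof.
rewrite /pullH; set z' := repr _.
have : cls z' = cls z by rewrite /z' /cls reprK.
move: z'; case: n z => [|n] z z'.
  move=> /cls_eqP /= /eqP; rewrite subr_eq0 => /eqP e.
  by congr cls; apply: val_inj => /=; rewrite e.
move=> /cls_eqSP[e Ee]; apply/cls_eqSP; exists (gpull e) => /=.
by rewrite gpull_delta -Ee.
Qed.

Lemma pullH_is_zmod_morphism n : zmod_morphism (@pullH n).
Proof.
move=> a b; have [z ->] := cls_surj a; have [w ->] := cls_surj b.
rewrite -raddfB /= !pull_cls -raddfB; congr cls; exact: val_inj.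
Qed.
HB.instance Definition _ n := GRing.isZmodMorphism.Build _ _
  (@pullH n) (@pullH_is_zmod_morphism n).

Lemma pull_cup1 n a (c : gH T n) : pullH (cup1 a c) = cup1 (pullH a) (pullH c).
Proof.
have [z ->] := cls_surj a; have [w ->] := cls_surj c.
rewrite cup1_cls !pull_cls cup1_cls; congr cls; apply: val_inj; exact: gpull_mul1.
Qed.
End Pullback.

Section Cover.
Variables (G : topGroupType) (T : gset G) (z : gcocycle T 1).

Definition cover_act (p : T * 'F_2) (g : G) : T * 'F_2 :=
  (gact p.1 g, p.2 + (z : gcochain T 1) p.1 (fun=> g)).

Lemma cover_act1 p : cover_act p 1%g = p.
Proof. by case: p => t e; rewrite /cover_act gact1 gcocycle1_1 addr0. Qed.

Lemma cover_actM p g h : cover_act p (g * h)%g = cover_act (cover_act p g) h.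
Proof. by case: p => t e; rewrite /cover_act /= gactM gcocycle1M addrA. Qed.

Lemma cst_tuple_continuous n : continuous (fun g : G => (fun=> g) : {ptws 'I_n -> G}).
Proof. by apply: ptws_continuous => j x; exact: cvg_id. Qed.

Lemma cover_near p g : \forall h \near g, cover_act p h = cover_act p g.
Proof.
case: p => t e.
have /asboolP/continuousF2P/(_ g) N2 :=
  contF2P (contF2_comp (@cst_tuple_continuous 1) ((z : gcochain T 1) t)).
by apply: filterS2 (gact_near t g) N2 => h /= e1 e2; rewrite /cover_act /= e1 e2.
Qed.

Definition double_cover : gset G := GSet cover_act1 cover_actM cover_near.

Lemma cover_fst (p : double_cover) g : fst (gact p g) = gact (fst p) g.
Proof. by []. Qed.

Lemma cst_contF2_subproof (X : topologicalType) (a : 'F_2) :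
  `[< continuousF2 (fun _ : X => a) >].
Proof. by apply/asboolP/continuousF2P => x; exact: nearW. Qed.
Definition cst_contF2 (X : topologicalType) a : contF2 X :=
  ContF2 (@cst_contF2_subproof X a).

(* In terms of F = F0 + e F1, the cochain complex of the double cover is the
   mapping cone of multiplication by z (gdelta_pairc). *)
Definition pairc n (F0 F1 : gcochain T n) : gcochain double_cover n :=
  fun p => F0 p.1 + cst_contF2 _ p.2 * F1 p.1.

Lemma paircE n (F0 F1 : gcochain T n) p x :
  pairc F0 F1 p x = F0 p.1 x + p.2 * F1 p.1 x.
Proof. by []. Qed.

(** Corestriction: the sum over a fibre. On [pairc F0 F1] it gives F1, the projection from the
    mapping cone; pullback from T is the inclusion F1 = 0. *)
Definition corc n (F : gcochain double_cover n) : gcochain T n :=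
  fun t => F (t, 0) + F (t, 1).

Lemma corcE n (F : gcochain double_cover n) t x : corc F t x = F (t, 0) x + F (t, 1) x.
Proof. by []. Qed.

Lemma paircK n (F : gcochain double_cover n) :
  F = pairc (fun t => F (t, 0)) (corc F).
Proof.
apply: gcochain_eq => -[t e] x; rewrite paircE corcE /=.
case: (F2P e) => ->; first by rewrite mul0r addr0.
by rewrite mul1r addrA F2_addxx add0r.
Qed.

(** The first step of a path moves the coordinate e to e + z(t, x_0); this is the source of the term
    [gmul1 z F1]. *)
Lemma gdelta_pairc n (F0 F1 : gcochain T n) :
  gdelta (pairc F0 F1) = pairc (gdelta F0 + gmul1 z F1) (gdelta F1).
Proof.
apply: gcochain_eq => -[t e] x.
rewrite paircE gaddE !gdeltaE gmul1E paircE.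
under eq_bigr do rewrite paircE.
by rewrite /= big_split /= -mulr_sumr; ring.
Qed.

Lemma pairc_inj n (F0 F1 K0 K1 : gcochain T n) :
  pairc F0 F1 = pairc K0 K1 -> F0 = K0 /\ F1 = K1.
Proof.
move=> E.
have E0 : F0 = K0.
  apply: gcochain_eq => t x; have := congr1 (fun F : gcochain double_cover n => F (t, 0) x) E.
  by rewrite /= !mul0r !addr0.
split=> //; apply: gcochain_eq => t x.
have := congr1 (fun F : gcochain double_cover n => F (t, 1) x) E.
by rewrite /= !mul1r E0 => /addrI.
Qed.

Lemma pairc0 n : pairc (0 : gcochain T n) 0 = 0.
Proof. by apply: gcochain_eq => p x; rewrite paircE !contF2_0E mulr0 addr0. Qed.

Lemma corc_delta n (F : gcochain double_cover n) : corc (gdelta F) = gdelta (corc F).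
Proof.
rewrite {1}(paircK F) gdelta_pairc.
apply: gcochain_eq => t x; rewrite corcE !paircE /= mul0r mul1r addr0.
by rewrite addrA F2_addxx add0r.
Qed.

Lemma corc_cocycle_subproof n (c : gcocycle double_cover n) :
  corc c \in @gcocycle_pred _ T n.
Proof.
apply/eqP; rewrite -corc_delta gdelta_cocycle.
by apply: gcochain_eq => t x; exact: F2_addxx.
Qed.
Definition corc_cocycle n c : gcocycle T n :=
  GCocycle (@corc_cocycle_subproof n c).

Definition cor n (c : gH double_cover n) : gH T n := cls (corc_cocycle (repr c)).

Lemma cor_cls n (c : gcocycle double_cover n) : cor (cls c) = cls (corc_cocycle c).
Proof.
rewrite /cor; set c' := repr _.
have : cls c' = cls c by rewrite /c' /cls reprK.
move: c'; case: n c => [|n] c c'.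
  move=> /cls_eqP /= /eqP; rewrite subr_eq0 => /eqP e.
  by congr cls; apply: val_inj => /=; rewrite e.
move=> /cls_eqSP[e Ee]; apply/cls_eqSP; exists (corc e) => /=.
rewrite -corc_delta -Ee; apply: gcochain_eq => t x.
by rewrite gaddE !corcE addrACA.
Qed.

Lemma cor_is_zmod_morphism n : zmod_morphism (@cor n).
Proof.
move=> a b; have [u ->] := cls_surj a; have [w ->] := cls_surj b.
rewrite -raddfB /= !cor_cls -raddfB; congr cls; apply: val_inj => /=.
apply: gcochain_eq => t x; rewrite gaddE goppE !corcE gaddE goppE.
by rewrite opprD addrACA.
Qed.
HB.instance Definition _ n := GRing.isZmodMorphism.Build _ _
  (@cor n) (@cor_is_zmod_morphism n).

Definition res_cover n : gH T n -> gH double_cover n := pullH cover_fst (n := n).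
HB.instance Definition _ n := GRing.Additive.on (@res_cover n).

Lemma res_cover_cup1 n a (c : gH T n) :
  res_cover (cup1 a c) = cup1 (res_cover a) (res_cover c).
Proof. exact: pull_cup1. Qed.

Lemma gpull_pairc n (c : gcochain T n) : gpull (fst : double_cover -> T) c = pairc c 0.
Proof. by apply: gcochain_eq => p x; rewrite paircE contF2_0E mulr0 addr0. Qed.

(** The projection formula. *)
Lemma cor_cup1 n a (c : gH double_cover n) : cor (cup1 (res_cover a) c) = cup1 a (cor c).
Proof.
have [u ->] := cls_surj a; have [w ->] := cls_surj c.
rewrite /res_cover pull_cls cup1_cls !cor_cls cup1_cls; congr cls; apply: val_inj.
apply: gcochain_eq => t x.
rewrite corcE !gmul1E corcE mulrDr /gpull /=.
rewrite /cover_act /= add0r.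
set w' := gcocycle_val w; set e := (z : gcochain T 1) t _.
(* If e = 1 the two points of the fibre are exchanged, which leaves their sum unchanged. *)
by case: (F2P e) => ->; rewrite ?addr0 ?F2_addxx // addrC.
Qed.

Lemma res_mul_cover n (c : gH T n) : res_cover (cup1 (cls z) c) = 0.
Proof.
have [u ->] := cls_surj c; rewrite cup1_cls /res_cover pull_cls.
(* On the cover the coordinate e is a 0-cochain with coboundary z; the witness is its product with
   [u]. *)
apply/cls_eq0; exists (pairc 0 u) => /=.
by rewrite gpull_pairc gdelta_pairc gdelta_cocycle raddf0 add0r.
Qed.

Lemma mul_cover_cor n (c : gH double_cover n) : cup1 (cls z) (cor c) = 0.
Proof.
have [u ->] := cls_surj c; rewrite cor_cls cup1_cls; apply/cls_eq0.
(* For a cocycle F0 + e F1 the first component of the coboundary says that delta F0 = z F1. *)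
exists (fun t => (u : gcochain double_cover n) (t, 0)) => /=.
have := gdelta_cocycle u; rewrite {1}(paircK u) gdelta_pairc -pairc0.
by move=> /pairc_inj[+ _]; rewrite addrC -gcochain_subE => /eqP; rewrite subr_eq0 => /eqP.
Qed.

(** Exactness of the Gysin sequence, here and in [cor_eq0] and [mul_cover_eq0]: each time the two
    components of [gdelta_pairc] are compared. *)
Lemma res_cover_eq0 n (c : gH T n.+1) :
  res_cover c = 0 -> exists d : gH T n, c = cup1 (cls z) d.
Proof.
have [u ->] := cls_surj c; rewrite /res_cover pull_cls => /cls_eq0[e].
rewrite /= gpull_pairc (paircK e) gdelta_pairc => /pairc_inj[E1 E2].
have Z : corc e \in @gcocycle_pred _ T n by apply/eqP.
exists (cls (GCocycle Z)); rewrite cup1_cls; apply/cls_eqSP => /=.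
exists (fun t => e (t, 0)).
by rewrite E1 -addrA gcochain_char2 addr0.
Qed.

Lemma cor_eq0 n (c : gH double_cover n.+1) :
  cor c = 0 -> exists d : gH T n.+1, c = res_cover d.
Proof.
have [u ->] := cls_surj c; rewrite cor_cls => /cls_eq0[e /= Ee].
pose u0 : gcochain T n.+1 := fun t => (u : gcochain double_cover _) (t, 0).
have uE : (u : gcochain double_cover _) = pairc u0 (gdelta e) by rewrite -Ee -paircK.
have := gdelta_cocycle u; rewrite uE gdelta_pairc -pairc0 => /pairc_inj[E1 _].
(* Adding the coboundary of [pairc 0 e], which is [pairc (gmul1 z e) (gdelta e)], leaves a cochain
   pulled back from T. *)
have Z : u0 + gmul1 z e \in @gcocycle_pred _ T n.+1.
  by apply/eqP; rewrite raddfD /= -gmul1_delta.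
exists (cls (GCocycle Z)); rewrite /res_cover pull_cls; apply/cls_eqSP.
exists (pairc 0 e) => /=; rewrite gdelta_pairc raddf0 add0r uE.
apply: gcochain_eq => p x; rewrite gaddE gpull_pairc !paircE contF2_0E mulr0 addr0.
by rewrite gaddE addrACA F2_addxx add0r addrC.
Qed.

Lemma mul_cover_eq0 n (c : gH T n) :
  cup1 (cls z) c = 0 -> exists d, c = cor d.
Proof.
have [u ->] := cls_surj c; rewrite cup1_cls => /cls_eq0[e /= Ee].
have Z : pairc e u \in @gcocycle_pred _ double_cover n.
  apply/eqP; rewrite gdelta_pairc gdelta_cocycle Ee gcochain_char2; exact: pairc0.
exists (cls (GCocycle Z)); rewrite cor_cls; congr cls; apply: val_inj.
apply: gcochain_eq => t x; rewrite corcE !paircE /=.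
by rewrite mul0r mul1r addr0 addrA F2_addxx add0r.
Qed.
End Cover.

(** * Evaluation at a fixed point of an involution *)

Section Evaluation.
Variables (G : topGroupType) (y : G).
Hypothesis yy : (y * y = 1)%g.

Definition consx n (g : G) (x : {ptws 'I_n -> G}) : {ptws 'I_n.+1 -> G} :=
  fun i => oapp x g (unlift ord0 i).

Lemma consx0 n g (x : {ptws 'I_n -> G}) : consx g x ord0 = g.
Proof. by rewrite /consx unlift_none. Qed.

Lemma consxS n g (x : {ptws 'I_n -> G}) j : consx g x (lift ord0 j) = x j.
Proof. by rewrite /consx liftK. Qed.

Lemma tailx_consx n g (x : {ptws 'I_n -> G}) : tailx (consx g x) = x.
Proof. by apply: funext => j; exact: consxS. Qed.

Lemma face_consxS n (k : 'I_n.+1) g (x : {ptws 'I_n.+1 -> G}) :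
  face (lift ord0 (lift ord0 k)) (consx g x) =
  consx g (face (lift ord0 k) x).
Proof.
apply: funext => j; case: (unliftP ord0 j) => [i ->|->].
  rewrite consxS /face /= /bump !add1n !ltnS !eqSS !consxS.
  have -> : widen_ord (leqnSn n.+1) (lift ord0 i) =
            lift ord0 (widen_ord (leqnSn n) i) by apply: val_inj.
  by rewrite consxS.
rewrite consx0 /face /=.
by have -> : widen_ord (leqnSn n.+1) ord0 = ord0 by [apply: val_inj]; rewrite consx0.
Qed.

Lemma face1_consx n g h (x : {ptws 'I_n -> G}) :
  face (lift ord0 ord0) (consx g (consx h x)) = consx (g * h)%g x.
Proof.
apply: funext => j; case: (unliftP ord0 j) => [i ->|->].
  by rewrite /face /= !consxS.
rewrite consx0 /face /= consxS consx0.
by have -> : widen_ord (leqnSn n.+1) ord0 = ord0 by [apply: val_inj]; rewrite consx0.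
Qed.

(* The sum of all tuples with entries in {1, y} is a cycle of the bar complex,
   because each face map is two-to-one on such tuples; its class generates the
   homology of the group {1, y}. *)
Fixpoint bar_sum n : ({ptws 'I_n -> G} -> 'F_2) -> 'F_2 :=
  if n is m.+1 then fun f =>
    bar_sum (fun x => f (consx 1%g x)) + bar_sum (fun x => f (consx y x))
  else fun f => f (fun=> 1%g).

Lemma bar_sumS n (f : {ptws 'I_n.+1 -> G} -> 'F_2) :
  bar_sum f = bar_sum (fun x => f (consx 1%g x)) + bar_sum (fun x => f (consx y x)).
Proof. by []. Qed.

Lemma bar_sum_ext n (f g : {ptws 'I_n -> G} -> 'F_2) :
  f =1 g -> bar_sum f = bar_sum g.
Proof. by move=> /funext ->. Qed.

Lemma bar_sumD n (f g : {ptws 'I_n -> G} -> 'F_2) :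
  bar_sum (fun x => f x + g x) = bar_sum f + bar_sum g.
Proof. by elim: n f g => //= n IH f g; rewrite !IH addrACA. Qed.

Lemma bar_sumZ n a (f : {ptws 'I_n -> G} -> 'F_2) :
  bar_sum (fun x => a * f x) = a * bar_sum f.
Proof. by elim: n f => //= n IH f; rewrite !IH mulrDr. Qed.

Lemma bar_sum0 n : bar_sum (fun _ : {ptws 'I_n -> G} => 0) = 0.
Proof. by elim: n => //= n ->; rewrite addr0. Qed.

Lemma bar_sum_sum n m (f : 'I_m -> {ptws 'I_n -> G} -> 'F_2) :
  bar_sum (fun x => \sum_k f k x) = \sum_k bar_sum (f k).
Proof.
elim: m f => [|m IH] f.
  by rewrite big_ord0 -[RHS](bar_sum0 n); apply: bar_sum_ext => x; rewrite big_ord0.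
rewrite big_ord_recl -IH -bar_sumD; apply: bar_sum_ext => x.
by rewrite big_ord_recl.
Qed.

Lemma bar_sum_face n (k : 'I_n.+1) (f : {ptws 'I_n -> G} -> 'F_2) :
  bar_sum (fun x => f (face (lift ord0 k) x)) = 0.
Proof.
elim: n k f => [|n IH] k f.
  rewrite /=; set a := f _; set b := f _.
  by have -> : b = a; [congr f; apply: funext => -[]|exact: F2_addxx].
case: (unliftP ord0 k) => [j ->|->].
  rewrite [LHS]/=.
  have E g : bar_sum (fun x : {ptws 'I_n.+1 -> G} =>
      f (face (lift ord0 (lift ord0 j)) (consx g x))) = 0.
    under bar_sum_ext do rewrite face_consxS.
    exact: (IH j (fun x => f (consx g x))).
  by rewrite -[RHS](addr0 0); congr (_ + _); exact: E.
rewrite [LHS]/=.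
have E g h : bar_sum (fun x : {ptws 'I_n -> G} =>
    f (face (lift ord0 ord0) (consx g (consx h x)))) =
    bar_sum (fun x => f (consx (g * h)%g x)).
  by apply: bar_sum_ext => x; rewrite face1_consx.
rewrite !E !mulg1 mul1g yy addrACA [X in _ + X]addrC.
by rewrite F2_addxx.
Qed.

Variables (T : gset G) (t : T).
Hypothesis ty : gact t y = t.

(** Restriction to the subgroup {1, y} of the stabiliser of [t], paired with the bar cycle. *)
Definition evc n (c : gcochain T n) : 'F_2 := bar_sum (c t).

Lemma evc_delta n (e : gcochain T n) : evc (gdelta e) = 0.
Proof.
rewrite /evc; under bar_sum_ext do rewrite gdeltaE.
rewrite bar_sumD bar_sum_sum big1 ?addr0 => [|k _]; last exact: bar_sum_face.
have E g : bar_sum (fun x : {ptws 'I_n -> G} =>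
    e (gact t (consx g x ord0)) (tailx (consx g x))) = bar_sum (e (gact t g)).
  by apply: bar_sum_ext => x; rewrite consx0 tailx_consx.
by rewrite bar_sumS !E gact1 ty F2_addxx.
Qed.

Lemma evc_mul1 n (z : gcocycle T 1) (c : gcochain T n) :
  evc (gmul1 z c) = (z : gcochain T 1) t (fun=> y) * evc c.
Proof.
have E g : bar_sum (fun x : {ptws 'I_n -> G} => gmul1 z c t (consx g x)) =
    (z : gcochain T 1) t (fun=> g) * bar_sum (c (gact t g)).
  rewrite -bar_sumZ; apply: bar_sum_ext => x.
  by rewrite gmul1E consx0 tailx_consx.
(* A cocycle vanishes at 1, so only the tuples beginning with [y] contribute. *)
by rewrite /evc bar_sumS !E gcocycle1_1 mul0r add0r ty.
Qed.

Lemma evcD n (c d : gcochain T n) : evc (c + d) = evc c + evc d.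
Proof. exact: bar_sumD. Qed.

Definition ev n (c : gH T n) : 'F_2 := evc (repr c).

Lemma ev_cls n (c : gcocycle T n) : ev (cls c) = evc c.
Proof.
rewrite /ev; set c' := repr _.
have : cls c' = cls c by rewrite /c' /cls reprK.
case: n c c' => [|n] c c'.
  by move=> /cls_eqP /= /eqP; rewrite subr_eq0 => /eqP ->.
move=> /cls_eqSP[e Ee]; apply: F2_addr_eq0; by rewrite -evcD Ee evc_delta.
Qed.

Lemma evD n (a b : gH T n) : ev (a + b) = ev a + ev b.
Proof.
have [z ->] := cls_surj a; have [w ->] := cls_surj b.
by rewrite -raddfD /= !ev_cls /= evcD.
Qed.

Lemma ev0 n : ev (0 : gH T n) = 0.
Proof. by apply: (addIr (ev (0 : gH T n))); rewrite -evD !add0r. Qed.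

Lemma ev1_cls (z : gcocycle T 1) : ev (cls z) = (z : gcochain T 1) t (fun=> y).
Proof.
rewrite ev_cls /evc /=.
have E g (x : {ptws 'I_0 -> G}) : consx g x = fun=> g.
  by apply: funext => i; rewrite (ord1 i) consx0.
by rewrite !E gcocycle1_1 add0r.
Qed.

Lemma ev_cup1 n a (c : gH T n) : ev (cup1 a c) = ev a * ev c.
Proof.
have [z ->] := cls_surj a; have [w ->] := cls_surj c.
by rewrite cup1_cls ev_cls evc_mul1 ev1_cls ev_cls.
Qed.
End Evaluation.

Lemma ev_pull (G : topGroupType) (y : G) (S T : gset G) (f : S -> T)
    (fE : forall s g, f (gact s g) = gact (f s) g) (s : S) n (c : gH T n) :
  (y * y = 1)%g -> gact s y = s ->
  ev y s (pullH fE c) = ev y (f s) c.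
Proof.
move=> yy sy; have fy : gact (f s) y = f s by rewrite -fE sy.
by have [z ->] := cls_surj c; rewrite pull_cls !ev_cls.
Qed.

(** Where the class of [z] vanishes at [t], [y] fixes both points over [t]. *)
Lemma ev_cor (G : topGroupType) (y : G) (T : gset G) (z : gcocycle T 1) (t : T)
    n (c : gH (double_cover z) n) :
  (y * y = 1)%g -> gact t y = t -> ev y t (cls z) = 0 ->
  ev y t (cor c) = ev y ((t, 0) : double_cover z) c + ev y ((t, 1) : double_cover z) c.
Proof.
move=> yy ty; rewrite ev1_cls // => zy.
have fy e : gact ((t, e) : double_cover z) y = (t, e).
  by rewrite /= /cover_act /= ty zy addr0.
have [u ->] := cls_surj c.
by rewrite cor_cls !ev_cls // /evc -bar_sumD; apply: bar_sum_ext => x; rewrite corcE.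
Qed.

(** * The Bockstein relation *)

(** The second elementary symmetric polynomial. If s of the five bits are 1, it is binomial(s, 2)
    mod 2, the binary digit of weight 2 of s. *)
Definition e2_5 (a b c d e : 'F_2) : 'F_2 :=
  a * b + a * c + a * d + a * e + b * c + b * d + b * e + c * d + c * e + d * e.

Definition bool_F2 (b : bool) : 'F_2 := if b then 1 else 0.
Lemma bool_F2_surj a : exists b, a = bool_F2 b.
Proof. by case: (F2P a) => ->; [exists false|exists true]. Qed.
Lemma bool_F2D a b : bool_F2 a + bool_F2 b = bool_F2 (a (+) b).
Proof. by case: a; case: b; rewrite /= ?addr0 ?add0r ?F2_addxx. Qed.
Lemma bool_F2M a b : bool_F2 a * bool_F2 b = bool_F2 (a && b).
Proof. by case: a; case: b; rewrite /= ?mul0r ?mulr0 ?mulr1. Qed.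

(** The coboundary of the cochain [k] of [bockstein_relation], evaluated on steps g, h, l. Values on
    products of steps are eliminated by the cocycle relations and by delta f = x w + z z; ten free
    bits remain, and all cases are checked. *)
Lemma bockstein_identity (xg xh wh wl zg zh zl fg fh fl : 'F_2) :
  let k x w z z' a b c := e2_5 (x * w) (z * z') a b c + a + b in
  let fgh := fg + fh + (xg * wh + zg * zh) in
  let fhl := fh + fl + (xh * wl + zh * zl) in
  let fghl := fgh + fl + ((xg + xh) * wl + (zg + zh) * zl) in
  k xh wl zh zl fh fl fhl + (k (xg + xh) wl (zg + zh) zl fgh fl fghl +
  (k xg (wh + wl) zg (zh + zl) fg fhl fghl + k xg wh zg zh fg fh fgh)) =
  xg * (xh * wl) + xg * (wh * wl).
Proof.
have [xg' ->] := bool_F2_surj xg; have [xh' ->] := bool_F2_surj xh.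
have [wh' ->] := bool_F2_surj wh.
have [wl' ->] := bool_F2_surj wl; have [zg' ->] := bool_F2_surj zg.
have [zh' ->] := bool_F2_surj zh; have [zl' ->] := bool_F2_surj zl.
have [fg' ->] := bool_F2_surj fg; have [fh' ->] := bool_F2_surj fh.
have [fl' ->] := bool_F2_surj fl.
rewrite /e2_5 /=.
rewrite !(bool_F2D, bool_F2M); congr bool_F2.
by case: xg'; case: xh'; case: wh'; case: wl'; case: zg'; case: zh'; case: zl';
  case: fg'; case: fh'; case: fl'.
Qed.
Section Bockstein.
Variables (G : topGroupType) (T : gset G).

(** The Bockstein is a derivation: it kills z z and sends x w to x x w + x w w. The cochain [k]
    below makes this explicit. *)
Lemma bockstein_relation (x w z : gH T 1) :
  cup1 z z = cup1 x w -> cup1 x (cup1 x w) = cup1 x (cup1 w w).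
Proof.
have [x' ->] := cls_surj x; have [w' ->] := cls_surj w.
have [z' ->] := cls_surj z.
rewrite !cup1_cls => /cls_eqSP[f /= Ef]; apply/cls_eqSP => /=.
pose X t g := (x' : gcochain T 1) t (fun=> g).
pose W t g := (w' : gcochain T 1) t (fun=> g).
pose Z t g := (z' : gcochain T 1) t (fun=> g).
pose F t g := f t (fun=> g).
have FM t g h : F t (g * h)%g =
    F t g + F (gact t g) h + (X t g * W (gact t g) h + Z t g * Z (gact t g) h).
  have := congr1 (fun c : gcochain T 2 => c t (pair_tuple g h)) Ef.
  rewrite gdelta1E gaddE !gmul1E -/(X t g) -/(Z t g).
  have -> : tailx (pair_tuple g h) = fun=> h by apply: funext => i.
  rewrite [pair_tuple g h ord0]/= -/(W _ _) -/(Z _ _) -/(F _ _) -/(F t (g * h)%g) -/(F t g).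
  move=> E; apply: F2_addr_eq0.
  rewrite [X in _ + (_ + X)]addrC E.
  set p := F t _; set q := F t _; set r := F _ h.
  have -> : p + (q + r + (r + (p + q))) = (p + p) + (q + q) + (r + r) by ring.
  by rewrite !F2_addxx.
(* k is half of the integral lift of x w + z z - delta f, reduced mod 2. *)
pose k : gcochain T 2 := fun t =>
  let a := gmul1 x' w' t in let b := gmul1 z' z' t in
  let c := contF2_comp (@headx_continuous G 1) (f t) in let d := gshift f t in
  let e := contF2_comp (@face_continuous G 1 (lift ord0 ord0)) (f t) in
  a * b + a * c + a * d + a * e + b * c + b * d + b * e + c * d + c * e + d * e
  + c + d.
have kE t g h : k t (pair_tuple g h) =
    e2_5 (X t g * W (gact t g) h) (Z t g * Z (gact t g) h)
      (F t g) (F (gact t g) h) (F t (g * h)%g) + F t g + F (gact t g) h.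
  have E1 : tailx (pair_tuple g h) = fun=> h by apply: funext => i.
  have E2 : face (lift ord0 ord0) (pair_tuple g h) = fun=> (g * h)%g.
    by apply: funext => i; rewrite (ord1 i).
  by rewrite /X /W /Z /F -E2 -E1.
exists k; apply: gcochain_eq => t p.
pose g := p ord0; pose h := p (lift ord0 ord0); pose l := p (lift ord0 (lift ord0 ord0)).
rewrite gdeltaE !big_ord_recl big_ord0 addr0.
have -> : tailx p = pair_tuple h l by rewrite [LHS]pair_tupleE.
have -> : face (lift ord0 ord0) p = pair_tuple (g * h)%g l.
  rewrite [LHS]pair_tupleE; congr pair_tuple; rewrite /face /=.
  by congr (_ * _)%g; congr p; apply: val_inj.
have -> : face (lift ord0 (lift ord0 ord0)) p = pair_tuple g (h * l)%g.
  rewrite [LHS]pair_tupleE; congr pair_tuple; rewrite /face /=.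
    by congr p; apply: val_inj.
  by congr (_ * _)%g; congr p; apply: val_inj.
have -> : face (lift ord0 (lift ord0 (lift ord0 ord0))) p = pair_tuple g h.
  rewrite [LHS]pair_tupleE; congr pair_tuple; rewrite /face /=.
    by congr p; apply: val_inj.
  by congr p; apply: val_inj.
rewrite !kE gaddE !gmul1E.
have -> : tailx (tailx p) = fun=> l.
  by apply: funext => i; rewrite (ord1 i).
rewrite -/g -/(X t g).
have XM s a b : X s (a * b)%g = X s a + X (gact s a) b by exact: gcocycle1M.
have WM s a b : W s (a * b)%g = W s a + W (gact s a) b by exact: gcocycle1M.
have ZM s a b : Z s (a * b)%g = Z s a + Z (gact s a) b by exact: gcocycle1M.
have FM3 : F t (g * (h * l))%g = F t g + F (gact t g) h +
     (X t g * W (gact t g) h + Z t g * Z (gact t g) h) + F (gact (gact t g) h) l +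
     ((X t g + X (gact t g) h) * W (gact (gact t g) h) l +
      (Z t g + Z (gact t g) h) * Z (gact (gact t g) h) l).
  by rewrite mulgA FM FM XM ZM gactM.
rewrite -mulgA FM3 !XM !WM !ZM !FM !gactM.
by rewrite (bockstein_identity (X t g) (X (gact t g) h) (W (gact t g) h) (W (gact (gact t g) h) l)
  (Z t g) (Z (gact t g) h) (Z (gact (gact t g) h) l) (F t g) (F (gact t g) h) (F (gact (gact t g) h) l)).
Qed.
End Bockstein.

(** * Periodicity and towers of double covers *)

Section Operators.
Variables (G : topGroupType) (T : gset G).

Lemma one_subproof : (fun=> 1 : cochain G 0) \in @gcocycle_pred G T 0.
Proof.
apply/eqP; apply: gcochain_eq => t x.
by rewrite gdeltaE big_ord1; exact: F2_addxx.
Qed.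
Definition gH_one : gH T 0 := cls (GCocycle one_subproof).

Lemma cup1_one (a : gH T 1) : cup1 a gH_one = a.
Proof.
have [z ->] := cls_surj a; rewrite cup1_cls; congr cls; apply: val_inj.
apply: gcochain_eq => t x; rewrite gmul1E mulr1.
by congr (contF2_fun _ _); apply: funext => i; rewrite (ord1 i).
Qed.

Lemma cup1_sym (a b : gH T 1) : cup1 a b = cup1 b a.
Proof. by rewrite -{1}(cup1_one b) cup1_comm cup1_one. Qed.

(** Injectivity is asked only from degree 2 on: for a quasi-Boolean group the kernel of x in degree
    1 is the dual summand. *)
Definition periodic (x : gH T 1) : Prop :=
  (forall n (c : gH T n.+2), exists d, c = cup1 x d) /\
  (forall n (c : gH T n.+2), cup1 x c = 0 -> c = 0).

(* If z z = x w, then z z (z + x) (z + x) = x x w (x + w), which vanishes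
   by the Bockstein relation. *)
Lemma serre_product (x z w : gH T 1) : cup1 z z = cup1 x w ->
  cup1 z (cup1 z (cup1 (z + x) (z + x))) = 0.
Proof.
move=> zz; have S := bockstein_relation zz.
have yy : cup1 (z + x) (z + x) = cup1 x (w + x).
  rewrite cup1Dl !cup1Dr zz -addrA [X in _ + X]addrA (cup1_sym z x) gH_char2 add0r.
  by [].
rewrite yy (cup1_comm z x) (cup1_comm z x) (cup1_sym z (w + x)) (cup1_comm z (w + x)).
by rewrite zz (cup1_comm (w + x) x) cup1Dl !cup1Dr -S gH_char2.
Qed.

(* b x^7 = (x b)^4 is a multiple of z z (z + x) (z + x). *)
Lemma vanishes_on_both_covers (x b z : gH T 1) (c d : gH T 1) :
  periodic x -> cup1 b b = cup1 x b ->
  cup1 x b = cup1 z c -> cup1 x b = cup1 (z + x) d -> cup1 x b = 0.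
Proof.
move=> [sx ix] bb e1 e2.
have [w zz] := sx _ (cup1 z z).
have uS n (e : gH T n) : cup1 b (cup1 x e) = cup1 x (cup1 b e) by rewrite cup1_comm.
have P : cup1 x (cup1 b (cup1 x (cup1 b (cup1 x (cup1 b (cup1 x (cup1 b gH_one))))))) = 0.
  have E1 n (e : gH T n) : cup1 x (cup1 b e) = cup1 z (cup1 c e) by apply: cup1_assoc.
  have E2 n (e : gH T n) : cup1 x (cup1 b e) = cup1 (z + x) (cup1 d e) by apply: cup1_assoc.
  have : cup1 z (cup1 z (cup1 (z + x) (cup1 (z + x) gH_one))) = 0.
    by rewrite cup1_one (serre_product zz).
  rewrite E1 E2 E1 E2; move: (z + x) => y Py.
  rewrite !(cup1_comm z c, cup1_comm y c, cup1_comm y d, cup1_comm z d, cup1_comm y z, cup1_comm d c).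
  by rewrite Py !cup1_0r.
have bbn n (e : gH T n) : cup1 b (cup1 b e) = cup1 x (cup1 b e) by apply: cup1_assoc.
move: P; rewrite !(uS, bbn) cup1_one.
(* [P] now reads x^7 b = 0. Six factors can be cancelled; the last one cannot, since b has degree
   1. *)
by do 6 move=> /ix.
Qed.

End Operators.

Section PeriodicCover.
Variables (G : topGroupType) (T : gset G) (z : gcocycle T 1).

(** The two four lemmas for multiplication by x on the Gysin sequence. The chase uses surjectivity
    and injectivity exactly in the degrees granted by [periodic]. *)
Lemma periodic_cover (x : gH T 1) :
  periodic x -> periodic (res_cover z x).
Proof.
move=> [sx ix]; split=> n c.
  have [w ew] := sx _ (cor c).
  have zw : cup1 (cls z) w = 0.
    by apply: ix; rewrite cup1_comm -ew mul_cover_cor.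
  have [w' ew'] := mul_cover_eq0 zw.
  have [|d ed] := @cor_eq0 _ _ z _ (c - cup1 (res_cover z x) w').
    by rewrite raddfB /= cor_cup1 -ew' ew subrr.
  have [e ee] := sx _ d.
  exists (res_cover z e + w'); rewrite cup1Dr -res_cover_cup1 -ee -ed.
  by rewrite subrK.
move=> xc; have [|d ed] := @cor_eq0 _ _ z _ c.
  by apply: ix; rewrite -cor_cup1 xc raddf0.
have [|e ee] := @res_cover_eq0 _ _ z _ (cup1 x d); first by rewrite res_cover_cup1 -ed.
have [f ef] := sx _ e.
have -> : c = res_cover z (cup1 (cls z) f); last exact: res_mul_cover.
rewrite ed; congr (res_cover z _); apply: gH_addr_eq0; apply: ix.
by rewrite cup1Dr ee ef cup1_comm gH_char2.
Qed.
End PeriodicCover.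

(** * Towers of double covers and localisation at an involution *)

Section Towers.
Variable G : topGroupType.

Definition gpoint : gset G.
Proof.
exists unit (fun t _ => t) => // t g; exact: nearW.
Defined.

Definition from_point (T : gset G) n : gH gpoint n -> gH T n :=
  pullH (f := fun=> tt : gpoint) (fun _ _ => erefl) (n := n).
HB.instance Definition _ T n := GRing.Additive.on (@from_point T n).

Lemma from_point_cup1 T n a (c : gH gpoint n) :
  from_point T (cup1 a c) = cup1 (from_point T a) (from_point T c).
Proof. exact: pull_cup1. Qed.

Lemma from_point_id n (c : gH gpoint n) : from_point gpoint c = c.
Proof.
have [u ->] := cls_surj c; rewrite /from_point pull_cls; congr cls.
by apply: val_inj; apply: gcochain_eq => -[].
Qed.

Lemma res_from_point T z n (c : gH gpoint n) :
  @res_cover G T z n (from_point T c) = from_point (double_cover z) c.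
Proof.
have [u ->] := cls_surj c; rewrite /from_point /res_cover !pull_cls; congr cls.
exact: val_inj.
Qed.

Lemma ev_from_point (y : G) (T : gset G) (t : T) n (c : gH gpoint n) :
  (y * y = 1)%g -> gact t y = t -> ev y t (from_point T c) = ev y (tt : gpoint) c.
Proof. by move=> yy ty; rewrite ev_pull. Qed.

Inductive tower : gset G -> Prop :=
| tower_point : tower gpoint
| tower_cover T (z : gcocycle T 1) : tower T -> tower (double_cover z).

Variable x : gH gpoint 1.
Hypotheses (x_periodic : periodic x) (x_square : forall a : gH gpoint 1, cup1 a a = cup1 x a).

Lemma tower_periodic T : tower T -> periodic (from_point T x).
Proof.
elim=> [|{}T z _ IH]; first by rewrite from_point_id.
by rewrite -res_from_point; exact: periodic_cover.
Qed.

Variable y : G.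
Hypotheses (yy : (y * y = 1)%g) (xy : ev y (tt : gpoint) x = 1).

(* Together, these say that H^1 of T, localised at the classes of G that do not
   vanish at y, is the ring of functions on the fixed points of y in T. *)
Definition detected (T : gset G) : Prop := forall w : gH T 1,
  (forall t : T, gact t y = t -> ev y t w = 0) ->
  exists b : gH gpoint 1, ev y (tt : gpoint) b = 1 /\ cup1 (from_point T b) w = 0.
Definition interpolated (T : gset G) : Prop := forall f : T -> 'F_2,
  exists w : gH T 1, forall t, gact t y = t -> ev y t w = f t.

Lemma fixed_cover T (z : gcocycle T 1) t e :
  gact ((t, e) : double_cover z) y = (t, e) <-> gact t y = t /\ ev y t (cls z) = 0.
Proof.
split=> [|[ty]]; last first.
  by rewrite ev1_cls //= /cover_act /= ty => ->; rewrite addr0.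
rewrite /= /cover_act /= => -[ty]; rewrite -{2}(addr0 e) => /addrI zy.
by rewrite ev1_cls.
Qed.

(** Denominators stay in degree 1: the product b' b is replaced by a class b3 with x b3 = b' b, and
    x is cancelled. *)
Lemma localisation_mul T (b b' : gH gpoint 1) (w : gH T 1) : tower T ->
  ev y (tt : gpoint) b = 1 -> ev y (tt : gpoint) b' = 1 ->
  cup1 (from_point T b') (cup1 (from_point T b) w) = 0 ->
  exists b : gH gpoint 1, ev y (tt : gpoint) b = 1 /\ cup1 (from_point T b) w = 0.
Proof.
move=> tT by1 by1' bbw; have [sx _] := x_periodic.
have [b3 e3] := sx _ (cup1 b' b); exists b3; split.
  have := congr1 (@ev _ y _ (tt : gpoint) _) e3.
  by rewrite !ev_cup1 // by1 by1' xy !mul1r => <-.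
have [_ ix] := tower_periodic tT; apply: ix; rewrite -bbw; apply: esym.
by apply: cup1_assoc; rewrite -!from_point_cup1 e3.
Qed.

Lemma tower_localisation T : tower T -> detected T /\ interpolated T.
Proof.
elim=> [|{}T z tT [dT iT]].
  split=> [w wy|f].
    (* This class is 1 at [y] and kills [w], because w w = x w. *)
    exists (x + w); rewrite evD // xy wy // addr0 from_point_id; split=> //.
    by rewrite cup1Dl x_square gH_char2.
  exists (if f tt == 0 then 0 else x) => -[] _.
  case: (F2P (f tt)) => ->; first by rewrite eqxx ev0.
  by rewrite oner_eq0.
have [sx ix] := tower_periodic tT.
have evx t : gact t y = t -> ev y t (from_point T x) = 1.
  by move=> ty; rewrite ev_from_point.
split=> [w wy|f].
  have [t ty|b [by1 bw]] := dT (cor w).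
    have [zy|zy] := F2P (ev y t (cls z)).
      rewrite ev_cor // !wy ?addr0 //; exact/fixed_cover.
    have := congr1 (@ev _ y _ t _) (mul_cover_cor w).
    by rewrite ev_cup1 // zy mul1r ev0.
  have [|d ed] := @cor_eq0 _ _ z _ (cup1 (res_cover z (from_point T b)) w).
    by rewrite cor_cup1 bw.
  have [v ev'] := sx _ d.
  have vy t : gact t y = t -> ev y t (cls z) = 0 -> ev y t v = 0.
    move=> ty zy; have ty' : gact ((t, 0) : double_cover z) y = (t, 0) by apply/fixed_cover.
    have := congr1 (@ev _ y _ ((t, 0) : double_cover z) _) ed.
    rewrite ev_cup1 // wy // mulr0 /res_cover ev_pull // ev' ev_cup1 //= evx // mul1r.
    by move=> ->.
  (* [v''] plays the role of z v' / x. At fixed points it agrees with [v], which vanishes where z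
     does, while x v'' dies on the cover. *)
  have [v' ev1] := iT (fun t => ev y t v).
  have [v'' ev2] := sx _ (cup1 (cls z) v').
  have [t ty|b' [by2 bv]] := dT (v'' + v).
    have E : ev y t v'' = ev y t (cls z) * ev y t v.
      by rewrite -ev1 // -ev_cup1 // ev2 ev_cup1 // evx // mul1r.
    rewrite evD // E; have [zy|->] := F2P (ev y t (cls z)).
      by rewrite vy // mulr0 addr0.
    by rewrite mul1r F2_addxx.
  have bv' : cup1 (from_point T b') v = cup1 (from_point T b') v''.
    by apply: gH_addr_eq0; rewrite -cup1Dr addrC.
  apply: (localisation_mul (tower_cover z tT) by1 by2).
  rewrite -!res_from_point ed -res_cover_cup1 ev' cup1_comm bv' cup1_comm -ev2 cup1_comm.
  exact: res_mul_cover.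
(* The fibre sums are prescribed first. To be a corestriction, [w0] should be killed by z; z w0
   vanishes only at the fixed points, so [w0] is replaced by w0' = b w0 / x, which z does kill. *)
have [w0 ew0] := iT (fun t => if ev y t (cls z) == 0 then f (t, 0) + f (t, 1) else 0).
have [u eu] := sx _ (cup1 (cls z) w0).
have [t ty|b [by1 bu]] := dT u.
  have := congr1 (@ev _ y _ t _) eu; rewrite !ev_cup1 // evx // mul1r => <-.
  rewrite ew0 //; case: (F2P (ev y t (cls z))) => ->; first by rewrite mul0r.
  by rewrite oner_eq0 mulr0.
have [w0' ew0'] := sx _ (cup1 (from_point T b) w0).
have ew1 t : gact t y = t -> ev y t w0' = ev y t w0.
  move=> ty; have := congr1 (@ev _ y _ t _) ew0'.
  by rewrite !ev_cup1 // evx // ev_from_point // by1 !mul1r.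
have [|w1 e1] := @mul_cover_eq0 _ _ z _ w0'.
  by apply: ix; rewrite cup1_comm -ew0' cup1_comm eu cup1_comm bu cup1_0r.
(* A class pulled back from T adjusts the values at the points (t, 0) and keeps the fibre sums. *)
have [v ev2] := iT (fun t => f (t, 0) + ev y ((t, 0) : double_cover z) w1).
exists (w1 + res_cover z v) => -[t e] te.
have [ty zy] := (fixed_cover _ _ _).1 te.
rewrite evD // /res_cover ev_pull //= ev2 //.
case: (F2P e) te => -> te; first by rewrite addrCA F2_addxx addr0.
have := ev_cor w1 yy ty zy; rewrite -e1 ew1 // ew0 // zy eqxx => E.
rewrite addrCA [X in _ + X]addrC -E addrA F2_addxx add0r //.
Qed.
End Towers.

(** * Double covers from subgroups of index two *)

Section Characters.
Variable G : topGroupType.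

(** The continuous character of G attached to a class in H^1(G). Coboundaries of degree 1 vanish on
    a point, so the representative is immaterial. *)
Definition chi (c : gH (gpoint G) 1) : contF2 G :=
  contF2_comp (@cst_tuple_continuous G 1) ((repr c : gcochain (gpoint G) 1) tt).

Lemma gcoboundary_point (f : gcochain (gpoint G) 1) t x :
  is_gcoboundary f -> f t x = 0.
Proof.
case=> g ->; rewrite gdeltaE big_ord1 /=.
have E (u v : {ptws 'I_0 -> G}) : g t u = g t v.
  by congr (contF2_fun _ _); apply: funext => -[].
by case: t E => E; rewrite (E _ (tailx x)) F2_addxx.
Qed.

Lemma chi_cls (z : gcocycle (gpoint G) 1) g :
  chi (cls z) g = (z : gcochain _ 1) tt (fun=> g).
Proof.
rewrite /chi /=; set z' := repr _.
have /cls_eqP : cls z' = cls z by rewrite /z' /cls reprK.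
move=> /(gcoboundary_point tt (fun=> g)); rewrite gcochain_subE gaddE.
exact: F2_addr_eq0.
Qed.

Lemma chiM c g h : chi c (g * h)%g = chi c g + chi c h.
Proof. by have [z ->] := cls_surj c; rewrite !chi_cls gcocycle1M. Qed.

Lemma chi1 c : chi c 1%g = 0.
Proof. by have [z ->] := cls_surj c; rewrite !chi_cls gcocycle1_1. Qed.

Lemma chiV c g : chi c (g^-1)%g = chi c g.
Proof. by apply: F2_addr_eq0; rewrite -chiM mulVg chi1. Qed.

Lemma chiJ c g h : chi c (g ^ h)%g = chi c g.
Proof. by rewrite /conjg !chiM chiV addrCA F2_addxx addr0. Qed.

Lemma chiD c d g : chi (c + d) g = chi c g + chi d g.
Proof.
have [z ->] := cls_surj c; have [w ->] := cls_surj d.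
have -> : cls z + cls w = cls (z + w) by rewrite raddfD.
by rewrite !chi_cls.
Qed.

Lemma chi_inj c d : chi c =1 chi d -> c = d.
Proof.
have [z ->] := cls_surj c; have [w ->] := cls_surj d => E; congr cls.
apply: val_inj; apply: gcochain_eq => -[] x.
have -> : x = fun=> x ord0 by apply: funext => i; rewrite (ord1 i).
by have := E (x ord0); rewrite !chi_cls.
Qed.

Lemma ev_point y c : (y * y = 1)%g -> ev y (tt : gpoint G) c = chi c y.
Proof. by move=> yy; have [z ->] := cls_surj c; rewrite ev1_cls // chi_cls. Qed.

Lemma chi_zero g : chi 0 g = 0.
Proof. by apply: (addIr (chi 0 g)); rewrite -chiD !add0r. Qed.

Lemma from_point_cls (T : gset G) c : exists z : gcocycle T 1,
  from_point T c = cls z /\ forall t g, (z : gcochain T 1) t (fun=> g) = chi c g.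
Proof.
exists (gpull_cocycle (f := fun=> tt : gpoint G) (fun _ _ => erefl) (repr c)).
by split.
Qed.
End Characters.

(** * Shapiro's lemma in degree 1 *)

Section Induction.
Variables (G : topGroupType) (T : gset G) (t0 : T) (s : T -> G).

(** The section [s] leads from the base point to every point; in particular T is transitive. *)
Definition pointed : Prop := s t0 = 1%g /\ forall t, gact t0 (s t) = t.

(** The Schreier elements of the stabiliser of [t0]. *)
Definition transfer t g : G := (s t * g * (s (gact t g))^-1)%g.

Lemma transferM t g h :
  (transfer t g * transfer (gact t g) h)%g = transfer t (g * h)%g.
Proof. by rewrite /transfer gactM !mulgA mulgVK. Qed.

Lemma transfer_stab t g : pointed -> gact t0 (transfer t g) = t0.
Proof.
case=> _ sE; rewrite /transfer !gactM sE -{1}(sE (gact t g)) -gactM.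
by rewrite mulgV gact1.
Qed.

Lemma transfer_t0 g : pointed -> gact t0 g = t0 -> transfer t0 g = g.
Proof. by case=> s1 _ e; rewrite /transfer e s1 invg1 mulg1 mul1g. Qed.

Lemma transfer_section t : pointed -> transfer t0 (s t) = 1%g.
Proof. by case=> s1 sE; rewrite /transfer sE s1 mul1g mulgV. Qed.

Lemma lmul_continuous (a : G) : continuous (fun g : G => (a * g)%g).
Proof.
move=> g; apply: (@continuous_comp _ _ _ (fun g : G => (a, g)) (fun p : G * G => (p.1 * p.2)%g)).
  by apply: cvg_pair; [exact: cvg_cst|exact: cvg_id].
exact: mulg_continuous.
Qed.

Lemma rmul_continuous (a : G) : continuous (fun g : G => (g * a)%g).
Proof.
move=> g; apply: (@continuous_comp _ _ _ (fun g : G => (g, a)) (fun p : G * G => (p.1 * p.2)%g)).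
  by apply: cvg_pair; [exact: cvg_id|exact: cvg_cst].
exact: mulg_continuous.
Qed.

Lemma induced_subproof (f : contF2 G) t :
  `[< continuousF2 (fun x : {ptws 'I_1 -> G} => f (transfer t (x ord0))) >].
Proof.
apply/asboolP/continuousF2P => x.
have N1 : \forall y \near x, gact t (y ord0) = gact t (x ord0).
  exact: (@ptws_proj_continuous _ G (ord0 : 'I_1) x _ (gact_near t (x ord0))).
pose h (y : {ptws 'I_1 -> G}) := (s t * y ord0 * (s (gact t (x ord0)))^-1)%g.
have hc : continuous h.
  move=> u; apply: (@continuous_comp _ _ _ (fun y : {ptws 'I_1 -> G} => y ord0)
    (fun g => s t * g * (s (gact t (x ord0)))^-1)%g).
    exact: ptws_proj_continuous.
  apply: (@continuous_comp _ _ _ (fun g => s t * g)%g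
    (fun g => g * (s (gact t (x ord0)))^-1)%g).
    exact: lmul_continuous.
  exact: rmul_continuous.
have /asboolP/continuousF2P/(_ x) N2 := contF2P (contF2_comp hc f).
by apply: filterS2 N1 N2 => u e1 /= e2; rewrite /transfer e1; exact: e2.
Qed.

(** The inverse of Shapiro's isomorphism on cochains: for a pointed T only the values of [f] on the
    stabiliser of [t0] enter. *)
Definition induced (f : contF2 G) : gcochain T 1 := fun t => ContF2 (induced_subproof f t).

Lemma inducedE f t g : induced f t (fun=> g) = f (transfer t g).
Proof. by []. Qed.

Hypothesis t0s : pointed.

Lemma induced_delta f t g h : gdelta (induced f) t (pair_tuple g h) =
  f (transfer (gact t g) h) + (f (transfer t g * transfer (gact t g) h)%g + f (transfer t g)).
Proof. by rewrite gdelta1E !inducedE transferM. Qed.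

Lemma induced_cocycle_subproof (f : contF2 G) :
  (forall g h, gact t0 g = t0 -> gact t0 h = t0 -> f (g * h)%g = f g + f h) ->
  induced f \in @gcocycle_pred G T 1.
Proof.
move=> fM; apply/eqP; apply: gcochain_eq => t x.
rewrite (pair_tupleE x) induced_delta fM; [|exact: transfer_stab..].
set p := f _; set q := f _; have -> : p + (q + p + q) = (p + p) + (q + q) by ring.
by rewrite !F2_addxx.
Qed.
End Induction.

Section Extension.
Variables (G : topGroupType) (T : gset G) (t0 : T) (s : T -> G).
Hypothesis t0s : pointed t0 s.
Variable f : contF2 G.
Hypothesis fM : forall g h, gact t0 g = t0 -> gact t0 h = t0 ->
  f (g * h)%g = f g + f h.

Definition ext_cocycle : gcocycle T 1 := GCocycle (induced_cocycle_subproof t0s fM).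

(** [k] is meant to stabilise [t0] with f k = 1, so that it leads from (t0, 0) to (t0, 1). *)
Definition ext_section (k : G) (p : double_cover ext_cocycle) : G :=
  ((if p.2 == 0 then 1 else k) * s p.1)%g.

Lemma ext_stab g :
  gact ((t0, 0) : double_cover ext_cocycle) g = (t0, 0) <-> gact t0 g = t0 /\ f g = 0.
Proof.
rewrite /= /cover_act /= add0r; split=> [[e]|[e f0]].
  by rewrite transfer_t0 //.
by rewrite e transfer_t0 // f0.
Qed.

Lemma ext_pointed k : gact t0 k = t0 -> f k = 1 ->
  pointed ((t0, 0) : double_cover ext_cocycle) (ext_section k).
Proof.
move=> k0 fk; have [s1 sE] := t0s; split; first by rewrite /ext_section s1 mulg1.
have f1 : f 1%g = 0.
  have := fM (gact1 t0) (gact1 t0); rewrite mulg1.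
  by rewrite -{1}(addr0 (f 1%g)) => /addrI.
case=> t e; rewrite /ext_section /=.
have E e' : cover_act ext_cocycle (t0, e') (s t) = (t, e').
  by rewrite /cover_act /= sE transfer_section // f1 addr0.
case: (F2P e) => ->; first by rewrite eqxx mul1g E.
rewrite oner_eq0 cover_actM.
by rewrite /(cover_act _ _ k) /= k0 transfer_t0 // fk add0r E.
Qed.
End Extension.

(** * Open normal subgroups and steps of index 2 *)

Section OpenNormal.
Variable G : topGroupType.

Record open_normal (K : set G) : Prop := OpenNormal {
  on_open : open K;
  on1 : K 1%g;
  onM : forall g h, K g -> K h -> K (g * h)%g;
  onV : forall g, K g -> K (g^-1)%g;
  onJ : forall g h, K g -> K (g ^ h)%g
}.

Definition index2 (K M : set G) : Prop :=
  [/\ M `<=` K, exists2 k, K k & ~ M k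
    & forall g h, K g -> K h -> ~ M g -> ~ M h -> M (g * h)%g].

Section Indicator.
Variable M : set G.
Hypothesis nM : open_normal M.

Lemma out_subproof : `[< continuousF2 (fun g => if `[< M g >] then 0 else 1 : 'F_2) >].
Proof.
apply/asboolP/continuousF2P => g.
have oL : open_nbhs (g^-1 * g)%g M.
  by split; [exact: on_open|rewrite mulVg; exact: on1].
have := @lmul_continuous G (g^-1)%g g _ (open_nbhs_nbhs oL).
rewrite nbhs_filterE /= => N; apply: filterS N => h /= Lh.
congr (if _ then _ else _); apply: asbool_equiv_eq; split=> [Lg|Lg].
  by move: (onM nM Lg (onV nM Lh)); rewrite invgM invgK mulVKg.
by move: (onM nM Lg Lh); rewrite mulVKg.
Qed.
Definition outside : contF2 G := ContF2 out_subproof.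

Lemma out_eq0 g : outside g = 0 <-> M g.
Proof.
by rewrite /outside /=; case: asboolP => // nLg; split=> // /eqP.
Qed.

Lemma out_eq1 g : outside g = 1 <-> ~ M g.
Proof.
rewrite -out_eq0; case: (F2P (outside g)) => ->; split=> //.
Qed.

Lemma outJ g h : outside (g ^ h)%g = outside g.
Proof.
have [/out_eq0 Lg|/out_eq1 nLg] := F2P (outside g).
  by rewrite (out_eq0 g).2 //; apply/out_eq0; exact: onJ.
rewrite (out_eq1 g).2 //; apply/out_eq1 => Lgh; apply: nLg.
by rewrite -(conjgK h g); exact: onJ.
Qed.

Lemma outM K g h : index2 K M -> K g -> K h -> outside (g * h)%g = outside g + outside h.
Proof.
move=> [LK _ KM] Kg Kh.
have [/[dup] Eg /out_eq0 Lg|/[dup] Eg /out_eq1 Lg] := F2P (outside g);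
have [/[dup] Eh /out_eq0 Lh|/[dup] Eh /out_eq1 Lh] := F2P (outside h); rewrite Eg Eh.
- by rewrite addr0; apply/out_eq0; exact: onM.
- rewrite add0r; apply/out_eq1 => Lgh; apply: Lh.
  by rewrite -(mulKg g h); apply: onM => //; exact: onV.
- rewrite addr0; apply/out_eq1 => Lgh; apply: Lg.
  by rewrite -(mulgK h g); apply: onM => //; exact: onV.
- by rewrite F2_addxx; apply/out_eq0; exact: KM.
Qed.
End Indicator.
End OpenNormal.

(** * The subgroups K u yK and their double covers *)

Section Dihedral.
Variables (G : topGroupType) (x : gH (gpoint G) 1).

(** The stabiliser of [t0] is P = K u yK. The section lies in the kernel of x, so Schreier elements
    do not change x ([chi_transfer]). *)
Definition dihedral_state (T : gset G) (t0 : T) (s : T -> G) (y : G) (K : set G) :=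
  [/\ pointed t0 s, forall t, chi x (s t) = 0
    & forall g, gact t0 g = t0 <-> K g \/ K (y^-1 * g)%g].

Section Step.
Variables (y : G) (K M : set G).
Hypotheses (nK : open_normal K) (nM : open_normal M) (KM : index2 K M).
Hypotheses (Kx : forall g, K g -> chi x g = 0) (xy : chi x y = 1) (Kyy : K (y * y)%g).

Let xV g : chi x (y^-1 * g)%g = 1 + chi x g.
Proof. by rewrite chiM chiV xy. Qed.

Lemma in_coset g : K g \/ K (y^-1 * g)%g ->
  (chi x g = 0 /\ K g) \/ (chi x g = 1 /\ K (y^-1 * g)%g).
Proof.
case=> Kg; first by left; split; [exact: Kx|].
right; split=> //; have := Kx Kg; rewrite xV => e.
by apply: esym; exact: F2_addr_eq0.
Qed.

(* [y ^ a * u |-> outside M u] for [a] in {0, 1} and [u] in [K]. *)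
Definition kappa : contF2 G :=
  (1 + chi x) * outside nM +
  chi x * contF2_comp (@lmul_continuous G (y^-1)%g) (outside nM).

Lemma kappaE g : kappa g = (1 + chi x g) * outside nM g + chi x g * outside nM (y^-1 * g)%g.
Proof. by []. Qed.

Lemma kappa0 g : chi x g = 0 -> kappa g = outside nM g.
Proof. by rewrite kappaE => ->; rewrite mul0r !addr0 mul1r. Qed.

Lemma kappa1 g : chi x g = 1 -> kappa g = outside nM (y^-1 * g)%g.
Proof. by rewrite kappaE => ->; rewrite F2_addxx mul0r add0r mul1r. Qed.

(** The defect of additivity is x(g) x(h) times the class of y y in K/M. If y y lies in M, [kappa]
    is a character of P; otherwise it bounds x x. *)
Lemma kappaM g h : K g \/ K (y^-1 * g)%g -> K h \/ K (y^-1 * h)%g ->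
  kappa (g * h)%g = kappa g + kappa h + chi x g * chi x h * outside nM (y * y)%g.
Proof.
move=> /in_coset[[xg Kg]|[xg Kg]] /in_coset[[xh Kh]|[xh Kh]].
- rewrite !kappa0 ?chiM ?xg ?xh ?addr0 // !mul0r addr0.
  exact: outM KM _ _.
- rewrite (kappa0 xg) (kappa1 xh) kappa1 ?chiM ?xg ?xh ?add0r // !mul0r addr0.
  have -> : (y^-1 * (g * h))%g = (g ^ y * (y^-1 * h))%g.
    by rewrite conjgE -!mulgA mulVKg.
  by rewrite (outM nM KM) ?outJ //; exact: onJ.
- rewrite (kappa1 xg) (kappa0 xh) kappa1 ?chiM ?xg ?xh ?addr0 // mulr0 mul0r addr0.
  by rewrite mulgA; exact: outM KM _ _.
- rewrite (kappa1 xg) (kappa1 xh) kappa0 ?chiM ?xg ?xh ?F2_addxx // !mul1r.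
  (* With g = y u and h = y v this is y u y v = (y y) u^y v. *)
  have -> : (g * h)%g = ((y * y) * ((y^-1 * g) ^ y * (y^-1 * h)))%g.
    by rewrite conjgE -!mulgA !mulVKg.
  have KJ : K ((y^-1 * g) ^ y)%g by exact: onJ.
  rewrite (outM nM KM Kyy); last exact: onM.
  by rewrite (outM nM KM KJ Kh) outJ addrC.
Qed.

Variables (T : gset G) (t0 : T) (s : T -> G).
Hypothesis st : dihedral_state t0 s y K.
Let t0s : pointed t0 s. Proof. by case: st. Qed.

Lemma chi_transfer t g : chi x (transfer s t g) = chi x g.
Proof. by case: st => _ xs _; rewrite /transfer !chiM chiV !xs add0r addr0. Qed.

(** The common part of the two steps below. As [k] lies in K, where x vanishes, the new section
    stays in the kernel of x. *)
Lemma ext_state (f : contF2 G)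
    (fM : forall g h, gact t0 g = t0 -> gact t0 h = t0 -> f (g * h)%g = f g + f h)
    (y' k : G) :
  K k -> f k = 1 ->
  (forall g, (gact t0 g = t0 /\ f g = 0) <-> M g \/ M (y'^-1 * g)%g) ->
  exists s', dihedral_state ((t0, 0) : double_cover (ext_cocycle t0s fM)) s' y' M.
Proof.
move=> Kk fk stab'; have [_ xs stab] := st.
have k0 : gact t0 k = t0 by apply/stab; left.
exists (ext_section k); split; first exact: ext_pointed.
  move=> [t e]; rewrite /ext_section chiM xs addr0 /=.
  by case: eqP => _; [exact: chi1|exact: Kx].
by move=> g; rewrite ext_stab; exact: stab'.
Qed.

Lemma kappa_hom (Lyy : M (y * y)%g) g h : gact t0 g = t0 -> gact t0 h = t0 ->
  kappa (g * h)%g = kappa g + kappa h.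
Proof.
have [_ _ stab] := st; move=> /stab Pg /stab Ph.
by rewrite kappaM // (out_eq0 nM _).2 // mulr0 addr0.
Qed.

Lemma kappa_hom_twisted (Lyy : M (y * y)%g) g h : gact t0 g = t0 -> gact t0 h = t0 ->
  (kappa + chi x) (g * h)%g = (kappa + chi x) g + (kappa + chi x) h.
Proof.
move=> g0 h0; rewrite !(contF2_addE kappa) kappa_hom // chiM addrACA //.
Qed.

Lemma state_step (Lyy : M (y * y)%g) : exists s',
  dihedral_state ((t0, 0) : double_cover (ext_cocycle t0s (kappa_hom Lyy))) s' y M.
Proof.
have [LK [k Kk nLk] _] := KM; have [_ _ stab] := st.
apply: (ext_state _ Kk); first by rewrite kappa0 ?Kx //; apply/out_eq1.
move=> g; split=> [[/stab/in_coset[[xg Kg]|[xg Kg]]]|[Lg|Lg]].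
- by rewrite kappa0 // => /out_eq0; left.
- by rewrite kappa1 // => /out_eq0; right.
- split; first by apply/stab; left; exact: LK.
  by rewrite kappa0 ?Kx //; [apply/out_eq0|exact: LK].
- have Kg := LK _ Lg; split; first by apply/stab; right.
  have [[xg _]|[xg _]] := in_coset (or_intror Kg); last by rewrite kappa1 //; apply/out_eq0.
  by have := Kx Kg; rewrite xV xg.
Qed.

(** On yK the character x is 1, so [kappa + chi x] vanishes there on ykM instead of yM. This is the
    other subgroup of index 2 in P that meets K in M. *)
Lemma state_step_twisted (Lyy : M (y * y)%g) k : K k -> ~ M k ->
  exists s', dihedral_state
    ((t0, 0) : double_cover (ext_cocycle t0s (kappa_hom_twisted Lyy))) s' (y * k)%g M.
Proof.
move=> Kk nLk; have [LK _ _] := KM; have [_ _ stab] := st.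
have ok : outside nM k = 1 by apply/out_eq1.
have okV : outside nM (k^-1)%g = 1.
  by apply/out_eq1 => Lk; apply: nLk; rewrite -(invgK k); exact: onV.
have KkV : K (k^-1)%g by exact: onV.
apply: (ext_state _ Kk).
  by rewrite (contF2_addE kappa) kappa0 ?Kx // addr0.
move=> g; rewrite (contF2_addE kappa) invgM -mulgA.
split=> [[/stab/in_coset[[xg Kg]|[xg Kg]]]|[Lg|Lg]].
- by rewrite kappa0 // xg addr0 => /out_eq0; left.
- rewrite kappa1 // xg => e; right; apply/(out_eq0 nM).
  by rewrite (outM nM KM) // okV addrC.
- split; first by apply/stab; left; exact: LK.
  by rewrite kappa0 ?Kx ?addr0 //; [apply/out_eq0|exact: LK..].
- have Kg : K (y^-1 * g)%g.
    by rewrite -(mulVKg k (y^-1 * g)%g); apply: onM => //; exact: LK.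
  split; first by apply/stab; right.
  have [[xg _]|[xg _]] := in_coset (or_intror Kg).
    by have := Kx Kg; rewrite xV xg.
  rewrite kappa1 // xg; have /(out_eq0 nM) := Lg.
  by rewrite (outM nM KM) // okV addrC.
Qed.

Lemma twisted_cls (Lyy : M (y * y)%g) :
  cls (ext_cocycle t0s (kappa_hom_twisted Lyy)) =
  cls (ext_cocycle t0s (kappa_hom Lyy)) + from_point T x.
Proof.
have [X [-> XE]] := from_point_cls T x.
have -> : cls (ext_cocycle t0s (kappa_hom Lyy)) + cls X =
          cls (ext_cocycle t0s (kappa_hom Lyy) + X) by rewrite raddfD.
congr cls; apply: val_inj; apply: gcochain_eq => t p.
have -> : p = fun=> p ord0 by apply: funext => i; rewrite (ord1 i).
rewrite gaddE XE -(chi_transfer t (p ord0)); exact: (contF2_addE kappa).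
Qed.

(* Here (K u yK) / M is cyclic of order 4. *)
Lemma kappa_cyclic (nLyy : ~ M (y * y)%g) :
  cup1 (from_point T x) (from_point T x) = 0.
Proof.
have [X [-> XE]] := from_point_cls T x.
rewrite cup1_cls; apply/cls_eq0; exists (induced s kappa).
apply: gcochain_eq => t p; rewrite (pair_tupleE p) induced_delta //.
have [_ _ stab] := st.
rewrite kappaM; [|by apply/stab; exact: transfer_stab..].
rewrite !chi_transfer (out_eq1 nM _).2 // mulr1 gmul1E !XE.
have E (a b c : 'F_2) : c = b + (a + b + c + a).
  have -> : b + (a + b + c + a) = c + (a + a) + (b + b) by ring.
  by rewrite !F2_addxx !addr0.
exact: E.
Qed.
End Step.
End Dihedral.

(** * Chains of open normal subgroups *)

Section FiniteQuotient.
Import fingroup perm pgroup sylow.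
Variables (G : topGroupType) (N : set G) (nN : open_normal N).
Hypothesis pro2 : is_pro2 G.

Lemma open_normal_closed : group_closed (mem N).
Proof.
split=> [|g h /set_mem Ng /set_mem Nh]; apply: mem_set; first exact: on1.
by apply: onM => //; exact: onV.
Qed.

Lemma finite_quotient_index : exists (n : nat) (i : G -> 'I_(2 ^ n)),
  (forall g h, i g = i h <-> N (g^-1 * h)%g) /\ (forall k, exists g, i g = k).
Proof.
have [_ _ _ /(_ (Subgroup open_normal_closed) (on_open nN))] := pro2.
case=> [g u /set_mem Nu|n /card_set_bijP[f [fI finj fsurj]]].
  by apply: mem_set; exact: onJ.
pose c (g : G) : set G := [set (g * u)%g | u in N].
have cL g : left_cosets (Subgroup open_normal_closed) (c g).
  by exists g.
exists n, (fun g => Ordinal (fI _ (cL g))); split.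
  move=> g h; split=> [[]|Ngh].
    move=> /(finj _ _ (mem_set (cL g)) (mem_set (cL h))) e.
    have : c h h by exists 1%g; [exact: on1|rewrite mulg1].
    by rewrite -e => -[u Nu <-]; rewrite mulKg.
  apply: val_inj => /=; congr f; apply/seteqP; split=> _ [u Nu <-].
    exists ((g^-1 * h)^-1 * u)%g; first by apply: onM => //; exact: onV.
    by rewrite invgM invgK !mulgA mulgV mul1g.
  exists (g^-1 * h * u)%g; first exact: onM.
  by rewrite !mulgA mulgV mul1g.
move=> [k lk]; have [_ [g _ <-] fk] := fsurj _ lk.
by exists g; apply: val_inj.
Qed.

(* r is the regular representation of G/N. *)
Lemma finite_quotient : exists (n : nat) (r : G -> {perm 'I_(2 ^ n)}),
  [/\ forall g h, r (g * h)%g = (r g * r h)%g,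
      forall g h, r g = r h <-> N (g^-1 * h)%g
    & #|[set q | `[< exists g, r g = q >]]%SET| = (2 ^ n)%N].
Proof.
have [n [i [iE isurj]]] := finite_quotient_index.
exists n; have /choice[s sK] := isurj.
have iM g h k : i g = i h -> i (g * k)%g = i (h * k)%g.
  move=> /iE Ngh; apply/iE.
  have -> : ((g * k)^-1 * (h * k) = (g^-1 * h) ^ k)%g by rewrite conjgE invgM !mulgA.
  exact: onJ.
have rinj g : injective (fun k => i (s k * g)%g).
  move=> j k /(iM _ _ (g^-1)%g); rewrite !mulgK.
  by rewrite !sK.
pose r g := perm (rinj g).
have rE g k : r g k = i (s k * g)%g by rewrite permE.
have riE g h : i (s (i h) * g)%g = i (h * g)%g by apply: iM; rewrite sK.
exists r; split.
- move=> g h; apply/permP => k; rewrite permM !rE riE.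
  by rewrite mulgA.
- move=> g h; split=> [e|Ngh].
    have := rE g (i 1%g); rewrite e rE !riE !mul1g => /esym /iE //.
  apply/permP => k; rewrite !rE; apply/iE.
  by rewrite invgM -mulgA mulKg.
- rewrite -[RHS]card_ord -cardsT.
  rewrite -(card_in_imset (f := fun q : {perm 'I_(2 ^ n)} => q (i 1%g))).
    congr #|pred_of_set _|; apply/setP => k; rewrite finset.in_setT; apply/imsetP.
    have [g e] := isurj k; exists (r g); last by rewrite rE riE mul1g.
    by rewrite finset.in_set; apply/asboolP; exists g.
  move=> p q; rewrite !finset.in_set => /asboolP[g <-] /asboolP[h <-].
  rewrite !rE !riE !mul1g => /iE Ngh.
  apply/permP => k; rewrite !rE; apply/iE.
  by rewrite invgM -mulgA mulKg.
Qed.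

(** K/N is normal in the finite 2-group G/N, so a chain of normal subgroups of G with successive
    indices 2 leads from K down to N, and [Pr] is carried along it. *)
Lemma normal_chain (Pr : set G -> Prop) (K : set G) :
  open_normal K -> N `<=` K -> Pr K ->
  (forall K M, open_normal K -> open_normal M -> N `<=` M -> index2 K M ->
     Pr K -> Pr M) ->
  Pr N.
Proof.
have [n [r [rM rE cardQ]]] := finite_quotient => nK NK PK step.
set Q0 := [set q | _]%SET in cardQ.
pose im (K : set G) : {set {perm 'I_(2 ^ n)}} :=
  [set q | `[< exists2 g, K g & r g = q >]]%SET.
have r1 : r 1%g = 1%g.
  by apply: (mulgI (r 1%g)); rewrite -rM !mulg1.
have rV g : r (g^-1)%g = (r g)^-1%g.
  by apply: (mulgI (r g)); rewrite -rM !mulgV.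
have imG (H : set G) : H 1%g -> (forall g h, H g -> H h -> H (g * h)%g) ->
    group_set (im H).
  move=> H1 HM; apply/group_setP; split.
    by rewrite finset.in_set; apply/asboolP; exists 1%g.
  move=> p q; rewrite !finset.in_set => /asboolP[g Hg <-] /asboolP[h Hh <-].
  by apply/asboolP; exists (g * h)%g; [exact: HM|].
have gT : group_set (im setT) by apply: imG.
pose Q := Group gT.
have Q2 : (2.-group Q)%g.
  rewrite /pgroup; suff -> : #|Q| = (2 ^ n)%N by rewrite pnatX pnat_id.
  apply: (etrans _ cardQ); congr #|pred_of_set _|; apply/setP => q; rewrite !finset.in_set.
  by apply: asbool_equiv_eq; split=> -[g]; exists g.
have imE (H : set G) g : open_normal H -> N `<=` H -> (r g \in im H) = `[< H g >].
  move=> nH NH; rewrite finset.in_set; apply: asbool_equiv_eq; split=> [[h Hh /rE /NH]|Hg].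
    by move=> /(onM nH Hh); rewrite mulVKg.
  by exists g.
have rQ g : r g \in Q by rewrite finset.in_set; apply/asboolP; exists g.
(* Induction on the order of K/N. *)
have [m] := ubnP #|im K|; elim: m K nK NK PK => // m IH K nK NK PK /ltnSE ltm.
pose R := Group (imG _ (on1 nK) (onM nK)).
have RQ : (R <| Q)%g.
  rewrite /normal; apply/andP; split.
    by apply/fintype.subsetP => q; rewrite !finset.in_set => /asboolP[g _ <-]; apply/asboolP; exists g.
  apply/fintype.subsetP => q; rewrite finset.in_set => /asboolP[h _ <-]; rewrite inE.
  apply/fintype.subsetP => _ /imsetP[q' + ->]; rewrite /= finset.in_set => /asboolP[g Kg <-].
  rewrite conjgE -rV -!rM imE //; apply/asboolP.
  by have := onJ nK h Kg; rewrite conjgE.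
have [c Rc] := p_natP (pgroupS (normal_sub RQ) Q2).
case: c Rc => [|c] Rc.
  have KN : K `<=` N.
    move=> g Kg; have : r g \in R by rewrite /= imE //; exact/asboolP.
    have /card1_trivg -> : #|R| = 1%N by [].
    by move=> /set1P; rewrite -r1 => /esym /rE; rewrite invg1 mul1g.
  by have -> : N = K by apply/seteqP.
(* A nontrivial normal subgroup of a 2-group has a subgroup of index 2 that is normal in the whole
   group. *)
have [|R' [R'R R'Q R'c]] := normal_pgroup (r := c) Q2 RQ.
  by rewrite Rc pfactorK.
pose M : set G := [set g | r g \in R'].
have NM : N `<=` M.
  move=> g Ng; rewrite /M /=; suff -> : r g = 1%g by exact: group1.
  by rewrite -r1; apply/rE; rewrite mulg1; exact: onV.
have MM g h : M g -> M h -> M (g * h)%g by rewrite /M /= rM; exact: groupM.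
have nM : open_normal M.
  split.
  - rewrite openE => g Mg; rewrite /interior.
    have oN : open_nbhs (g^-1 * g)%g N.
      by split; [exact: on_open|rewrite mulVg; exact: on1].
    have := @lmul_continuous G (g^-1)%g g _ (open_nbhs_nbhs oN).
    rewrite nbhs_filterE /= => W; apply: filterS W => h /= /NM Mh.
    by have := MM _ _ Mg Mh; rewrite mulVKg.
  - by rewrite /M /= r1; exact: group1.
  - exact: MM.
  - by move=> g; rewrite /M /= rV groupV.
  - move=> g h; rewrite /M /= conjgE !rM rV -conjgE => Mg.
    by rewrite memJ_norm //; exact: (fintype.subsetP (normal_norm R'Q)).
have MK : M `<=` K.
  by move=> g /(fintype.subsetP R'R); rewrite /= imE // => /asboolP.
have cR : #|R| = (2 * #|R'|)%N by rewrite Rc R'c expnS.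
have KM : index2 K M.
  split=> //.
    have /subsetPn[q] : ~~ (R \subset R').
      apply/negP => /subset_leq_card; rewrite cR -{2}(mul1n #|R'|).
      by rewrite leq_pmul2r ?cardG_gt0.
    by rewrite finset.in_set => /asboolP[g Kg <-] /negP; exists g.
  move=> g h Kg Kh nMg nMh.
  have rR k : K k -> r k \in R by move=> Kk; rewrite /= imE //; exact/asboolP.
  (* R is the disjoint union of R' and the coset of (r g)^-1; as [r h] is not in R', it lies in that
     coset, so g h is in M. *)
  have D : R' :&: ((r g)^-1 *: R')%g = finset.set0.
    apply/setP => q; rewrite !inE; apply/negP => /andP[q1].
    rewrite mem_lcoset invgK => q2; apply: nMg; rewrite /M /=.
    by rewrite -(groupMr _ q1).
  have E : R' :|: ((r g)^-1 *: R')%g = R.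
    apply/eqP; rewrite eqEcard; apply/andP; split.
      rewrite finset.subUset R'R /=; apply/fintype.subsetP => q; rewrite mem_lcoset invgK => q2.
      by rewrite -(groupMl _ (rR _ Kg)); exact: (fintype.subsetP R'R).
    by rewrite cardsU D cards0 subn0 card_lcoset addnn -mul2n cR.
  have : r h \in R by exact: rR.
  rewrite -E inE => /orP[/nMh//|]; rewrite mem_lcoset invgK -rM.
  by [].
apply: (IH M) => //; first exact: step KM PK.
apply: leq_trans ltm; rewrite [X in (_ < X)%N](_ : _ = #|R|) // cR.
have -> : im M = R'.
  apply/setP => q; rewrite finset.in_set; apply/asboolP/idP => [[g Mg <-]//|qR'].
  have := fintype.subsetP R'R _ qR'; rewrite /= finset.in_set => /asboolP[g _ e].
  by exists g => //; rewrite /M /= e.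
by rewrite mul2n -addnn -{1}(addn0 #|R'|) ltn_add2l cardG_gt0.
Qed.
End FiniteQuotient.

(** * Compactness arguments *)

Section Compactness.

(** The finite intersection property for a family directed downwards: a cluster point of the filter
    it generates lies in every member. *)
Lemma directed_compact (X : topologicalType) (I : Type) (K : set X)
    (F : I -> set X) (i0 : I) :
  compact K -> (forall i, closed (F i)) ->
  (forall i, K `&` F i !=set0) ->
  (forall i j, exists k, F k `<=` F i `&` F j) ->
  exists2 p, K p & forall i, F i p.
Proof.
move=> cK cF neF dF.
have fF : Filter (filter_from setT (fun i => K `&` F i)).
  apply: filter_from_filter; first by exists i0.
  move=> i j _ _; have [k Fk] := dF i j; exists k => // p [Kp /Fk[Fi Fj]].
  by split; split.
have pF : ProperFilter (filter_from setT (fun i => K `&` F i)).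
  by apply: filter_from_proper => i _; exact: neF.
have [|p [Kp cp]] := cK _ pF; first by exists i0 => // p [].
exists p => // i; apply: cF => B nB.
have [|q [[_ Fq] Bq]] := cp (K `&` F i) B _ nB; last by exists q.
by exists i.
Qed.

Lemma contF2_closed (X : topologicalType) (f : contF2 X) (a : 'F_2) :
  closed [set p | f p = a].
Proof.
have /asboolP/continuousF2P fc := contF2P f.
by move=> p /(_ _ (fc p)) [q [/= <- ->]].
Qed.

Lemma contF2_open (X : topologicalType) (f : contF2 X) (a : 'F_2) :
  open [set p | f p = a].
Proof.
have /asboolP/continuousF2P fc := contF2P f.
rewrite openE => p /= fp; apply: filterS (fc p) => q /= ->; exact: fp.
Qed.

Lemma clopen_contF2 (X : topologicalType) (C : set X) : clopen C ->
  exists f : contF2 X, forall p, f p = 1 <-> C p.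
Proof.
move=> [oC cC].
have fc : `[< continuousF2 (fun p => if `[< C p >] then 1 else 0 : 'F_2) >].
  apply/asboolP/continuousF2P => p; case: asboolP => Cp.
    by apply: filterS (open_nbhs_nbhs (conj oC Cp)) => q Cq; rewrite asboolT.
  have oD : open (~` C) by rewrite openC.
  by apply: filterS (open_nbhs_nbhs (conj oD Cp)) => q Cq; rewrite asboolF.
exists (ContF2 fc) => p /=; case: asboolP => // Cp; split=> // /eqP.
Qed.

(* The intersection of the clopen neighbourhoods of p is connected. *)
Lemma totally_disconnected_clopen (X : topologicalType) (p q : X) :
  compact [set: X] -> hausdorff_space X -> totally_disconnected [set: X] ->
  p <> q -> exists C : set X, [/\ clopen C, C p & ~ C q].
Proof.
move=> cX hX tX pq; apply: contrapT => noC.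
pose J := {C : set X | clopen C /\ C p}.
pose Q : set X := [set r | forall C : J, sval C r].
have Qp : Q p by move=> [C [clC Cp]].
have Qq : Q q.
  by move=> [C [clC Cp]] /=; apply: contrapT => Cq; apply: noC; exists C.
have QC : closed Q.
  have -> : Q = \bigcap_(C in [set: J]) sval C.
    by apply/seteqP; split=> r h C; [move=> _; exact: h|exact: h].
  by apply: closed_bigI => -[C [[oC cC] Cp]] _.
suff cQ : connected Q.
  have := tX p I; have /(_ _ Qq) := connected_component_max Qp (@subsetT _ _) cQ.
  by move=> + e; rewrite e => /esym.
move=> B Bne [O oO BO] [C cC BC].
have cB : closed B by rewrite BC; exact: closedI.
have nB : set_nbhs B (~` (Q `&` ~` O)).
  apply/set_nbhsP; exists (~` (Q `&` ~` O)); split=> //.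
    by rewrite openC; apply: closedI => //; rewrite closedC.
  by move=> r; rewrite BO => -[Qr Or] [].
(* Normality gives disjoint open sets, U around [B] and V around the rest of [Q]. *)
have [W nW Wsub] := @compact_normal X hX cX B cB _ nB.
have [U [oU BU UW]] := (set_nbhsP _ _).1 nW.
pose V := ~` closure W.
have oV : open V by rewrite openC; exact: closed_closure.
have UV r : U r -> ~ V r by move=> /UW Wr; apply; exact: subset_closure.
have QUV r : Q r -> U r \/ V r.
  move=> Qr; have [Or|nOr] := pselect (O r); first by left; apply: BU; rewrite BO.
  by right => /Wsub; apply.
(* By compactness some clopen neighbourhood [E] of [p] lies in the union of U and V. It is cut into
   two clopen pieces, and the piece containing [p] contains all of [Q]. *)
have [E [[oE cE] Ep] EUV] : exists2 E : set X, clopen E /\ E p & E `<=` U `|` V.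
  apply: contrapT => nE.
  have [||||r nr Qr] := @directed_compact X J (~` (U `|` V)) (fun C => sval C)
      (exist _ setT (conj clopenT I)).
  - apply: (subclosed_compact _ cX) => //.
    by rewrite closedC; exact: openU.
  - by move=> [D [[oD cD] Dp]].
  - move=> [D [clD Dp]] /=; apply: contrapT => h; apply: nE; exists D => // r Dr.
    by apply: contrapT => nr; apply: h; exists r.
  - move=> [D [clD Dp]] [D' [clD' Dp']].
    exists (exist _ (D `&` D') (conj (clopenI clD clD') (conj Dp Dp'))) => //.
  by apply: nr; case: (QUV r Qr); [left|right].
have clEU : clopen (E `&` U).
  split; first exact: openI.
  have -> : E `&` U = E `&` ~` V.
    apply/seteqP; split=> r [Er Ur]; split=> //; first exact: UV.
    by case: (EUV r Er).
  by apply: closedI => //; rewrite closedC.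
have clEV : clopen (E `&` V).
  split; first exact: openI.
  have -> : E `&` V = E `&` ~` U.
    apply/seteqP; split=> r [Er Vr]; split=> //; first by move=> /UV.
    by case: (EUV r Er).
  by apply: closedI => //; rewrite closedC.
case: (EUV p Ep) => [Up|Vp].
  have QU r : Q r -> U r.
    by move=> /(_ (exist _ (E `&` U) (conj clEU (conj Ep Up)))) [].
  apply/seteqP; split=> [r|r Qr]; first by rewrite BO => -[].
  rewrite BO; split=> //; apply: contrapT => nOr.
  by have := Wsub r (subset_closure (UW _ (QU _ Qr))); apply.
have [r Br] := Bne; have Qr : Q r by move: Br; rewrite BO => -[].
have [_ /=] := Qr (exist _ (E `&` V) (conj clEV (conj Ep Vp))).
by move=> /(UV _ (BU _ Br)).
Qed.
End Compactness.

(** * Open normal subgroups of a compact group *)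

Section OpenNormalBase.
Variable G : topGroupType.

Lemma open_normalT : open_normal [set: G].
Proof. by split=> //; exact: openT. Qed.

Lemma open_normalI (K M : set G) : open_normal K -> open_normal M ->
  open_normal (K `&` M).
Proof.
move=> nK nM; split.
- by apply: openI; exact: on_open.
- by split; exact: on1.
- by move=> g h [? ?] [? ?]; split; exact: onM.
- by move=> g [? ?]; split; exact: onV.
- by move=> g h [? ?]; split; exact: onJ.
Qed.

Lemma open_normal_chi (c : gH (gpoint G) 1) : open_normal [set g | chi c g = 0].
Proof.
split=> [|||g|g h].
- exact: contF2_open.
- exact: chi1.
- by move=> g h g0 h0; have := chiM c g h; rewrite g0 h0 addr0.
- by move=> g0; have := chiV c g; rewrite g0.
- by move=> g0; have := chiJ c g h; rewrite g0.
Qed.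

Lemma open_normal_closed_set (K : set G) : open_normal K -> closed K.
Proof.
move=> nK; have -> : K = [set g | outside nK g = 0].
  apply/seteqP; split=> g; first by move=> Kg; exact: (out_eq0 nK g).2.
  by move=> /(out_eq0 nK g).
exact: contF2_closed.
Qed.

Hypothesis cG : compact [set: G].

(** Inserting n anywhere leaves [f] unchanged: these n form the kernel of the action on the
    translates of [f]. Openness is the tube lemma for the compact space G x G. *)
Lemma translation_invariant_open (f : contF2 G) :
  open_normal [set n | forall g h, f (g * n * h)%g = f (g * h)%g].
Proof.
have /asboolP/continuousF2P fc := contF2P f.
split=> /=.
- rewrite openE => n /= fn.
  have cGG : compact [set: G * G].
    by rewrite -setXTT; exact: compact_setX.
  have := (compact_near_coveringP _).1 cGG G (nbhs n)
    (fun n' p => f (p.1 * n' * p.2)%g = f (p.1 * p.2)%g).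
  have H (p : G * G) : [set: G * G] p ->
      \forall p' \near p & n' \near nbhs n, f (p'.1 * n' * p'.2)%g = f (p'.1 * p'.2)%g.
    move=> _.
    have c1 : {for (p, n), continuous (fun q : (G * G) * G => (q.1.1 * q.2 * q.1.2)%g)}.
      have m3 : continuous (fun q : (G * G) * G => (q.1.1 * q.2)%g).
        move=> q; apply: (@continuous_comp _ _ _ (fun q : (G * G) * G => (q.1.1, q.2))
          (fun p : G * G => (p.1 * p.2)%g)); last exact: mulg_continuous.
        apply: cvg_pair; last exact: cvg_snd.
        by apply: (@continuous_comp _ _ _ fst fst); exact: cvg_fst.
      apply: (@continuous_comp _ _ _ (fun q : (G * G) * G => ((q.1.1 * q.2)%g, q.1.2))
        (fun p : G * G => (p.1 * p.2)%g)); last exact: mulg_continuous.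
      apply: cvg_pair; first exact: m3.
      by apply: (@continuous_comp _ _ _ fst snd); [exact: cvg_fst|exact: cvg_snd].
    have c2 : {for (p, n), continuous (fun q : (G * G) * G => (q.1.1 * q.1.2)%g)}.
      apply: (@continuous_comp _ _ _ fst (fun p : G * G => (p.1 * p.2)%g)).
        exact: cvg_fst.
      exact: mulg_continuous.
    have n1 := c1 _ (fc (p.1 * n * p.2)%g); have n2 := c2 _ (fc (p.1 * p.2)%g).
    rewrite /= in n1 n2; near=> q => /=.
    have -> : f (q.1.1 * q.2 * q.1.2)%g = f (p.1 * n * p.2)%g.
      by near: q; exact: n1.
    have -> : f (q.1.1 * q.1.2)%g = f (p.1 * p.2)%g by near: q; exact: n2.
    exact: fn.
  move=> /(_ _ H); apply: filterS => m /= h g k.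
  exact: (h (g, k) I).
- by move=> g h; rewrite mulg1.
- by move=> n m fn fm g h; rewrite mulgA fm fn.
- by move=> n fn g h; have := fn g (n^-1 * h)%g; rewrite !mulgA mulgK.
- move=> n k fn g h; rewrite conjgE !mulgA -(mulgA _ k h) fn.
  by rewrite !mulgA mulgVK.
Unshelve. all: by end_near.
Qed.
End OpenNormalBase.

(** * Existence and conjugacy of involutions *)

Section Involutions.
Variables (G : topGroupType) (x : gH (gpoint G) 1).
Hypotheses (pro2 : is_pro2 G) (x_periodic : periodic x)
  (x_square : forall a : gH (gpoint G) 1, cup1 a a = cup1 x a).

Let cG : compact [set: G]. Proof. by case: pro2. Qed.

Lemma open_normal_separates (v : G) : v <> 1%g ->
  exists2 N, open_normal N & ~ N v.
Proof.
move=> v1; have [_ hG tG _] := pro2.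
have [C [clC C1 Cv]] := totally_disconnected_clopen cG hG tG (nesym v1).
have [f fC] := clopen_contF2 clC.
exists [set n | forall g h, f (g * n * h)%g = f (g * h)%g].
  exact: translation_invariant_open.
move=> /= /(_ 1%g 1%g); rewrite mul1g !mulg1 => e.
by apply: Cv; apply/fC; rewrite e; apply/fC.
Qed.

Lemma pointed_point : pointed (tt : gpoint G) (fun=> 1%g).
Proof. by split=> // -[]. Qed.

(** By periodicity z z = x w for some w, so z(y)^2 = x(y) w(y) = 0. *)
Lemma square_vanish (T : gset G) (t : T) (y : G) (z : gH T 1) :
  tower T -> (y * y = 1)%g -> gact t y = t -> chi x y = 0 -> ev y t z = 0.
Proof.
move=> tT yy ty xy; have [sx _] := tower_periodic x_periodic tT.
have [w /(congr1 (@ev _ y _ t _))] := sx _ (cup1 z z).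
rewrite !ev_cup1 // ev_from_point // ev_point // xy mul0r.
by case: (F2P (ev y t z)) => ->.
Qed.

(** If x(y) = 0, all classes of degree 1 on towers vanish at the fixed points of y. So y never
    leaves the subgroups of a chain from G to N, and lies in every open normal subgroup. *)
Lemma involution_chi (y : G) : (y * y = 1)%g -> y <> 1%g -> chi x y = 1.
Proof.
move=> yy y1; case: (F2P (chi x y)) => // xy; exfalso.
have [N nN] := open_normal_separates y1; apply.
pose Pr (K : set G) := K y /\ exists (T : gset G) (t0 : T) (s : T -> G),
  [/\ tower T, pointed t0 s & forall g, gact t0 g = t0 <-> K g].
suff [] : Pr N by [].
apply: (normal_chain nN pro2 (K := setT)) => //.
- exact: open_normalT.
- split=> //; exists (gpoint G), tt, (fun=> 1%g); split=> //.
  + exact: tower_point.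
  + exact: pointed_point.
move=> K M nK nM _ KM [Ky [T [t0 [s [tT t0s stab]]]]].
have fM g h : gact t0 g = t0 -> gact t0 h = t0 ->
    outside nM (g * h)%g = outside nM g + outside nM h.
  by move=> /stab Kg /stab Kh; exact: outM KM Kg Kh.
have [MK [k Kk nMk] _] := KM.
have ty : gact t0 y = t0 by apply/stab.
split.
  have := square_vanish (cls (ext_cocycle t0s fM)) tT yy ty xy.
  by rewrite ev1_cls //= transfer_t0 // => /(out_eq0 nM).
exists (double_cover (ext_cocycle t0s fM)), (t0, 0), (ext_section k); split.
- exact: tower_cover.
- by apply: ext_pointed; [apply/stab|apply/out_eq1].
- move=> g; rewrite ext_stab; split=> [[_ /(out_eq0 nM)]//|Mg].
  by split; [apply/stab; exact: MK|apply/out_eq0].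
Qed.

Lemma initial_state (y : G) : chi x y = 1 ->
  dihedral_state x (tt : gpoint G) (fun=> 1%g) y [set g | chi x g = 0].
Proof.
move=> xy; split; [exact: pointed_point|by move=> _; exact: chi1|].
move=> g; split=> // _; have [xg|xg] := F2P (chi x g); [by left|right].
by have := chiM x (y^-1)%g g; rewrite chiV xy xg F2_addxx.
Qed.

Lemma approximate_involution (b : gH (gpoint G) 1) (N : set G) :
  open_normal N -> cup1 x b <> 0 -> exists2 y, chi b y = 1 & N (y * y)%g.
Proof.
move=> nN xb.
(* At the end of the chain b vanishes on N', hence on N' u yN' unless b(y) = 1. *)
pose N' := N `&` ([set g | chi x g = 0] `&` [set g | chi b g = 0]).
have nN' : open_normal N'.
  apply: open_normalI => //; apply: open_normalI; exact: open_normal_chi.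
pose Pr (K : set G) := (forall g, K g -> chi x g = 0) /\
  exists (T : gset G) (t0 : T) (s : T -> G) (y : G),
  [/\ tower T, dihedral_state x t0 s y K, chi x y = 1, K (y * y)%g
    & cup1 (from_point T x) (from_point T b) <> 0].
suff [_ [T [t0 [s [y [tT st xy [Nyy _] xbT]]]]]] : Pr N'.
  exists y => //; have [b0|//] := F2P (chi b y); exfalso; apply: xbT.
  suff -> : from_point T b = 0 by rewrite cup1_0r.
  have [z [-> zE]] := from_point_cls T b.
  have [t0s _ stab] := st.
  have bP g : gact t0 g = t0 -> chi b g = 0.
    move=> /stab[[_ [_ //]]|[_ [_]]].
    have := chiM b (y^-1)%g g; rewrite chiV.
    by move=> + e; rewrite [X in X = _]e b0 add0r => <-.
  (* As b vanishes on the stabiliser of [t0], the function t |-> b(s(t)) has coboundary b on T. *)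
  apply/cls_eq0; exists (fun t => cst_contF2 _ (chi b (s t))).
  apply: gcochain_eq => t p; rewrite gdeltaE big_ord1.
  have -> : p = fun=> p ord0 by apply: funext => i; rewrite (ord1 i).
  rewrite zE; have := bP _ (transfer_stab t (p ord0) t0s).
  rewrite /transfer !chiM chiV => e.
  have E (u v w : 'F_2) : u + v + w = 0 -> v = w + u.
    by move=> h; apply: F2_addr_eq0; rewrite (addrC w) addrA (addrC v).
  exact: E e.
have [y0 xy0] : exists y, chi x y = 1.
  apply: contrapT => h; apply: xb.
  suff -> : x = 0 by rewrite cup1_0l.
  apply: chi_inj => g; rewrite chi_zero.
  by have [//|xg] := F2P (chi x g); case: h; exists g.
apply: (normal_chain nN' pro2 (K := [set g | chi x g = 0])).
- exact: open_normal_chi.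
- by move=> g [_ []].
- split=> //; exists (gpoint G), tt, (fun=> 1%g), y0; split=> //.
  + exact: tower_point.
  + exact: initial_state.
  + by rewrite /mkset chiM xy0 F2_addxx.
  + by rewrite !from_point_id.
move=> K M nK nM NM KM [Kx [T [t0 [s [y [tT st xy Kyy xbT]]]]]].
have [MK [k Kk nMk] _] := KM.
split; first by move=> g /MK /Kx.
have pT := tower_periodic x_periodic tT.
have [Myy|nMyy] := pselect (M (y * y)%g); last first.
  (* In the cyclic case x x = 0, so x (x b) = 0 and x is cancelled in degree 2. *)
  exfalso; apply: xbT; have [_ ix] := pT; apply: ix.
  rewrite (cup1_sym (from_point T x) (from_point T b)) cup1_comm.
  by rewrite (kappa_cyclic nK nM KM Kx xy Kyy st nMyy) cup1_0r.
have [s1 st1] := state_step nK nM KM Kx xy Kyy st Myy.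
have [s2 st2] := state_step_twisted nK nM KM Kx xy Kyy st Myy Kk nMk.
have tc := twisted_cls nK nM KM Kx xy Kyy st Myy.
move: st1 st2 tc; set z1 := ext_cocycle _ _; set z2 := ext_cocycle _ _ => st1 st2 tc.
(* If x b survives on the first cover, y is kept; otherwise it survives on the second one and y is
   replaced by y k. *)
have [h1|h1] := pselect (cup1 (from_point (double_cover z1) x) (from_point (double_cover z1) b) = 0);
  last first.
  by exists (double_cover z1), (t0, 0), s1, y; split=> //; exact: tower_cover.
exists (double_cover z2), (t0, 0), s2, (y * k)%g; split=> //.
- exact: tower_cover.
- by rewrite chiM xy Kx // addr0.
- have -> : (y * k * (y * k) = (y * y) * (k ^ y * k))%g.
    by rewrite conjgE -!mulgA mulVKg.
  apply: onM => //; have [_ _ KMM] := KM; apply: KMM => //; first exact: onJ.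
  by move=> Mky; apply: nMk; rewrite -(conjgK y k); exact: onJ.
- move=> h2; apply: xbT.
  have [|c ec] := @res_cover_eq0 _ _ z1 _ (cup1 (from_point T x) (from_point T b)).
    by rewrite res_cover_cup1 !res_from_point.
  have [|d ed] := @res_cover_eq0 _ _ z2 _ (cup1 (from_point T x) (from_point T b)).
    by rewrite res_cover_cup1 !res_from_point.
  rewrite tc in ed.
  apply: vanishes_on_both_covers pT _ ec ed.
  by rewrite -!from_point_cup1 x_square.
Qed.

Lemma exists_involution (b : gH (gpoint G) 1) : cup1 x b <> 0 ->
  exists2 y, chi b y = 1 & (y * y = 1)%g.
Proof.
move=> xb.
pose J := {N : set G | open_normal N}.
pose F (N : J) := [set y | chi b y = 1] `&` [set y | sval N (y * y)%g].
have [|||y _ yF] := @directed_compact _ J setT F (exist _ setT (open_normalT G)) cG.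
- move=> [N nN]; apply: closedI; first exact: contF2_closed.
  have c2 : continuous (fun y : G => (y * y)%g).
    move=> y; apply: (@continuous_comp _ _ _ (fun y : G => (y, y)) (fun p : G * G => (p.1 * p.2)%g)).
      by apply: cvg_pair; exact: cvg_id.
    exact: mulg_continuous.
  have := preimage_closed (fun y _ => c2 y) (open_normal_closed_set nN).
  exact.
- move=> [N nN]; have [y by1 Nyy] := approximate_involution nN xb.
  by exists y.
- move=> [N nN] [N' nN']; exists (exist _ (N `&` N') (open_normalI nN nN')).
  by move=> y [by1 [Ny Ny']].
exists y; first by have [] := yF (exist _ setT (open_normalT G)).
apply: contrapT => yy; have [N nN] := open_normal_separates yy; apply.
by have [] := yF (exist _ N nN).
Qed.

Lemma conjugate_mod (y y' : G) (N : set G) : open_normal N ->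
  (y * y = 1)%g -> (y' * y' = 1)%g -> chi x y = 1 ->
  (forall c, chi c y = chi c y') -> exists g, N (y'^-1 * y ^ g)%g.
Proof.
move=> nN yy yy' xy eqc; have xy' : chi x y' = 1 by rewrite -eqc.
pose N' := N `&` [set g | chi x g = 0].
have nN' : open_normal N' by apply: open_normalI => //; exact: open_normal_chi.
pose Pr (K : set G) := (forall g, K g -> chi x g = 0) /\
  exists (T : gset G) (t0 : T) (s : T -> G),
  tower T /\ dihedral_state x t0 s y' K.
suff [N'x [T [t0 [s [tT [[s1 sE] _ stab]]]]]] : Pr N'.
  have [t ty] : exists t : T, gact t y = t.
    (* Without fixed points of y, every class is detected as zero, so b x = 0 on T for some b with
       b(y) = 1. At the fixed point [t0] of y' this gives b(y') x(y') = 0, although both factors are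
       1. *)
    apply: contrapT => nofix.
    have [|dT _] := tower_localisation x_periodic x_square yy _ tT.
      by rewrite ev_point.
    have [t ty|b [by1 bx]] := dT (from_point T x); first by case: nofix; exists t.
    have ty' : gact t0 y' = t0.
      by apply/stab; right; rewrite mulVg; exact: on1.
    have := congr1 (@ev _ y' _ t0 _) bx.
    rewrite ev_cup1 // !ev_from_point // !ev_point // xy' mulr1 ev0 // -eqc.
    by rewrite -(ev_point b yy) by1.
  have sty : gact t0 (y ^ (s t)^-1)%g = t0.
    rewrite conjgE invgK mulgA !gactM sE ty -{1}(sE t) -gactM mulgV; exact: gact1.
  (* The conjugate of y lies in N' u y'N', but not in N', as x(y) = 1. *)
  have [N'y|[Ny _]] := (stab _).1 sty; last by exists (s t)^-1%g.
  by have := N'x _ N'y; rewrite chiJ xy.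
apply: (normal_chain nN' pro2 (K := [set g | chi x g = 0])).
- exact: open_normal_chi.
- by move=> g [].
- split=> //; exists (gpoint G), tt, (fun=> 1%g); split.
  + exact: tower_point.
  + exact: initial_state.
move=> K M nK nM NM KM [Kx [T [t0 [s [tT st]]]]].
have [MK _ _] := KM.
split; first by move=> g /MK /Kx.
have Myy : M (y' * y')%g by rewrite yy'; exact: on1.
have [s1 st1] := state_step nK nM KM Kx xy' (MK _ Myy) st Myy.
move: st1; set e := ext_cocycle _ _ => st1.
exists (double_cover e), (t0, 0), s1; split=> //; exact: tower_cover.
Qed.
End Involutions.

(** * Groups of order two and comparison of the cochain complexes *)

Section OrderTwo.
Variables (C : topGroupType) (y : C) (f : contF2 C).
Hypotheses (yy : (y * y = 1)%g) (C2 : forall g : C, g = 1%g \/ g = y).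
Hypothesis f1y : f 1%g = 0 /\ f y = 1.

Lemma consx_continuous n (g : C) : continuous (@consx C n g).
Proof.
apply: ptws_continuous => j; rewrite /consx; case: (unlift ord0 j) => [i|] /=.
  exact: ptws_proj_continuous.
exact: cst_continuous.
Qed.

Lemma order_two_mul g h : f (g * h)%g = f g + f h.
Proof.
have [f1 fy] := f1y.
by case: (C2 g) (C2 h) => -> [] ->; rewrite ?mulg1 ?mul1g ?yy f1 ?fy ?F2_addxx ?addr0 ?add0r.
Qed.

Lemma order_two_cocycle_subproof :
  (fun=> contF2_comp (@ptws_proj_continuous _ C (ord0 : 'I_1)) f) \in
  @gcocycle_pred C (gpoint C) 1.
Proof.
apply/eqP; apply: gcochain_eq => t p; rewrite (pair_tupleE p) gdelta1E /=.
rewrite order_two_mul; set u := f _; set v := f _.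
have -> : u + (v + u + v) = (u + u) + (v + v) by ring.
by rewrite !F2_addxx.
Qed.
Definition order_two_cocycle := GCocycle order_two_cocycle_subproof.

(* This double cover is the regular C-set; prepending the element that moves the
   base point to t is a contracting homotopy. *)
Lemma regular_acyclic n (c : gH (double_cover order_two_cocycle) n.+1) : c = 0.
Proof.
have [f1 fy] := f1y.
pose T := double_cover order_two_cocycle; pose t0 : T := (tt, 0).
pose s (t : T) := if t.2 == 0 then 1%g else y.
have s0 t : gact t0 (s t) = t.
  case: t => -[] e; rewrite /= /cover_act /s /=.
  by case: (F2P e) => ->; rewrite ?eqxx ?oner_eq0 ?f1 ?fy ?addr0 ?add0r.
have sM t g : s (gact t g) = (s t * g)%g.
  case: t => -[] e; rewrite /s /= .
  case: (F2P e) (C2 g) => -> [] ->;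
    by rewrite ?f1 ?fy ?addr0 ?add0r ?F2_addxx ?eqxx ?oner_eq0 ?mulg1 ?mul1g ?yy.
have [z ->] := cls_surj c; apply/cls_eq0.
exists (fun t => contF2_comp (@consx_continuous n (s t)) ((z : gcochain T _) t0)).
apply: gcochain_eq => t x; rewrite gdeltaE /=.
have := congr1 (fun k : gcochain T _ => k t0 (consx (s t) x)) (gdelta_cocycle z).
rewrite gdeltaE consx0 tailx_consx s0 big_ord_recl contF2_0E => /F2_addr_eq0 ->.
have -> : x = consx (x ord0) (tailx x).
  apply: funext => j; case: (unliftP ord0 j) => [i ->|->].
    by rewrite consxS.
  by rewrite consx0.
rewrite face1_consx sM consx0 tailx_consx; congr (_ + _).
by apply: eq_bigr => k _; rewrite face_consxS.
Qed.

(** Since the regular cover is acyclic, the Gysin sequence makes every class of positive degree a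
    multiple of the generator; induction on the degree follows. *)
Lemma order_two_ev_inj n (c : gH (gpoint C) n) : ev y (tt : gpoint C) c = 0 -> c = 0.
Proof.
have [_ fy] := f1y.
elim: n c => [|n IH] c ec.
  have [z ez] := cls_surj c; rewrite ez -(raddf0 (@cls _ (gpoint C) 0)).
  congr cls; apply: val_inj; apply: gcochain_eq => -[] x.
  move: ec; rewrite ez ev_cls // /evc /=.
  by have -> : x = fun=> 1%g by apply: funext => -[].
have [d ed] := res_cover_eq0 (regular_acyclic (res_cover order_two_cocycle c)).
rewrite ed (IH d) ?cup1_0r //; move: ec; rewrite ed ev_cup1 // ev1_cls // /= fy.
by rewrite mul1r.
Qed.

Lemma order_two_ev_surj n : exists c : gH (gpoint C) n, ev y (tt : gpoint C) c = 1.
Proof.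
have [_ fy] := f1y.
elim: n => [|n [c ec]]; first by exists (gH_one _); rewrite ev_cls.
exists (cup1 (cls order_two_cocycle) c).
by rewrite ev_cup1 // ev1_cls // ec /= fy mul1r.
Qed.
End OrderTwo.

(** * The cohomology of G as that of the one-point G-set *)

Section Comparison.
Variable G : topGroupType.

Lemma gdelta_point n (f : cochain G n) t :
  gdelta ((fun=> f) : gcochain (gpoint G) n) t = coboundary_map f.
Proof.
apply: contF2_eq => x; by rewrite gdeltaE coboundary_mapE [in RHS]big_ord_recl.
Qed.

Lemma cocycle_point_subproof n (z : cocycle G n) :
  (fun=> z : cochain G n) \in @gcocycle_pred G (gpoint G) n.
Proof.
apply/eqP; apply: gcochain_eq => t x.
by rewrite gdelta_point coboundary_map_cocycle.
Qed.
Definition cocycle_point n (z : cocycle G n) : gcocycle (gpoint G) n :=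
  GCocycle (cocycle_point_subproof z).

Lemma is_gcoboundary_point n (f : cochain G n) :
  is_gcoboundary ((fun=> f) : gcochain (gpoint G) n) <-> is_coboundary f.
Proof.
case: n f => [|n] f /=.
  by split=> [/(congr1 (fun k : gcochain (gpoint G) 0 => k tt))|->].
split=> [[g /(congr1 (fun k : gcochain (gpoint G) _ => k tt)) e]|[g ->]].
  exists (g tt); rewrite e -(gdelta_point (g tt) (tt : gpoint G)).
  by congr (gdelta _ (tt : gpoint G)); apply: funext => -[].
by exists (fun=> g); apply: funext => t; rewrite gdelta_point.
Qed.

Definition to_point n (c : cohomology G n) : gH (gpoint G) n :=
  cls (cocycle_point (repr c)).

Lemma to_point_pi n (z : cocycle G n) :
  to_point (\pi_(cohomology G n)%qT z) = cls (cocycle_point z).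
Proof.
apply/cls_eqP; rewrite -[val _ - val _]/((fun=> _) : gcochain (gpoint G) n).
apply/(is_gcoboundary_point (val (repr (\pi_(cohomology G n)%qT z) - z))).
by apply/pi_cohomology_eqP; rewrite reprK.
Qed.

Lemma to_point_is_zmod_morphism n : zmod_morphism (@to_point n).
Proof.
elim/quotW=> z; elim/quotW=> w.
rewrite -raddfB !to_point_pi -raddfB; congr cls; exact: val_inj.
Qed.
HB.instance Definition _ n := GRing.isZmodMorphism.Build _ _
  (@to_point n) (@to_point_is_zmod_morphism n).

Lemma to_point_inj n : injective (@to_point n).
Proof.
elim/quotW=> z; elim/quotW=> w; rewrite !to_point_pi => /cls_eqP h.
apply/eqP/pi_cohomology_eqP; exact/(is_gcoboundary_point (val (z - w))).
Qed.

Lemma to_point_surj n (c : gH (gpoint G) n) : exists d, c = to_point d.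
Proof.
have [z ->] := cls_surj c.
have e : (z : gcochain (gpoint G) n) = fun=> (z : gcochain (gpoint G) n) tt.
  by apply: funext => -[].
have Z : (z : gcochain (gpoint G) n) tt \in @cocycle_pred G n.
  by apply/eqP; rewrite -(gdelta_point _ (tt : gpoint G)) -e gdelta_cocycle.
exists (\pi_(cohomology G n)%qT (Cocycle Z)); rewrite to_point_pi; congr cls.
by apply: val_inj.
Qed.

Lemma to_point_cup n (a : cohomology G 1) (c : cohomology G n) :
  to_point (cup a c : cohomology G n.+1) = cup1 (to_point a) (to_point c).
Proof.
elim/quotW: a => a; elim/quotW: c => c.
rewrite cup_pi !to_point_pi cup1_cls; congr cls; apply: val_inj.
apply: gcochain_eq => t x; rewrite gmul1E [LHS]cup_cocycleE.
have -> : @left_part G 1 n x = fun=> x ord0.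
  by apply: funext => i; rewrite (ord1 i); congr x; apply: val_inj.
have -> // : @right_part G 1 n x = tailx x.
by apply: funext => i; congr x; apply: val_inj.
Qed.
End Comparison.

(* x is the unit of the Boolean ring in degree 1. *)
Section QuasiBoolean.
Variable G : topGroupType.

Lemma quasi_boolean_periodic : cohomologically_quasi_boolean G ->
  exists x : gH (gpoint G) 1, periodic x /\ forall a : gH (gpoint G) 1, cup1 a a = cup1 x a.
Proof.
move=> [V [B [phi [phi_bij _ phiM]]]].
pose E := connected_sum (dual_alg V) (boolean_alg B).
have inj n : injective (phi n) := bij_inj (phi_bij n).
have surj n (e : E n) : exists c, phi n c = e.
  by have [psi _ psiK] := phi_bij n; exists (psi e).
have [x0 ex0] := surj 1%N ((0, 1) : V * boolean_module B).
have phiX n (d : cohomology G n.+1) :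
    phi n.+2 (cup x0 d) = (0, (phi n.+1 d).2) :> 'rV_0 * boolean_module B.
  have -> : phi n.+2 (cup x0 d) = csum_mul (phi 1%N x0) (phi n.+1 d).
    exact: (phiM 1%N n.+1 x0 d).
  rewrite ex0 /=; congr pair; last exact: mul1r.
(* The dual summand is zero from degree 2 on, so there [x0] acts as the unit of B. *)
have ext n (e : E n.+2) : e = (0, e.2) :> 'rV_0 * boolean_module B.
  by case: e => u v; rewrite (thinmx0 u).
exists (to_point x0); split; first split.
- move=> n c; have [c' ->] := to_point_surj c.
  have [d ed] := surj n.+1 ((0, (phi n.+2 c').2) : E n.+1).
  exists (to_point d); rewrite -to_point_cup; congr to_point; apply: inj.
  by rewrite phiX ed [LHS]ext.
- move=> n c; have [d ->] := to_point_surj c; rewrite -to_point_cup.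
  rewrite -(raddf0 (@to_point G n.+3)) => /to_point_inj.
  move=> /(congr1 (phi n.+3)); rewrite phiX raddf0 => -[d2].
  suff -> : d = 0 by rewrite raddf0.
  by apply: inj; rewrite raddf0 [LHS]ext d2.
- move=> a; have [a' ->] := to_point_surj a; rewrite -!to_point_cup.
  congr to_point; apply: (inj 2%N); rewrite phiX.
  have -> : phi 2%N (cup a' a') = csum_mul (phi 1%N a') (phi 1%N a').
    exact: (phiM 1%N 1%N a' a').
  rewrite /=; congr pair; exact: boolean_idem.
Qed.
End QuasiBoolean.

(** * The restriction map *)

Lemma F2_mul_eq1 (a b : 'F_2) : a * b = 1 -> a = 1 /\ b = 1.
Proof. by case: (F2P a) (F2P b) => -> [] ->; rewrite ?mul0r ?mulr0. Qed.

Lemma F2_join_eq0 (a b : 'F_2) : a + b + a * b = 0 -> a = 0 /\ b = 0.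
Proof.
by case: (F2P a) (F2P b) => -> [] ->;
  rewrite ?(mul0r, mulr0, mulr1, addr0, add0r, F2_addxx).
Qed.

Section Main.
Variables (G : topGroupType) (x : gH (gpoint G) 1).
Hypotheses (pro2 : is_pro2 G) (x_periodic : periodic x)
  (x_square : forall a : gH (gpoint G) 1, cup1 a a = cup1 x a).

Let cG : compact [set: G]. Proof. by case: pro2. Qed.
Let hG : hausdorff_space G. Proof. by case: pro2. Qed.

Lemma involution_mulgg (y : involution G) : (inv_val y * inv_val y = 1)%g.
Proof. by have [_] := set_mem (valP y). Qed.

Lemma involution_neq1 (y : involution G) : inv_val y <> 1%g.
Proof. by have [/eqP] := set_mem (valP y). Qed.

Lemma involution_chi1 (y : involution G) : chi x (inv_val y) = 1.
Proof.
exact: (involution_chi pro2 x_periodic (involution_mulgg y) (@involution_neq1 y)).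
Qed.

Lemma square_continuous : continuous (fun y : G => (y * y)%g).
Proof.
move=> y; apply: (@continuous_comp _ _ _ (fun y : G => (y, y)) (fun p : G * G => (p.1 * p.2)%g)).
  by apply: cvg_pair; exact: cvg_id.
exact: mulg_continuous.
Qed.

(** The elements conjugating y to y' modulo N form closed nonempty sets, directed in N; a common
    point conjugates y to y'. *)
Lemma involutions_conjugate (y y' : G) :
  (y * y = 1)%g -> (y' * y' = 1)%g -> chi x y = 1 ->
  (forall c, chi c y = chi c y') -> exists g, (y' = y ^ g)%g.
Proof.
move=> yy yy' xy eqc.
pose J := {N : set G | open_normal N}.
pose F (N : J) := [set g | sval N (y'^-1 * y ^ g)%g].
have cJ : continuous (fun g : G => (y ^ g)%g).
  move=> g; apply: (@continuous_comp _ _ _ (fun g : G => (g^-1%g, (y * g)%g))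
     (fun p : G * G => (p.1 * p.2)%g)); last exact: mulg_continuous.
  by apply: cvg_pair; [exact: invg_continuous|exact: lmul_continuous].
have cc : continuous (fun g : G => (y'^-1 * y ^ g)%g).
  move=> g; apply: (@continuous_comp _ _ _ (fun g : G => (y ^ g)%g)
    (fun g => (y'^-1 * g)%g)); first exact: cJ.
  exact: lmul_continuous.
have [|||g _ gF] := @directed_compact _ J setT F (exist _ setT (open_normalT G)) cG.
- move=> [N nN]; exact: (preimage_closed (fun g _ => cc g) (open_normal_closed_set nN)).
- move=> [N nN]; have [g Ng] := conjugate_mod pro2 x_periodic x_square nN yy yy' xy eqc.
  by exists g.
- move=> [N nN] [N' nN']; exists (exist _ (N `&` N') (open_normalI nN nN')).
  by move=> g [Ng Ng'].
exists g; apply: contrapT => h.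
have [|N nN] := @open_normal_separates _ pro2 (y'^-1 * y ^ g)%g.
  by move=> e; apply: h; apply: (mulgI y'^-1%g); rewrite e mulVg.
by apply; exact: gF (exist _ N nN).
Qed.

Lemma conj_class_eq (y z : involution G) :
  (forall c, chi c (inv_val y) = chi c (inv_val z)) -> conj_class y = conj_class z.
Proof.
move=> e; apply/(@eqmodP _ (conjugate_equiv_rel G)); apply/asboolP.
apply: involutions_conjugate => //; [exact: involution_mulgg..|exact: involution_chi1].
Qed.

Lemma chi_conj_class c (y z : involution G) :
  conj_class y = conj_class z -> chi c (inv_val y) = chi c (inv_val z).
Proof.
by move=> /(@eqmodP _ (conjugate_equiv_rel G))/asboolP[g ->]; rewrite chiJ.
Qed.

Lemma inv_val_continuous : continuous (@inv_val G).
Proof. exact: initial_continuous. Qed.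

(** The condition y != 1 is open, but by [involution_chi1] it can be replaced by the closed
    condition x(y) = 1. *)
Lemma involution_compact : compact [set: involution G].
Proof.
have c1 : closed [set 1%g : G].
  exact: (accessible_closed_set1 (hausdorff_accessible hG)).
pose A := [set y | chi x y = 1] `&` [set y : G | (y * y = 1)%g].
have cA : compact A.
  apply: (subclosed_compact _ cG) => //.
  apply: closedI; first exact: contF2_closed.
  exact: (preimage_closed (fun y _ => @square_continuous y) c1).
have inA (p : G) : A p -> exists y : involution G, inv_val y = p.
  move=> [xp pp].
  have Y : p \in [set y : G | y != 1%g /\ (y ^+ 2)%g = 1%g].
    apply: mem_set; split; last by rewrite expg2.
    by apply/eqP => p1; have : chi x p = 1 := xp; rewrite p1 chi1.
  by exists (exist _ p Y).
move=> F FF _.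
have FA : (@inv_val G @ F) A.
  apply: (@filterE _ F) => y; split; first exact: involution_chi1.
  exact: involution_mulgg.
have [p [Ap cp]] := cA _ (fmap_proper_filter _ FF) FA.
have [y ey] := inA _ Ap; exists y; split=> // V W FV.
move=> [_ [[O oO <-] Oy] OW].
have [||q [[z Vz ez] Oq]] := cp [set inv_val z | z in V] O _ _.
- by apply: (@filterS _ F _ V) => // z Vz; exists z.
- by apply: open_nbhs_nbhs; split=> //; rewrite -ey.
by exists z; split=> //; apply: OW; rewrite /preimage /= -[set_val z]/(inv_val z) ez.
Qed.

(** Periodicity divides b c by x, which is 1 at every involution. *)
Lemma chi_product (b c : gH (gpoint G) 1) : exists d : gH (gpoint G) 1,
  forall y : involution G,
  chi d (inv_val y) = chi b (inv_val y) * chi c (inv_val y).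
Proof.
have [sx _] := x_periodic; have [d ed] := sx _ (cup1 b c); exists d => y.
have yy := involution_mulgg y.
have := congr1 (@ev _ (inv_val y) _ (tt : gpoint G) _) ed.
by rewrite !ev_cup1 // !ev_point // involution_chi1 mul1r => ->.
Qed.

Lemma chi_interpolates (f : contF2 (conj_classes G)) : exists b : gH (gpoint G) 1,
  forall y : involution G, chi b (inv_val y) = f (conj_class y).
Proof.
have cf : continuous (@conj_class G) by exact: pi_continuous.
pose fY := contF2_comp cf f.
pose chiY b := contF2_comp inv_val_continuous (chi b).
have fYE y : fY y = f (conj_class y) by [].
have chiYE b y : chiY b y = chi b (inv_val y) by [].
have sep (s : involution G) : f (conj_class s) = 1 ->
    exists b, chi b (inv_val s) = 1 /\
      forall t, f (conj_class t) = 0 -> chi b (inv_val t) = 0.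
  move=> fs; apply: contrapT => nb.
  (* Otherwise the sets where f = 0 and b = 1, directed by products of the b with b(s) = 1, share a
     point t that no class separates from s. *)
  pose J := {b : gH (gpoint G) 1 | chi b (inv_val s) = 1}.
  pose F (b : J) := [set t | fY t = 0] `&` [set t | chiY (sval b) t = 1].
  have [|||t _ tF] := @directed_compact _ J setT F
    (exist _ x (involution_chi1 s)) involution_compact.
  - by move=> [b bs]; apply: closedI; exact: contF2_closed.
  - move=> [b bs] /=; apply: contrapT => h; apply: nb; exists b; split=> // t ft.
    by case: (F2P (chi b (inv_val t))) => // bt; case: h; exists t.
  - move=> [b bs] [c cs]; have [d ed] := chi_product b c.
    have ds : chi d (inv_val s) = 1 by rewrite ed bs cs mulr1.
    exists (exist _ d ds) => t [ft dt].
    have {}dt : chi d (inv_val t) = 1 := dt; rewrite ed in dt.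
    by have [bt ct] := F2_mul_eq1 dt; split; split.
  have [ft _] := tF (exist _ x (involution_chi1 s)).
  have E b : chi b (inv_val s) = 1 -> chi b (inv_val t) = 1.
    by move=> bs; have [_] := tF (exist _ b bs).
  have : conj_class s = conj_class t.
    apply: conj_class_eq => b; case: (F2P (chi b (inv_val s))) => bs.
      (* Where b(s) = 0, the class x + b is 1 at s, hence at t. *)
      have := E (x + b); rewrite !chiD bs !involution_chi1 addr0 => /(_ erefl) h.
      by apply: esym; apply: (addrI 1); rewrite h addr0.
    by rewrite bs E.
  have {}ft : f (conj_class t) = 0 := ft.
  by move=> e; move: ft; rewrite -e fs => /eqP.
(* Otherwise the classes b that vanish where f does, directed by the joins b + c + b c, all vanish
   at some s with f(s) = 1, against [sep]. *)
apply: contrapT => nb.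
pose J := {b : gH (gpoint G) 1 | forall t, f (conj_class t) = 0 -> chi b (inv_val t) = 0}.
have j0 : forall t, f (conj_class t) = 0 -> chi 0 (inv_val t) = 0.
  by move=> t _; exact: chi_zero.
pose F (b : J) := [set t | fY t = 1] `&` [set t | chiY (sval b) t = 0].
have [|||s _ sF] := @directed_compact _ J setT F (exist _ 0 j0) involution_compact.
- by move=> [b bs]; apply: closedI; exact: contF2_closed.
- move=> [b bt] /=; apply: contrapT => h; apply: nb; exists b => y.
  case: (F2P (f (conj_class y))) => fy; first by rewrite fy bt.
  rewrite fy; case: (F2P (chi b (inv_val y))) => // b0.
  by case: h; exists y.
- move=> [b bt] [c ct]; have [d ed] := chi_product b c.
  have et t : f (conj_class t) = 0 -> chi (b + c + d) (inv_val t) = 0.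
    by move=> ft; rewrite !chiD ed bt // ct // mul0r !addr0.
  exists (exist _ _ et) => t [ft dt].
  have {}dt : chi (b + c + d) (inv_val t) = 0 := dt; rewrite !chiD ed in dt.
  by have [b0 c0] := F2_join_eq0 dt; split; split.
have [fs _] := sF (exist _ 0 j0); have [b [bs bt]] := sep s fs.
have [_ b0] := sF (exist _ b bt).
by have : chi b (inv_val s) = 0 := b0; rewrite bs => /eqP.
Qed.

Fixpoint xpow n (b : gH (gpoint G) 1) : gH (gpoint G) n.+1 :=
  if n is m.+1 then cup1 x (xpow m b) else b.

Lemma xpow_surj n (c : gH (gpoint G) n.+1) : exists b, c = xpow n b.
Proof.
elim: n c => [|n IH] c; first by exists c.
by have [sx _] := x_periodic; have [d ->] := sx _ c; have [b ->] := IH d; exists b.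
Qed.

Lemma ev_xpow n b (y : involution G) :
  ev (inv_val y) (tt : gpoint G) (xpow n b) = chi b (inv_val y).
Proof.
have yy := involution_mulgg y.
elim: n => [|n IH] /=; first exact: ev_point.
by rewrite ev_cup1 // IH ev_point // involution_chi1 mul1r.
Qed.

(** In degree 2 this is the contrapositive of [exists_involution]; higher powers of x follow at
    once. *)
Lemma xpow_eq0 n b : (forall y : involution G, chi b (inv_val y) = 0) ->
  xpow n.+1 b = 0.
Proof.
move=> b0; elim: n => [|n IH]; last by rewrite /= -/(xpow n.+1 b) IH cup1_0r.
rewrite /=; apply: contrapT => /(exists_involution pro2 x_periodic x_square)[y by1 yy].
have Y : y \in [set y : G | y != 1%g /\ (y ^+ 2)%g = 1%g].
  apply: mem_set; split; last by rewrite expg2.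
  by apply/eqP => y1; move: by1; rewrite y1 chi1 => /eqP.
by have : chi b y = 0 := b0 (exist _ y Y); rewrite by1 => /eqP.
Qed.

Definition restriction_fun n (c : cohomology G n.+1) (q : conj_classes G) : 'F_2 :=
  ev (inv_val (repr q)) (tt : gpoint G) (to_point c).

(** The class is x^n b for some b, so its value at y is b(y), and a character is invariant under
    conjugation. The involution picked by [repr] is therefore immaterial. *)
Lemma restriction_funE n (c : cohomology G n.+1) (y : involution G) :
  restriction_fun c (conj_class y) = ev (inv_val y) (tt : gpoint G) (to_point c).
Proof.
have [b eb] := xpow_surj (to_point c).
rewrite /restriction_fun eb !ev_xpow; apply: chi_conj_class.
by rewrite /conj_class reprK.
Qed.

Lemma restriction_subproof n (c : cohomology G n.+1) :
  `[< continuousF2 (restriction_fun c) >].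
Proof.
apply/asboolP; apply/quotient_continuous.
have [b eb] := xpow_surj (to_point c).
have -> : restriction_fun c \o \pi_(conj_classes G)%qT =
    contF2_comp inv_val_continuous (chi b).
  apply: funext => y; rewrite /= -[LHS]/(restriction_fun c (conj_class y)).
  by rewrite restriction_funE eb ev_xpow.
by have /asboolP := contF2P (contF2_comp inv_val_continuous (chi b)).
Qed.

Definition restriction n (c : cohomology G n.+1) : contF2 (conj_classes G) :=
  ContF2 (restriction_subproof c).

Lemma restrictionE n (c : cohomology G n.+1) (y : involution G) :
  restriction c (conj_class y) = ev (inv_val y) (tt : gpoint G) (to_point c).
Proof. exact: restriction_funE. Qed.

Lemma conj_class_surj (q : conj_classes G) : exists y, q = conj_class y.
Proof. by exists (repr q); rewrite /conj_class reprK. Qed.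

Lemma restriction_is_zmod_morphism n : zmod_morphism (@restriction n).
Proof.
move=> a b; apply: contF2_eq => q; have [y ->] := conj_class_surj q.
rewrite contF2_addE contF2_oppE !restrictionE raddfB /=.
have N (c : gH (gpoint G) n.+1) : - c = c.
  by apply: (addIr c); rewrite addNr gH_char2.
rewrite N (evD (involution_mulgg y)) //.
by congr (_ + _); apply: F2_addr_eq0; rewrite addrN.
Qed.
HB.instance Definition _ n := GRing.isZmodMorphism.Build _ _
  (@restriction n) (@restriction_is_zmod_morphism n).

Lemma restriction_inj n : injective (@restriction n.+1).
Proof.
apply: raddf_inj => c c0; apply: to_point_inj; rewrite raddf0.
have [b eb] := xpow_surj (to_point c); rewrite eb; apply: xpow_eq0 => y.
by rewrite -(ev_xpow n.+1) -eb -restrictionE c0.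
Qed.

Lemma restriction_surj n f : exists c, @restriction n c = f.
Proof.
have [b bf] := chi_interpolates f; have [c ec] := to_point_surj (xpow n b).
exists c; apply: contF2_eq => q; have [y ->] := conj_class_surj q.
by rewrite restrictionE -ec ev_xpow bf.
Qed.

Lemma restriction_bij n : bijective (@restriction n.+1).
Proof.
have /choice[g gK] := @restriction_surj n.+1.
by exists g => // c; apply: restriction_inj; rewrite gK.
Qed.

(** * The subgroup generated by an involution *)

Section CyclicOfOrderTwo.
Variable y : involution G.
Local Notation U := (generated [set inv_val y]).
Local Notation C := (subgroup_type U).

Lemma in_generated g : g \in (U : set G) -> g = 1%g \/ g = inv_val y.
Proof.
have yy := involution_mulgg y.
move=> /set_mem Ug; have := Ug [set h | h = 1%g \/ h = inv_val y]; apply.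
split; last by move=> h ->; right.
have yV : (inv_val y)^-1%g = inv_val y by apply: (mulgI (inv_val y)); rewrite mulgV yy.
split; first by apply: mem_set; left.
move=> g1 g2 /set_mem e1 /set_mem e2; apply: mem_set; move: e1 e2.
by move=> [->|->] [->|->]; rewrite ?invg1 ?yV ?mulg1 ?mul1g ?yy /=; [left|right|right|left].
Qed.

Lemma gen_in : inv_val y \in (U : set G).
Proof. by apply: mem_set => H [_ HA]; apply: HA. Qed.

Definition gen : C := exist _ (inv_val y) gen_in.

Lemma gen_mulgg : (gen * gen = 1)%g.
Proof.
by apply: val_inj; rewrite valM val1; exact: involution_mulgg.
Qed.

Lemma order_two (g : C) : g = 1%g \/ g = gen.
Proof.
have [e|e] := in_generated (valP g); [left|right]; exact: val_inj.
Qed.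

Lemma bar_sum_val n (f : {ptws 'I_n -> G} -> 'F_2) :
  bar_sum gen (fun u : {ptws 'I_n -> C} => f (subgroup_tuple u)) =
  bar_sum (inv_val y) f.
Proof.
elim: n f => [|n IH] f /=.
  by congr f; apply: funext => -[].
have E (g : C) : bar_sum gen (fun u : {ptws 'I_n -> C} => f (subgroup_tuple (consx g u))) =
    bar_sum (inv_val y) (fun u => f (consx (val g) u)).
  rewrite -(IH (fun u => f (consx (val g) u))); congr bar_sum; apply: funext => u.
  congr f; apply: funext => i; rewrite /subgroup_tuple /consx.
  by case: (unlift ord0 i).
by rewrite !E val1.
Qed.

Lemma ev_res n (c : cohomology G n) :
  ev gen (tt : gpoint C) (to_point (res U c)) = ev (inv_val y) (tt : gpoint G) (to_point c).
Proof.
have yy := involution_mulgg y; have gg := gen_mulgg.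
elim/quotW: c => z; rewrite res_pi !to_point_pi !ev_cls //.
exact: bar_sum_val.
Qed.

(** The identification of the cohomology of this group of order two with F_2 in each degree. *)
Definition ev_gen n (c : cohomology C n) : 'F_2 := ev gen (tt : gpoint C) (to_point c).

Lemma ev_gen_is_zmod_morphism n : zmod_morphism (@ev_gen n).
Proof.
move=> a b; rewrite /ev_gen raddfB /=.
have N (c : gH (gpoint C) n) : - c = c.
  by apply: (addIr c); rewrite addNr gH_char2.
rewrite N (evD gen_mulgg) //.
by congr (_ + _); apply: F2_addr_eq0; rewrite addrN.
Qed.
HB.instance Definition _ n := GRing.isZmodMorphism.Build _ _
  (@ev_gen n) (@ev_gen_is_zmod_morphism n).

Lemma ev_gen_bij n : bijective (@ev_gen n).
Proof.
(* Because x(y) = 1, the restriction of x is the nontrivial character of {1, y}. *)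
pose f := contF2_comp (@val_subgroup_continuous G U) (chi x).
have f1y : f 1%g = 0 /\ f gen = 1.
  split; last exact: involution_chi1.
  by rewrite /f /= -[LHS]/(chi x (val (1%g : C))) val1 chi1.
have inj : injective (@ev_gen n).
  apply: raddf_inj => c c0; apply: to_point_inj; rewrite raddf0.
  exact: (order_two_ev_inj gen_mulgg order_two f1y c0).
have surj a : exists c, @ev_gen n c = a.
  have [->|->] := F2P a; first by exists 0; rewrite raddf0.
  have [c ec] := order_two_ev_surj gen_mulgg order_two f1y n.
  have [d ed] := to_point_surj c.
  by exists d; rewrite /ev_gen -ed.
have /choice[g gK] := surj.
by exists g => // c; apply: inj; rewrite gK.
Qed.
End CyclicOfOrderTwo.

Lemma restriction_is_restriction n : is_restriction_to_involutions (@restriction n).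
Proof.
move=> y; exists (@ev_gen y n.+1); split; first exact: ev_gen_bij.
by move=> c; rewrite restrictionE -ev_res.
Qed.
End Main.

Theorem corollary7p24 (G : topGroupType) :
  is_pro2 G ->
  cohomologically_quasi_boolean G ->
  forall i : nat, (0 < i)%N ->
  exists pi_i : {additive cohomology G i -> contF2 (conj_classes G)},
    [/\ is_restriction_to_involutions pi_i,
        (1 < i)%N -> bijective pi_i
      & i = 1%N -> forall f : contF2 (conj_classes G), exists c, pi_i c = f].
Proof.
move=> pro2 /quasi_boolean_periodic[x [x_periodic x_square]] [//|n] _.
exists (@restriction G x pro2 x_periodic n); split.
- exact: restriction_is_restriction.
- by case: n => // n _; exact: restriction_bij.
- by move=> _ f; exact: restriction_surj.
Qed.
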